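(* Let $M,M'\in\mathcal O^{\rm int}_-$ (respectively $M,M'\in\mathcal O^{\rm int}_+$) be modules with crystal bases $(\mathcal L,B)$ and $(\mathcal L',B')$. Let $B\otimes B'=\{b\otimes b'\in(\mathcal L/q\mathcal L)\otimes_{\mathbb Q}(\mathcal L'/q\mathcal L'): b\in B,\ b'\in B'\}$. Then $M\otimes M'$ has crystal basis $(\mathcal L\otimes_{\mathcal A}\mathcal L',B\otimes B')$, and for all $i\in I$, $b\in B$, $b'\in B'$, in $\mathcal L\otimes\mathcal L'/q(\mathcal L\otimes\mathcal L')$: $$\tilde f_i(b\otimes b')=\begin{cases}\tilde f_ib\otimes b'&\text{if }\varphi_i(b)>\varepsilon_i(b'),\\ \pi_i^{p(b)}\,b\otimes\tilde f_ib'&\text{otherwise;}\end{cases}\qquad \tilde e_i(b\otimes b')=\begin{cases}\pi_i^{p(b)}\,b\otimes\tilde e_ib'&\text{if }\varphi_i(b)<\varepsilon_i(b'),\\ \tilde e_ib\otimes b'&\text{otherwise.}\end{cases}$$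
   Context: **Root data.** $q$ is an indeterminate, $\pi$ a formal symbol with $\pi^2=1$; $R^\pi=R\otimes_{\mathbb Z}\mathbb Z[\pi]/(\pi^2-1)$. $I=I_0\sqcup I_1$ is a finite set with $I_1\neq\emptyset$, and $p(i)=t$ for $i\in I_t$. $(a_{ij})_{i,j\in I}$ is an integer matrix with $a_{ii}=2$; $a_{ij}\le 0$ for $i\ne j$; $a_{ij}=0\iff a_{ji}=0$; $a_{ij}\in2\mathbb Z$ if $i\in I_1$; there are $d_i\in\mathbb Z_{>0}$, $\gcd(d_i)=1$, with $(d_ia_{ij})$ symmetric; and $p(i)\equiv d_i \pmod 2$. $\mathfrak h$ is a finite-dimensional $\mathbb Q$-space with linearly independent sets $\{\alpha_i\}\subset\mathfrak h^*$, $\{\alpha_i^\vee\}\subset\mathfrak h$, $\langle\alpha_i^\vee,\alpha_j\rangle=a_{ij}$; $P\subset\mathfrak h^*$ is a lattice containing all $\alpha_j$ with $\langle\alpha_i^\vee,P\rangle\subseteq\mathbb Z$; $P^\vee=\{h\in\mathfrak h:\langle h,P\rangle\subseteq\mathbb Z\}$. Put $q_i=q^{d_i}$, $\pi_i=\pi^{p(i)}$, $[n]_i=\frac{(\pi_iq_i)^n-q_i^{-n}}{\pi_iq_i-q_i^{-1}}$, with factorials $[n]_i^!$ and binomials $\begin{bmatrix}n\\ a\end{bmatrix}_i$ accordingly. **Algebra.** $\mathbf U$ is the $\mathbb Q(q)^\pi$-superalgebra generated by $E_i,F_i$ (parity $p(i)$) and even $K_\mu,J_\mu$ ($i\in I,\mu\in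 P^\vee$) with relations: $K_0=1$, $K_\mu K_\nu=K_{\mu+\nu}$, $J_{2\mu}=1$, $J_\mu J_\nu=J_{\mu+\nu}$, $J_\mu K_\nu=K_\nu J_\mu$; $K_\mu E_i=q^{\langle\mu,\alpha_i\rangle}E_iK_\mu$, $J_\mu E_i=\pi^{\langle\mu,\alpha_i\rangle}E_iJ_\mu$, $K_\mu F_i=q^{-\langle\mu,\alpha_i\rangle}F_iK_\mu$, $J_\mu F_i=\pi^{-\langle\mu,\alpha_i\rangle}F_iJ_\mu$; $\sum_{s+t=1-a_{ij}}(-1)^s\pi_i^{sp(j)+\binom s2}\begin{bmatrix}1-a_{ij}\\ s\end{bmatrix}_iX_i^tX_jX_i^s=0$ for $i\ne j$ and $X=E$ or $X=F$; $E_iF_j-\pi^{p(i)p(j)}F_jE_i=\delta_{ij}\frac{\tilde J_i\tilde K_i-\tilde K_i^{-1}}{\pi_iq_i-q_i^{-1}}$, where $\tilde K_i=K_{d_i\alpha_i^\vee}$, $\tilde J_i=J_{d_i\alpha_i^\vee}$. $F_i^{(n)}=F_i^n/[n]_i^!$ (and $F_i^{(-1)}=0$). **Modules.** A weight module is a $\mathbb Z_2$-graded $\mathbf U$-module $M=\bigoplus_{\mu\in P}M^\mu$, $M^\mu=\{m:K_hm=q^{\langle h,\mu\rangle}m,\ J_hm=\pi^{\langle h,\mu\rangle}m\ \forall h\in P^\vee\}$, with $\mathbb Z_2$-graded weight spaces. $\mathcal O^{\rm int}$ is the category of weight modules on which all $E_i,F_i$ act locally nilpotently and such that for every $m\in M$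 all monomials in the $E_i$ of sufficiently large length kill $m$. $\mathcal O^{\rm int}_\pm$ is the subcategory of modules on which $\pi$ acts as $\pm1$. **Tensor product.** $\mathbf U\otimes\mathbf U$ has multiplication $(a\otimes b)(c\otimes d)=\pi^{p(b)p(c)}ac\otimes bd$, and acts on $M\otimes M'$ by $(a\otimes b)(m\otimes m')=\pi^{p(b)p(m)}am\otimes bm'$. $M\otimes M'$ is a $\mathbf U$-module via the coproduct $\Delta(E_i)=E_i\otimes\tilde K_i^{-1}+\tilde J_i\otimes E_i$, $\Delta(F_i)=F_i\otimes1+\tilde K_i\otimes F_i$, $\Delta(K_\mu)=K_\mu\otimes K_\mu$, $\Delta(J_\mu)=J_\mu\otimes J_\mu$. **Kashiwara operators.** For $M\in\mathcal O^{\rm int}$ each $m\in M^\mu$ is uniquely a finite sum $m=\sum_{t\ge0}F_i^{(t)}m_t$ with $m_t\in M^{\mu+t\alpha_i}$, $E_im_t=0$, $m_t=0$ unless $t\le\langle\alpha_i^\vee,\mu+t\alpha_i\rangle$; $\tilde e_im=\sum_tF_i^{(t-1)}m_t$, $\tilde f_im=\sum_tF_i^{(t+1)}m_t$. **Crystal basis of $M\in\mathcal O^{\rm int}_\pm$.** $\mathcal A\subset\mathbb Q(q)$ is the subring of functions regular at $q=0$. A pair $(\mathcal L,B)$, $\mathcal L$ a free $\mathcal A$-submodule of $M$, $B\subset\mathcal L/q\mathcal L$, such that: (1) $\mathcal L\otimes_{\mathcal A}\mathbb Q(q)=M$; (2) $\mathcal L=\bigoplus_\mu\mathcal L_\mu$,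 $\mathcal L_\mu=\mathcal L\cap M^\mu$; (3) $\tilde e_i\mathcal L\subseteq\mathcal L$, $\tilde f_i\mathcal L\subseteq\mathcal L$; (4) $B$ is a $\pi$-basis of the $\mathbb Q$-space $\mathcal L/q\mathcal L$, i.e. $B^0\subseteq B\subseteq B^0\cup\pi B^0$ for some $\mathbb Q$-basis $B^0$; (5) $B=\coprod_\mu B_\mu$, $B_\mu=B\cap\mathcal L_\mu/q\mathcal L_\mu$; (6) $\tilde e_iB\subseteq B\cup\{0\}$, $\tilde f_iB\subseteq B\cup\{0\}$; (7) for $b,b'\in B$: $\tilde e_ib=b'$ iff $b=\tilde f_ib'$. Lattices and $B$ are compatible with the $\mathbb Z_2$-grading, and $p(b)$ is the parity of $b$. For $b\in B$: $\varphi_i(b)=\max\{n:\tilde f_i^nb\ne0\}$, $\varepsilon_i(b)=\max\{n:\tilde e_i^nb\neq0\}$.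
   Formalization: For M, M' in O^int_- the operators need only preserve B⊗B' up to π (conditions (6),(7) are stated for B⊗B' ∪ π(B⊗B')), as (6) can fail literally; B⊗B' is a literal crystal basis if π acts as +1 or if B or B' is stable under π. *)

(* Defs.v *)
From HB Require Import structures.
From mathcomp Require Import all_boot all_order all_algebra.
From mathcomp Require Import generic_quotient sesquilinear.
From mathcomp Require Import boolp classical_sets.

Set Implicit Arguments.
Unset Strict Implicit.
Unset Printing Implicit Defensive.

Import Order.TTheory GRing.Theory Num.Theory.
Local Open Scope ring_scope.
Local Open Scope quotient_scope.
Local Open Scope classical_set_scope.

(* For a subring S of R, b is a basis of the S-submodule X of V.  Taking
   S smaller than R avoids restricting scalars. *)
Definition basis_over (R : nzRingType) (V : lmodType R) (S : set R)
    (b X : set V) : Prop :=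
  [/\ b `<=` X,
      forall x, X x <-> exists (t : seq V) (c : V -> R),
        [/\ uniq t, forall v, v \in t -> b v /\ S (c v)
          & x = \sum_(v <- t) c v *: v]
    & forall (t : seq V) (c : V -> R),
        uniq t -> (forall v, v \in t -> b v /\ S (c v)) ->
        \sum_(v <- t) c v *: v = 0 -> forall v, v \in t -> c v = 0].

(* X is the internal direct sum of the W j, j in J. *)
Definition direct_sum (V : zmodType) (T : choiceType) (J : set T)
    (W : T -> set V) (X : set V) : Prop :=
  [/\ forall j, J j -> W j `<=` X,
      forall x, X x -> exists (t : seq T) (w : T -> V),
        [/\ uniq t, forall j, j \in t -> J j /\ W j (w j)
          & x = \sum_(j <- t) w j]
    & forall (t : seq T) (w : T -> V),
        uniq t -> (forall j, j \in t -> J j /\ W j (w j)) ->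
        \sum_(j <- t) w j = 0 -> forall j, j \in t -> w j = 0].

(* The tensor product of two modules over a commutative ring R: a formal sum
   of pure tensors is a sequence of pairs, and two formal sums are identified
   when no R-bilinear map separates them.  The universal property is given by
   tlift, tliftE and tensor_ext below. *)
Section Tensor.
Variables (R : comNzRingType) (M M' : lmodType R).

Definition feval (N : lmodType R) (f : {bilinear M -> M' -> N})
    (t : seq (M * M')) : N := \sum_(p <- t) f p.1 p.2.

Definition feq (t u : seq (M * M')) : bool :=
  `[< forall (N : lmodType R) (f : {bilinear M -> M' -> N}),
        feval f t = feval f u >].

Lemma feq_refl : reflexive feq. Proof. by move=> t; apply/asboolP. Qed.
Lemma feq_sym : symmetric feq.
Proof. by move=> t u; apply/asboolP/asboolP => h N f; rewrite h. Qed.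
Lemma feq_trans : transitive feq.
Proof.
move=> u t v /asboolP h1 /asboolP h2; apply/asboolP => N f.
by rewrite h1 h2.
Qed.
Canonical feq_equiv := EquivRel feq feq_refl feq_sym feq_trans.

Definition tensor := {eq_quot feq}.
HB.instance Definition _ : EqQuotient _ feq tensor := EqQuotient.on tensor.
HB.instance Definition _ := Choice.on tensor.

Lemma tensor_eqP (t u : seq (M * M')) :
  (forall (N : lmodType R) (f : {bilinear M -> M' -> N}),
    feval f t = feval f u) <-> \pi_tensor t = \pi_tensor u.
Proof.
split; first by move=> h; apply/eqmodP; apply/asboolP.
by move=> /eqmodP /asboolP.
Qed.

Definition tlift_fun (N : lmodType R) (f : {bilinear M -> M' -> N})
  (x : tensor) : N := feval f (repr x).

Lemma tlift_pi (N : lmodType R) (f : {bilinear M -> M' -> N}) t :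
  tlift_fun f (\pi_tensor t) = feval f t.
Proof.
by apply: (proj2 (tensor_eqP (repr (\pi_tensor t)) t)); rewrite reprK.
Qed.

Lemma tensor_sep (x y : tensor) :
  (forall (N : lmodType R) (f : {bilinear M -> M' -> N}),
    tlift_fun f x = tlift_fun f y) -> x = y.
Proof.
move=> h; rewrite -[x]reprK -[y]reprK; apply: (proj1 (tensor_eqP _ _)).
exact: h.
Qed.

Definition tzero : tensor := \pi_tensor [::].
Definition tadd (x y : tensor) : tensor := \pi_tensor (repr x ++ repr y).
Definition tscale (a : R) (x : tensor) : tensor :=
  \pi_tensor [seq (a *: p.1, p.2) | p <- repr x].
Definition topp (x : tensor) : tensor := tscale (-1) x.

Lemma tlift0 (N : lmodType R) (f : {bilinear M -> M' -> N}) : tlift_fun f tzero = 0.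
Proof. by rewrite tlift_pi /feval big_nil. Qed.
Lemma tliftD (N : lmodType R) (f : {bilinear M -> M' -> N}) x y :
  tlift_fun f (tadd x y) = tlift_fun f x + tlift_fun f y.
Proof. by rewrite tlift_pi /feval big_cat. Qed.
Lemma tliftZ (N : lmodType R) (f : {bilinear M -> M' -> N}) a x :
  tlift_fun f (tscale a x) = a *: tlift_fun f x.
Proof.
rewrite tlift_pi /tlift_fun /feval big_map scaler_sumr.
by apply: eq_bigr => p _ /=; rewrite linearZl_LR.
Qed.

Lemma taddA : associative tadd.
Proof. by move=> x y z; apply: tensor_sep => N f; rewrite !tliftD addrA. Qed.
Lemma taddC : commutative tadd.
Proof. by move=> x y; apply: tensor_sep => N f; rewrite !tliftD addrC. Qed.
Lemma tadd0 : left_id tzero tadd.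
Proof. by move=> x; apply: tensor_sep => N f; rewrite tliftD tlift0 add0r. Qed.
Lemma taddN : left_inverse tzero topp tadd.
Proof.
move=> x; apply: tensor_sep => N f.
by rewrite tliftD tlift0 tliftZ scaleN1r addNr.
Qed.
HB.instance Definition _ := GRing.isZmodule.Build tensor taddA taddC tadd0 taddN.

Lemma tscaleA a b x : tscale a (tscale b x) = tscale (a * b) x.
Proof. by apply: tensor_sep => N f; rewrite !tliftZ scalerA. Qed.
Lemma tscale1 : left_id 1 tscale.
Proof. by move=> x; apply: tensor_sep => N f; rewrite tliftZ scale1r. Qed.
Lemma tscaleDr : right_distributive tscale +%R.
Proof.
by move=> a x y; apply: tensor_sep => N f; rewrite !(tliftD, tliftZ) scalerDr.
Qed.
Lemma tscaleDl x : {morph tscale^~ x : a b / a + b}.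
Proof.
by move=> a b; apply: tensor_sep => N f; rewrite !(tliftD, tliftZ) scalerDl.
Qed.
HB.instance Definition _ := GRing.Zmodule_isLmodule.Build R tensor
  tscaleA tscale1 tscaleDr tscaleDl.

Lemma tlift_is_linear (N : lmodType R) (f : {bilinear M -> M' -> N}) : linear (tlift_fun f).
Proof. by move=> a x y; rewrite tliftD tliftZ. Qed.
HB.instance Definition _ (N : lmodType R) (f : {bilinear M -> M' -> N}) :=
  GRing.isLinear.Build R tensor N _ (tlift_fun f) (@tlift_is_linear N f).
Definition tlift (N : lmodType R) (f : {bilinear M -> M' -> N}) : {linear tensor -> N} :=
  tlift_fun f.

Definition tens (m : M) (m' : M') : tensor := \pi_tensor [:: (m, m')].

Lemma tliftE (N : lmodType R) (f : {bilinear M -> M' -> N}) m m' :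
  tlift f (tens m m') = f m m'.
Proof. by rewrite [LHS]tlift_pi /feval big_seq1. Qed.

Lemma tens_is_bilinear :
  bilinear_for (GRing.Scale.Law.clone _ _ *:%R _)
               (GRing.Scale.Law.clone _ _ *:%R _) tens.
Proof.
split=> [u' a x y|u a x y]; apply: tensor_sep => N f.
  rewrite -/(tlift f _) -[RHS]/(tlift f _) linearP !tliftE.
  by rewrite linearPl.
rewrite -/(tlift f _) -[RHS]/(tlift f _) linearP !tliftE.
by rewrite linearPr.
Qed.
HB.instance Definition _ := bilinear_isBilinear.Build R M M' tensor _ _ tens
  tens_is_bilinear.

Lemma tensor_gen (x : tensor) : exists t : seq (M * M'),
  x = \sum_(p <- t) tens p.1 p.2.
Proof.
exists (repr x); apply: tensor_sep => N f.
rewrite -[RHS]/(tlift f _) linear_sum /=.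
by apply: eq_bigr => p _; rewrite tliftE.
Qed.

Lemma tensor_ext (N : lmodType R) (f g : {linear tensor -> N}) :
  (forall m m', f (tens m m') = g (tens m m')) -> f =1 g.
Proof.
move=> h x; have [t ->] := tensor_gen x.
by rewrite !linear_sum; apply: eq_bigr => p _; rewrite h.
Qed.

End Tensor.

Section TensorMap.
Variables (R : comNzRingType) (M M' N N' : lmodType R).
Variables (f : {linear M -> N}) (g : {linear M' -> N'}).

Definition tmap_fun (m : M) (m' : M') : tensor N N' := tens (f m) (g m').

Lemma tmap_fun_is_bilinear :
  bilinear_for (GRing.Scale.Law.clone _ _ *:%R _)
               (GRing.Scale.Law.clone _ _ *:%R _) tmap_fun.
Proof.
split=> [u' a x y|u a x y]; rewrite /tmap_fun linearP.
  by rewrite linearPl.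
by rewrite linearPr.
Qed.
HB.instance Definition _ := bilinear_isBilinear.Build R M M' (tensor N N') _ _
  tmap_fun tmap_fun_is_bilinear.

Definition tmap : {linear tensor M M' -> tensor N N'} := tlift tmap_fun.

Lemma tmapE m m' : tmap (tens m m') = tens (f m) (g m').
Proof. exact: tliftE. Qed.

End TensorMap.

Definition Qq : fieldType := {fraction {poly rat}}.

(* Q(q)^pi = Q(q)[pi]/(pi^2 - 1) *)
Definition Qqpi : comUnitRingType := {poly %/ ('X^2 - 1 : {poly Qq})}.

Definition emb (x : Qq) : Qqpi := qpolyC ('X^2 - 1 : {poly Qq}) x.
Definition embQ (c : rat) : Qqpi := emb (tofrac c%:P).
Definition qq : Qqpi := emb (tofrac 'X).
Definition ppi : Qqpi := qpolyX ('X^2 - 1 : {poly Qq}).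

Lemma ppi2 : ppi ^+ 2 = 1.
Proof.
have m : ('X^2 - 1 : {poly Qq}) \is monic by rewrite -[1]/(1%:P) monicXnsubC.
have s : size ('X^2 - 1 : {poly Qq}) = 3%N.
  by rewrite -[1]/(1%:P) size_XnsubC.
have mk : mk_monic ('X^2 - 1 : {poly Qq}) = 'X^2 - 1 by rewrite /mk_monic s m.
rewrite /ppi /qpolyX -rmorphXn /=.
have e : ('X^2 : {poly Qq}) = ('X^2 - 1) + 1 by rewrite subrK.
set h := 'X^2 - 1 in mk e *; rewrite e in_qpolyD in_qpoly1.
rewrite (_ : in_qpoly h h = 0) ?add0r //; apply: val_inj => /=.
by rewrite mk Pdiv.RingMonic.rmodpp.
Qed.

(* The scalars Q(q) and the subring A of functions regular at q = 0, inside
   Q(q)^pi. *)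
Definition Qq_scal : set Qqpi := range emb.
Definition regular0 (x : Qq) : Prop :=
  exists n d : {poly rat}, d.[0] != 0 /\ x = tofrac n / tofrac d.
Definition A_scal : set Qqpi := emb @` regular0.

Lemma A_embQ c : A_scal (embQ c).
Proof.
exists (tofrac c%:P) => //; exists c%:P, 1.
by rewrite hornerC oner_neq0 tofrac1 divr1.
Qed.

Lemma embQ_is_zmod_morphism : zmod_morphism embQ.
Proof. by move=> a b; rewrite /embQ /emb !raddfB. Qed.
HB.instance Definition _ := GRing.isZmodMorphism.Build rat Qqpi embQ
  embQ_is_zmod_morphism.
Lemma embQ_is_monoid_morphism : monoid_morphism embQ.
Proof. by split=> [|a b]; rewrite /embQ /emb ?rmorph1 // !rmorphM. Qed.
HB.instance Definition _ := GRing.isMonoidMorphism.Build rat Qqpi embQ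
  embQ_is_monoid_morphism.

Record root_data := RootData {
  rI : finType;
  par : rI -> bool;                       (* par i iff i lies in I_1 *)
  cartan : rI -> rI -> int;
  rd : rI -> nat;
  hh : vectType rat;
  alpha : rI -> 'Hom(hh, rat^o);
  alphav : rI -> hh;
  Pwt : set 'Hom(hh, rat^o);
  par_nonempty : exists i, par i;
  cartan_diag : forall i, cartan i i = 2;
  cartan_offdiag : forall i j, i != j -> cartan i j <= 0;
  cartan_eq0 : forall i j, cartan i j = 0 <-> cartan j i = 0;
  cartan_even : forall i j, par i -> (2 %| cartan i j)%Z;
  rd_gt0 : forall i, (0 < rd i)%N;
  rd_gcd : \big[gcdn/0%N]_(i : rI) rd i = 1%N;
  rd_sym : forall i j, (rd i)%:Z * cartan i j = (rd j)%:Z * cartan j i;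
  par_rd : forall i, odd (rd i) = par i;
  alpha_free : free [seq alpha i | i : rI];
  alphav_free : free [seq alphav i | i : rI];
  alpha_alphav : forall i j, alpha j (alphav i) = (cartan i j)%:~R;
  (* P is a full lattice: the Z-span of a Q-basis of the dual of hh *)
  Pwt_lattice : exists b : seq 'Hom(hh, rat^o), basis_of fullv b /\
    forall mu, Pwt mu <->
      exists z : nat -> int, mu = \sum_(k < size b) b`_k *~ z k;
  alpha_Pwt : forall i, Pwt (alpha i);
  alphav_int : forall i mu, Pwt mu -> mu (alphav i) \is a Num.int
}.

Section Modules.
Variable D : root_data.
Local Notation I := (rI D).
Local Notation wt := 'Hom(hh D, rat^o).

Definition Pcowt : set (hh D) :=
  [set h | forall mu, Pwt mu -> mu h \is a Num.int].

(* The integer <h, mu>, for h in P^vee and mu in P: an integral rational is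
   its own numerator. *)
Definition ipair (h : hh D) (mu : wt) : int := numq (mu h).

Definition q_ (i : I) : Qqpi := qq ^+ rd i.
Definition pi_ (i : I) : Qqpi := ppi ^+ par i.

Definition qint (i : I) (n : nat) : Qqpi :=
  ((pi_ i * q_ i) ^+ n - (q_ i)^-1 ^+ n) / (pi_ i * q_ i - (q_ i)^-1).
Definition qfact (i : I) (n : nat) : Qqpi := \prod_(1 <= k < n.+1) qint i k.
Definition qbin (i : I) (n a : nat) : Qqpi :=
  qfact i n / (qfact i a * qfact i (n - a)).

(* A Q(q)^pi-module with operators for the generators of U; it is a graded
   U-module when these satisfy the defining relations of U (is_Umodule).  The
   grading is given by its projections: M_t = {m | gr t m = m}. *)
Record Udata := UData {
  car :> lmodType Qqpi;
  gr : bool -> {linear car -> car};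
  opE : I -> {linear car -> car};
  opF : I -> {linear car -> car};
  opK : hh D -> {linear car -> car};
  opJ : hh D -> {linear car -> car}
}.
Arguments gr {u}.
Arguments opE {u}.
Arguments opF {u}.
Arguments opK {u}.
Arguments opJ {u}.

Definition is_graded (M : Udata) : Prop :=
  (forall (t u : bool) (m : M), gr t (gr u m) = if t == u then gr u m else 0)
  /\ (forall m : M, gr false m + gr true m = m).

Definition Kt (M : Udata) (i : I) : {linear M -> M} :=
  opK (alphav i *+ rd i).
Definition Ktinv (M : Udata) (i : I) : {linear M -> M} :=
  opK (- (alphav i *+ rd i)).
Definition Jt (M : Udata) (i : I) : {linear M -> M} :=
  opJ (alphav i *+ rd i).

Definition serre (M : Udata) (X : I -> {linear M -> M}) : Prop :=
  forall (i j : I) (m : M), i != j ->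
    let n := `|1 - cartan i j|%N in
    \sum_(s < n.+1)
      ((-1) ^+ s * pi_ i ^+ (s * par j + 'C(s, 2)) * qbin i n s) *:
      iter (n - s) (X i) (X j (iter s (X i) m)) = 0.

(* K and J are only meaningful on P^vee; their values elsewhere are not
   constrained. *)
Definition is_Umodule (M : Udata) : Prop :=
  [/\ is_graded M,
      (forall t (m : M) i,
         [/\ opE i (gr t m) = gr (t (+) par i) (opE i m)
           & opF i (gr t m) = gr (t (+) par i) (opF i m)]) /\
      (forall t (m : M) h, Pcowt h ->
         opK h (gr t m) = gr t (opK h m) /\ opJ h (gr t m) = gr t (opJ h m)),
      forall (h k : hh D) (m : M), Pcowt h -> Pcowt k ->
        [/\ opK 0 m = m, opK (h + k) m = opK h (opK k m),
            opJ (h *+ 2) m = m, opJ (h + k) m = opJ h (opJ k m)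
          & opJ h (opK k m) = opK k (opJ h m)],
      forall (h : hh D) (i : I) (m : M), Pcowt h ->
        [/\ opK h (opE i m) = qq ^ ipair h (alpha i) *: opE i (opK h m),
            opJ h (opE i m) = ppi ^ ipair h (alpha i) *: opE i (opJ h m),
            opK h (opF i m) = qq ^ (- ipair h (alpha i)) *: opF i (opK h m)
          & opJ h (opF i m) = ppi ^ (- ipair h (alpha i)) *: opF i (opJ h m)]
    & [/\ serre (@opE M), serre (@opF M)
        & forall (i j : I) (m : M),
          opE i (opF j m) - ppi ^+ (par i * par j) *: opF j (opE i m) =
          if i == j then
            (pi_ i * q_ i - (q_ i)^-1)^-1 *: (Jt M i (Kt M i m) - Ktinv M i m)
          else 0]].

Definition wtspace (M : Udata) (mu : wt) : set M :=
  [set m | forall h, Pcowt h ->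
     opK h m = qq ^ ipair h mu *: m /\ opJ h m = ppi ^ ipair h mu *: m].

Arguments wtspace : clear implicits.

Definition is_weight_module (M : Udata) : Prop :=
  [/\ is_Umodule M,
      direct_sum (@Pwt D) (wtspace M) [set: M]
    & forall mu, Pwt mu -> forall t (m : M),
        wtspace M mu m -> wtspace M mu (gr t m)].

Definition in_Oint (M : Udata) : Prop :=
  [/\ is_weight_module M,
      forall i (m : M), exists n, iter n (opE i) m = 0,
      forall i (m : M), exists n, iter n (opF i) m = 0
    & forall m : M, exists n, forall w : seq I, (n <= size w)%N ->
        foldr (fun i x => opE i x) m w = 0].

(* O^int_+ for s = false and O^int_- for s = true *)
Definition in_Oint_pm (s : bool) (M : Udata) : Prop :=
  in_Oint M /\ forall m : M, ppi *: m = (-1) ^+ s *: m.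

(* m |-> pi ^ (t * p(m)) m for m homogeneous *)
Definition sgn_op (M : Udata) (t : bool) : {linear M -> M} :=
  gr false \+ (ppi ^+ t \*: gr true).

Section TensorU.
Variables M M' : Udata.

(* The action of a (x) b, with b of parity t:
   m (x) m' |-> pi ^ (t * p(m)) a m (x) b m' *)
Definition stens (t : bool) (a : {linear M -> M}) (b : {linear M' -> M'}) :
    {linear tensor M M' -> tensor M M'} :=
  tmap (a \o sgn_op M t) b.

Definition tensU : Udata := {|
  car := tensor M M';
  gr := fun t => stens false (gr t) (gr false) \+
                 stens false (gr (~~ t)) (gr true);
  opE := fun i => stens false (opE i) (Ktinv M' i) \+
                  stens (par i) (Jt M i) (opE i);
  opF := fun i => stens false (opF i) idfun \+
                  stens (par i) (Kt M i) (opF i);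
  opK := fun h => stens false (opK h) (opK h);
  opJ := fun h => stens false (opJ h) (opJ h)
|}.

End TensorU.

Definition divF (M : Udata) (i : I) (n : nat) (m : M) : M :=
  (qfact i n)^-1 *: iter n (opF i) m.

(* F_i^(n-1), with F_i^(-1) = 0 *)
Definition divF_pred (M : Udata) (i : I) (n : nat) (m : M) : M :=
  if n is n'.+1 then divF i n' m else 0.

(* A vector of M is the sum of its weight components m_mu, mu in t, each
   written as \sum_(k < n) F_i^(k) (c mu k). *)
Definition kdecomp (M : Udata) (i : I) (t : seq wt) (n : nat)
    (c : wt -> nat -> M) : Prop :=
  uniq t /\ forall mu, mu \in t -> Pwt mu /\ forall k,
    [/\ wtspace M (mu + alpha i *+ k) (c mu k), opE i (c mu k) = 0
      & ~~ (k%:Z <= ipair (alphav i) (mu + alpha i *+ k)) -> c mu k = 0].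

Arguments kdecomp : clear implicits.

Definition etilde (M : Udata) (i : I) (m : M) : M :=
  xget 0 [set x | exists t n c, [/\ kdecomp M i t n c,
    m = \sum_(mu <- t) \sum_(k < n) divF i k (c mu k)
  & x = \sum_(mu <- t) \sum_(k < n) divF_pred i k (c mu k)]].

Definition ftilde (M : Udata) (i : I) (m : M) : M :=
  xget 0 [set x | exists t n c, [/\ kdecomp M i t n c,
    m = \sum_(mu <- t) \sum_(k < n) divF i k (c mu k)
  & x = \sum_(mu <- t) \sum_(k < n) divF i k.+1 (c mu k)]].

End Modules.

Arguments gr {D u}.
Arguments wtspace {D} M mu.
Arguments etilde {D} M i m.
Arguments ftilde {D} M i m.

Record Asubmod (V : lmodType Qqpi) := ASubmod {
  aset : set V;
  aset0 : aset 0;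
  asetD : forall x y, aset x -> aset y -> aset (x + y);
  asetZ : forall a x, A_scal a -> aset x -> aset (a *: x)
}.

Section ASpan.
Variables (V : lmodType Qqpi) (X : set V).
Definition Aspan_set : set V :=
  [set x | forall N : Asubmod V, X `<=` aset N -> aset N x].
Lemma Aspan0 : Aspan_set 0.
Proof. by move=> N _; exact: aset0. Qed.
Lemma AspanD x y : Aspan_set x -> Aspan_set y -> Aspan_set (x + y).
Proof. by move=> hx hy N XN; apply: asetD; [exact: hx|exact: hy]. Qed.
Lemma AspanZ a x : A_scal a -> Aspan_set x -> Aspan_set (a *: x).
Proof. by move=> Aa hx N XN; apply: asetZ => //; exact: hx. Qed.
Definition Aspan : Asubmod V := ASubmod Aspan0 AspanD AspanZ.
End ASpan.

(* lquo L is V / q L, with its structure of Q-vector space; L / q L is its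
   subspace Lbar L below. *)
Section LQuo.
Variables (V : lmodType Qqpi) (L : Asubmod V).

Definition lcong (x y : V) : bool := `[< exists2 l, aset L l & x - y = qq *: l >].

Lemma lcong_refl : reflexive lcong.
Proof.
by move=> x; apply/asboolP; exists 0; [exact: aset0|rewrite subrr scaler0].
Qed.
Lemma Laset_embQ c l : aset L l -> aset L (embQ c *: l).
Proof. by apply: asetZ; exact: A_embQ. Qed.
Lemma Laset_opp l : aset L l -> aset L (- l).
Proof. by move=> /(Laset_embQ (-1)); rewrite rmorphN1 scaleN1r. Qed.
Lemma lcong_sym : symmetric lcong.
Proof.
suff h x y : lcong x y -> lcong y x by move=> x y; apply/idP/idP; exact: h.
move=> /asboolP[l Ll e]; apply/asboolP; exists (- l); first exact: Laset_opp.
by rewrite scalerN -e opprB.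
Qed.
Lemma lcong_trans : transitive lcong.
Proof.
move=> y x z /asboolP[l Ll e] /asboolP[k Lk e']; apply/asboolP.
by exists (l + k); [exact: asetD|rewrite scalerDr -e -e' subrKA].
Qed.
Canonical lcong_equiv := EquivRel lcong lcong_refl lcong_sym lcong_trans.

Definition lquo := {eq_quot lcong}.
HB.instance Definition _ : EqQuotient _ lcong lquo := EqQuotient.on lquo.
HB.instance Definition _ := Choice.on lquo.

Definition cls (x : V) : lquo := \pi_lquo x.

Lemma clsP (x y : V) : (exists2 l, aset L l & x - y = qq *: l) <-> cls x = cls y.
Proof.
split=> [h|/eqmodP/asboolP //]; by apply/eqmodP/asboolP.
Qed.

Lemma cls_repr x : cls (repr x) = x. Proof. exact: reprK. Qed.

Definition lqadd (x y : lquo) : lquo := cls (repr x + repr y).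
Definition lqscale (c : rat) (x : lquo) : lquo := cls (embQ c *: repr x).
Definition lqopp (x : lquo) : lquo := lqscale (-1) x.

Lemma clsD x y : cls (x + y) = lqadd (cls x) (cls y).
Proof.
have /clsP[l Ll e] := esym (cls_repr (cls x)).
have /clsP[k Lk e'] := esym (cls_repr (cls y)).
apply/clsP; exists (l + k); first exact: asetD.
by rewrite scalerDr -e -e' opprD addrACA.
Qed.
Lemma clsZ c x : cls (embQ c *: x) = lqscale c (cls x).
Proof.
have /clsP[l Ll e] := esym (cls_repr (cls x)).
apply/clsP; exists (embQ c *: l); first exact: Laset_embQ.
by rewrite -scalerBr e !scalerA mulrC.
Qed.

Lemma lqaddA : associative lqadd.
Proof.
move=> x y z; rewrite -[x]cls_repr -[y]cls_repr -[z]cls_repr.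
by rewrite -!clsD addrA.
Qed.
Lemma lqaddC : commutative lqadd.
Proof. by move=> x y; rewrite /lqadd addrC. Qed.
Lemma lqadd0 : left_id (cls 0) lqadd.
Proof. by move=> x; rewrite -[x]cls_repr -clsD add0r. Qed.
Lemma lqaddN : left_inverse (cls 0) lqopp lqadd.
Proof.
move=> x; rewrite -[x]cls_repr /lqopp -clsZ -clsD.
by rewrite rmorphN1 scaleN1r addNr.
Qed.
HB.instance Definition _ := GRing.isZmodule.Build lquo
  lqaddA lqaddC lqadd0 lqaddN.

Lemma cls0 : cls 0 = 0. Proof. by []. Qed.
Lemma clsDr x y : cls (x + y) = cls x + cls y. Proof. exact: clsD. Qed.

Lemma lqscaleA a b x : lqscale a (lqscale b x) = lqscale (a * b) x.
Proof. by rewrite -[x]cls_repr -!clsZ scalerA rmorphM. Qed.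
Lemma lqscale1 : left_id 1 lqscale.
Proof. by move=> x; rewrite -[x]cls_repr -clsZ rmorph1 scale1r. Qed.
Lemma lqscaleDr : right_distributive lqscale +%R.
Proof.
move=> a x y; rewrite -[x]cls_repr -[y]cls_repr -clsDr -!clsZ -clsDr.
by rewrite scalerDr.
Qed.
Lemma lqscaleDl x : {morph lqscale^~ x : a b / a + b}.
Proof.
by move=> a b; rewrite -[x]cls_repr -!clsZ -clsDr rmorphD scalerDl.
Qed.
HB.instance Definition _ := GRing.Zmodule_isLmodule.Build rat lquo
  lqscaleA lqscale1 lqscaleDr lqscaleDl.

Definition Lbar : set lquo := cls @` aset L.

(* The operator induced on V / q L by an operator on V; it is only
   meaningful on L / q L and for f preserving L and q L. *)
Definition lqop (f : V -> V) (x : lquo) : lquo := cls (f (repr x)).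

Lemma lqopE (f : V -> V) x : (forall y z, f (y + z) = f y + f z) ->
  (forall l, aset L l -> exists2 l', aset L l' & f (qq *: l) = qq *: l') ->
  lqop f (cls x) = cls (f x).
Proof.
move=> fD fL; have /clsP[l Ll e] := cls_repr (cls x).
have [l' Ll' e'] := fL l Ll; apply/clsP; exists l' => //.
have -> : repr (cls x) = qq *: l + x by rewrite -e subrK.
by rewrite fD addrK e'.
Qed.

End LQuo.

Section Crystal.
Variables (D : root_data) (M : Udata D) (L : Asubmod M).
Implicit Types (B : set (lquo L)) (b : lquo L).

Definition qpi : lquo L -> lquo L := lqop (fun x : M => ppi *: x).
Definition qetilde (i : rI D) : lquo L -> lquo L := lqop (etilde M i).
Definition qftilde (i : rI D) : lquo L -> lquo L := lqop (ftilde M i).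

(* For L free over A, L (x)_A Q(q) -> M is an isomorphism when an A-basis of L
   is a Q(q)-basis of M. *)
Definition crystal_lattice : Prop :=
  [/\ exists b : set M,
        basis_over A_scal b (aset L) /\ basis_over Qq_scal b [set: M],
      direct_sum (@Pwt D) (fun mu => aset L `&` wtspace M mu) (aset L),
      forall t m, aset L m -> aset L (gr t m)
    & forall i m, aset L m -> aset L (etilde M i m) /\ aset L (ftilde M i m)].

Definition hom_part (t : bool) : set (lquo L) :=
  @cls M L @` [set m | aset L m /\ gr t m = m].
Definition wt_part (mu : 'Hom(hh D, rat^o)) : set (lquo L) :=
  @cls M L @` (aset L `&` wtspace M mu).

Definition graded_pi_basis B : Prop :=
  [/\ exists B0 : set (lquo L),
        [/\ basis_over [set: rat] B0 (@Lbar M L), B0 `<=` B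
          & B `<=` B0 `|` qpi @` B0],
      forall b, B b -> exists! mu, Pwt mu /\ wt_part mu b
    & forall b, B b -> exists t, hom_part t b].

Definition crystal_operators B : Prop :=
  (forall i b, B b -> (B `|` [set 0]) (qetilde i b) /\
                      (B `|` [set 0]) (qftilde i b)) /\
  (forall i b b', B b -> B b' -> (qetilde i b = b' <-> b = qftilde i b')).

Definition crystal_basis B : Prop :=
  [/\ crystal_lattice, graded_pi_basis B & crystal_operators B].

Definition pi_closure B : set (lquo L) := B `|` qpi @` B.

(* As crystal_basis, except that the operators preserve B up to pi only, and
   exchange e~_i b = b' and b = f~_i b' on all of B u pi B.  This is what
   {b (x) b'} satisfies when pi = -1 and neither factor is stable under pi: for
   i odd and M = M' spanned by v and F_i v, v even, B = B' = {v, F_i v}, one has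
   f~_i (F_i v (x) v) = pi (F_i v (x) F_i v), which is not in B (x) B'. *)
Definition crystal_basis_upto_pi B : Prop :=
  [/\ crystal_lattice, graded_pi_basis B & crystal_operators (pi_closure B)].

Definition parity b : bool := `[< hom_part true b >].

Definition phi (i : rI D) b : nat :=
  xget 0%N [set n | iter n (qftilde i) b != 0 /\
                    forall k, iter k (qftilde i) b != 0 -> (k <= n)%N].
Definition epsilon (i : rI D) b : nat :=
  xget 0%N [set n | iter n (qetilde i) b != 0 /\
                    forall k, iter k (qetilde i) b != 0 -> (k <= n)%N].

End Crystal.

Arguments qpi {D M} L _.
Arguments qetilde {D M} L i _.
Arguments qftilde {D M} L i _.
Arguments crystal_basis {D M} L B.
Arguments crystal_basis_upto_pi {D M} L B.
Arguments phi {D M L} i b.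
Arguments epsilon {D M L} i b.
Arguments parity {D M L} b.

Section TensorCrystal.
Variables (D : root_data) (M M' : Udata D).
Variables (L : Asubmod M) (L' : Asubmod M').

(* L (x)_A L', as a submodule of M (x) M' *)
Definition ltens : Asubmod (tensU M M') :=
  Aspan [set x : tensU M M' |
    exists l l', [/\ aset L l, aset L' l' & x = tens l l']].

(* b (x) b', under the identification of L/qL (x) L'/qL' with
   (L (x) L')/q(L (x) L') *)
Definition qtens (b : lquo L) (b' : lquo L') : lquo ltens :=
  @cls (tensU M M') ltens (tens (repr b) (repr b')).

Lemma qtensE (l : M) (l' : M') : aset L l -> aset L' l' ->
  qtens (cls L l) (cls L' l') = @cls (tensU M M') ltens (tens l l').
Proof.
move=> Ll Ll'; have /clsP[k Lk e] := cls_repr (cls L l).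
have /clsP[k' Lk' e'] := cls_repr (cls L' l').
set r := repr (cls L l) in e *; set r' := repr (cls L' l') in e' *.
have Er : r = qq *: k + l by rewrite -e subrK.
have Er' : r' = qq *: k' + l' by rewrite -e' subrK.
have Lr : aset L r.
  rewrite Er; apply: asetD => //; apply: asetZ => //.
  exists (tofrac 'X) => //; exists 'X, 1.
  by rewrite hornerC oner_neq0 tofrac1 divr1.
apply/clsP; exists (tens k l' + tens r k').
  apply: asetD => N XN; apply: XN; first by exists k, l'.
  by exists r, k'.
change (tens r r' - tens l l' = qq *: (tens k l' + tens r k')).
rewrite Er' linearDr linearZr_LR /= [in tens r l']Er linearDl linearZl_LR /=.
by rewrite scalerDr addrA addrK addrC.
Qed.

Definition qtens_set (B : set (lquo L)) (B' : set (lquo L')) :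
    set (lquo ltens) :=
  [set x | exists b b', [/\ B b, B' b' & x = qtens b b']].

End TensorCrystal.

Arguments ltens {D M M'} L L'.
Arguments qtens {D M M' L L'} b b'.
Arguments qtens_set {D M M' L L'} B B'.

(* Main.v *)
(*
  Fix i.  Under Delta, a tensor of two rank one strings has basis
  x_(a, b) = F^(a) u (x) F^(b) v with E u = E v = 0, of highest weights m and m',
  on which E and F act by explicit two-term formulas.  For h <= m, m', solving
  E w = 0 in the span of the x_(a, h - a) gives w_h with F^(k) w_h congruent to
  x_(k, h) modulo q for k + h <= m; symmetrically, from a lowest weight vector
  one gets, up to a power of pi, the x_(a, b) with a + b >= m.  By Nakayama's
  lemma the A-span of the x_(a, b) is stable under the Kashiwara operators, and
  modulo q each x_(a, b) is a divided power of F on a highest weight vector;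
  this gives both the tensor product rule and the exchange of e~_i and f~_i.

  A crystal lattice is spanned by vectors F^(n) u with u in the lattice and
  E u = 0, and each b in B is the class of such a vector with n = epsilon_i(b)
  and m - n = phi_i(b), so the rank one computation applies to L (x) L'.

  For the Serre relations on M (x) M', the Serre polynomial is a composite of
  twisted commutators Z |-> X_i Z - c_k Z X_i.  Composed in one order on
  the first half of Delta(X_j), and in the opposite order on the second, they
  act, up to scalars, through a single tensor factor.
*)
Require Import Defs.
From HB Require Import structures.
From mathcomp Require Import all_boot all_order all_algebra.
From mathcomp Require Import generic_quotient sesquilinear.
From mathcomp Require Import boolp classical_sets.
From mathcomp Require Import zify ring.

Set Implicit Arguments.
Unset Strict Implicit.
Unset Printing Implicit Defensive.

Import Order.TTheory GRing.Theory Num.Theory.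
Local Open Scope ring_scope.
Local Open Scope classical_set_scope.

(** * q-integers over a ring localized at q *)

(** A congruence modulo q can be pushed through e~ or f~ only once the lattice is known to be stable
    under them, so Nakayama's lemma has to come before any tensor product formula.

    The rank one calculus runs over A[pi], with p standing for pi_i. This ring is not local, having
    the two reductions pi = 1 and pi = -1 at q = 0; the axioms of [local_at] only put q in its
    Jacobson radical, which is what Nakayama's lemma uses. The specialization of pi to a sign enters
    when lattices over A and bases over Q(q) appear.

    Two families of strings are needed because the estimate for F^(k) w_h stops at k = m - h. Up to
    there the second summand of Delta(F) contributes a positive power of q to the leading terms; at
    k = m - h its order drops to 0 and it starts to compete with the first summand. The strings
    built upwards from lowest weight vectors cover the rest.

    Along those, the leading coefficients are signs, and the ratio of two consecutive ones is the
    sign pi_i^p(b) of the tensor product rule. *)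

Record local_at (R : comUnitRingType) (A : set R) (q : R) : Prop := LocalAt {
  local1 : A 1;
  localB : forall a b, A a -> A b -> A (a - b);
  localM : forall a b, A a -> A b -> A (a * b);
  localq : A q;
  localU : q \is a GRing.unit;
  localV : forall a, A a -> 1 - q * a \is a GRing.unit /\ A (1 - q * a)^-1
}.

(** The index is an integer because the q-integers of weights occur, and these may be negative. *)
HB.lock Definition qnum (R : comUnitRingType) (p q : R) (n : int) : R :=
  ((p * q) ^ n - q ^ (- n)) / (p * q - q^-1).

HB.lock Definition qnum_fact (R : comUnitRingType) (p q : R) (n : nat) : R :=
  \prod_(1 <= k < n.+1) qnum p q k.

Lemma exprzMu (R : comUnitRingType) (x y : R) (n : int) :
  x \is a GRing.unit -> y \is a GRing.unit -> (x * y) ^ n = x ^ n * y ^ n.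
Proof. by move=> ux uy; rewrite exprMz_comm //; exact: mulrC. Qed.

Lemma qnum_def (R : comUnitRingType) (p q : R) (n : int) :
  qnum p q n = ((p * q) ^ n - q ^ (- n)) / (p * q - q^-1).
Proof. by rewrite qnum.unlock. Qed.

Lemma qnum_fact_def (R : comUnitRingType) (p q : R) (n : nat) :
  qnum_fact p q n = \prod_(1 <= k < n.+1) qnum p q k.
Proof. by rewrite qnum_fact.unlock. Qed.

Section Local.
Variables (R : comUnitRingType) (A : set R) (q : R).
Hypothesis HA : local_at A q.

Lemma local0 : A 0.
Proof. by rewrite -(subrr 1); apply: (localB HA); exact: (local1 HA). Qed.

Lemma localN a : A a -> A (- a).
Proof. by move=> Aa; rewrite -sub0r; apply: (localB HA) => //; exact: local0. Qed.

Lemma localD a b : A a -> A b -> A (a + b).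
Proof. by move=> Aa Ab; rewrite -[b]opprK; apply: (localB HA) => //; exact: localN. Qed.

Lemma localX a n : A a -> A (a ^+ n).
Proof.
move=> Aa; elim: n => [|n ih]; first by rewrite expr0; exact: (local1 HA).
by rewrite exprS; apply: (localM HA).
Qed.

(** The condition that the q-adic order is at least [k]. Negative [k] are essential, since [n] has a
    pole of order n - 1 at q = 0. *)
Definition ord_ge (k : int) (x : R) : Prop := A (q ^ (- k) * x).

Let uq := localU HA.

Lemma ord_ge0 x : ord_ge 0 x <-> A x.
Proof. by rewrite /ord_ge oppr0 expr0z mul1r. Qed.

Lemma ord_geD k x y : ord_ge k x -> ord_ge k y -> ord_ge k (x + y).
Proof. by rewrite /ord_ge mulrDr; exact: localD. Qed.

Lemma ord_geN k x : ord_ge k x -> ord_ge k (- x).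
Proof. by rewrite /ord_ge mulrN; exact: localN. Qed.

Lemma ord_ge_zero k : ord_ge k 0.
Proof. by rewrite /ord_ge mulr0; exact: local0. Qed.

Lemma ord_geM k l x y : ord_ge k x -> ord_ge l y -> ord_ge (k + l) (x * y).
Proof.
rewrite /ord_ge => hx hy; rewrite opprD exprzDr // mulrACA.
exact: (localM HA).
Qed.

Lemma ord_geMA k x y : A x -> ord_ge k y -> ord_ge k (x * y).
Proof. by move=> /ord_ge0 hx hy; rewrite -[k]add0r; exact: ord_geM. Qed.

Lemma ord_ge_exp (k : int) : ord_ge k (q ^ k).
Proof. by rewrite /ord_ge -exprzDr // addNr expr0z; exact: (local1 HA). Qed.

Lemma ord_ge_weak k l x : (l <= k)%R -> ord_ge k x -> ord_ge l x.
Proof.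
rewrite /ord_ge => lk hx.
have -> : q ^ (- l) * x = q ^+ `|k - l|%N * (q ^ (- k) * x).
  rewrite mulrA; congr (_ * _); rewrite -[X in X * _]/(q ^ (`|k - l|%N : int)).
  by rewrite -exprzDr //; congr (_ ^ _); lia.
by apply: (localM HA) => //; apply: localX; exact: (localq HA).
Qed.

Lemma ord_ge1 x : ord_ge 1 x -> exists2 a, A a & x = q * a.
Proof.
rewrite /ord_ge => h; exists (q ^ (-1) * x) => //.
by rewrite mulrA -{1}[q]expr1z -exprzDr // expr0z mul1r.
Qed.

Lemma ord_ge1q a : A a -> ord_ge 1 (q * a).
Proof.
move=> Aa; rewrite /ord_ge mulrA -{2}[q]expr1z -exprzDr //.
by rewrite expr0z mul1r.
Qed.

Lemma one_ord_ge1 x : ord_ge 1 (x - 1) -> x \is a GRing.unit /\ A x^-1.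
Proof.
move=> /ord_ge1[a Aa e].
have -> : x = 1 - q * (- a) by rewrite mulrN opprK -e addrC subrK.
by apply: (localV HA); exact: localN.
Qed.

Lemma one_ord_geM x y : ord_ge 1 (x - 1) -> ord_ge 1 (y - 1) -> ord_ge 1 (x * y - 1).
Proof.
move=> hx hy.
have -> : x * y - 1 = (x - 1) * (y - 1) + ((x - 1) + (y - 1)) by ring.
apply: ord_geD; last exact: ord_geD.
by apply: (ord_ge_weak _ (ord_geM hx hy)).
Qed.

Lemma one_ord_geA x : ord_ge 1 (x - 1) -> A x.
Proof.
move=> h0; have /ord_ge0 h : ord_ge 0 (x - 1) by exact: ord_ge_weak h0.
rewrite -[x](subrK 1).
by apply: localD => //; exact: (local1 HA).
Qed.

Lemma one_ord_geV x : ord_ge 1 (x - 1) -> ord_ge 1 (x^-1 - 1).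
Proof.
move=> h; have [ux Ax] := one_ord_ge1 h.
have -> : x^-1 - 1 = x^-1 * - (x - 1).
  by rewrite mulrN mulrBr mulVr // mulr1 opprB.
by apply: ord_geMA => //; exact: ord_geN.
Qed.

Variable p : R.
Hypotheses (Ap : A p) (pp : p * p = 1).

Lemma pK n : p ^+ n * p ^+ n = 1.
Proof. by rewrite -exprMn pp expr1n. Qed.

Lemma unit_p : p \is a GRing.unit.
Proof. by apply/unitrP; exists p. Qed.

Lemma invp : p^-1 = p.
Proof. by apply: (mulrI unit_p); rewrite divrr ?unit_p. Qed.

Lemma unit_pX n : p ^+ n \is a GRing.unit.
Proof. by rewrite unitrX // unit_p. Qed.

Let D := p * q - q^-1.

Let DE : D = - q^-1 * (1 - q * (p * q)).
Proof. by rewrite mulNr mulrBr mulr1 mulKr // opprB. Qed.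

Let uD : D \is a GRing.unit.
Proof.
rewrite DE unitrM unitrN unitrV uq /=.
by have [|//] := localV HA (a := p * q); apply: (localM HA) => //; exact: (localq HA).
Qed.

Lemma unit_qnum_den : p * q - q^-1 \is a GRing.unit.
Proof. exact: uD. Qed.

Lemma qnumE n : D * qnum p q n = (p * q) ^ n - q ^ (- n).
Proof. by rewrite qnum_def mulrC divrK. Qed.

Lemma qnum1 : qnum p q 1 = 1.
Proof. by rewrite qnum_def expr1z -[q ^ _]/(q^-1) divrr. Qed.

(** Numerator and denominator of [n + 1] are - q^(-n-1) and - q^(-1) times elements of 1 + qA. *)
Lemma qnum_lead (n : nat) : exists2 u, qnum p q n.+1 = q ^ (- n%:Z) * u &
  ord_ge 1 (u - 1).
Proof.
exists (q ^ (n%:Z) * qnum p q n.+1).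
  by rewrite mulrA -exprzDr // addNr expr0z mul1r.
set a := p ^+ n.+1 * q ^+ (n + n).+1; set b := p * q.
have Aa : A a by apply: (localM HA); apply: localX => //; exact: (localq HA).
have Ab : A b by apply: (localM HA) => //; exact: (localq HA).
have [u1 _] := localV HA Ab.
have -> : q ^ n%:Z * qnum p q n.+1 = (1 - q * a) * (1 - q * b)^-1.
  apply: (mulrI uD); rewrite mulrCA qnumE.
  have -> : D * ((1 - q * a) * (1 - q * b)^-1) = - q^-1 * (1 - q * a).
    by rewrite DE -/b -mulrA [(1 - q * b) * _]mulrCA divrr // mulr1.
  rewrite !mulrBr -exprzDr // (_ : n%:Z - n.+1%:Z = -1); last by lia.
  rewrite mulr1 [in RHS]mulNr [in RHS]mulrA [in RHS]mulVr // mul1r -[q ^ -1]/(q^-1).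
  rewrite -[(p * q) ^ _]/((p * q) ^+ n.+1) exprMn /a !exprS exprD.
  by rewrite -[q ^ n%:Z]/(q ^+ n); ring.
apply: one_ord_geM; last apply: one_ord_geV; rewrite addrAC subrr sub0r;
  apply: ord_geN; exact: ord_ge1q.
Qed.

Lemma unit_qnumS (n : nat) : qnum p q n.+1 \is a GRing.unit.
Proof.
have [u -> /one_ord_ge1[uu _]] := qnum_lead n.
by rewrite unitrM uu andbT unitrXz.
Qed.

Lemma qnumN (n : nat) : qnum p q (- n%:Z) = - p ^+ n * qnum p q n.
Proof.
apply: (mulrI uD); rewrite qnumE mulrCA qnumE opprK.
rewrite !exprzMu ?unit_p // -[p ^ n%:Z]/(p ^+ n) -[q ^ n%:Z]/(q ^+ n).
rewrite -[p ^ (- n%:Z)]exprz_inv invp -[p ^ n%:Z]/(p ^+ n).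
by rewrite mulrBr mulrA mulNr pK; ring.
Qed.

Lemma unit_qnum (n : int) : n != 0 -> qnum p q n \is a GRing.unit.
Proof.
case: n => [[|n]|n] // _; first exact: unit_qnumS.
by rewrite NegzE qnumN mulNr unitrN unitrM unit_pX unit_qnumS.
Qed.

(** The induction step of [E_iterF]: moving E past one more F adds the q-integer of the weight
    reached so far. *)
Lemma qnum_sl2 (j : nat) (r : int) :
  p ^+ j * (qnum p q j * qnum p q (r - j%:Z + 1)) + qnum p q (r - (2 * j)%:Z) =
  p ^+ j * (qnum p q j.+1 * qnum p q (r - j%:Z)).
Proof.
apply: (mulrI uD); apply: (mulrI uD).
have -> : D * (D * (p ^+ j * (qnum p q j.+1 * qnum p q (r - j%:Z)))) =
  p ^+ j * ((D * qnum p q j.+1) * (D * qnum p q (r - j%:Z))) by ring.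
have -> : D * (D * (p ^+ j * (qnum p q j * qnum p q (r - j%:Z + 1))
    + qnum p q (r - (2 * j)%:Z))) =
  p ^+ j * ((D * qnum p q j) * (D * qnum p q (r - j%:Z + 1))) +
  D * (D * qnum p q (r - (2 * j)%:Z)) by ring.
have upq : p * q \is a GRing.unit by rewrite unitrM unit_p uq.
rewrite !qnumE /D.
have -> : (p * q) ^ (r - (2 * j)%:Z) = p ^+ j * (q ^ (- j%:Z) * (p * q) ^ (r - j%:Z)).
  have -> : r - (2 * j)%:Z = (- j%:Z) + (r - j%:Z) by lia.
  rewrite (exprzDr upq (- j%:Z) (r - j%:Z)) mulrA; congr (_ * _); rewrite exprzMu ?unit_p //.
  by rewrite -[p ^ (- j%:Z)]exprz_inv invp.
have -> : q ^ (- (r - (2 * j)%:Z)) = p ^+ j * ((p * q) ^ j * q ^ (- (r - j%:Z))).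
  have -> : - (r - (2 * j)%:Z) = j%:Z + (- (r - j%:Z)) by lia.
  rewrite (exprzDr uq j%:Z) mulrA; congr (_ * _); rewrite exprzMu ?unit_p // mulrA.
  by rewrite -[p ^ j%:Z]/(p ^+ j) pK mul1r.
have -> : j.+1%:Z = j%:Z + 1 by lia.
rewrite !opprD !exprzDr // !expr1z -[q ^ (-1)]/(q^-1).
by ring.
Qed.

Lemma qnum_factS n : qnum_fact p q n.+1 = qnum_fact p q n * qnum p q n.+1.
Proof. by rewrite !qnum_fact_def big_nat_recr. Qed.

Lemma qnum_fact0 : qnum_fact p q 0 = 1.
Proof. by rewrite qnum_fact_def big_geq. Qed.

Lemma unit_qnum_fact n : qnum_fact p q n \is a GRing.unit.
Proof.
elim: n => [|n ih]; first by rewrite qnum_fact0 unitr1.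
by rewrite qnum_factS unitrM ih unit_qnumS.
Qed.
End Local.

Lemma iterS_lin (R : nzRingType) (V : lmodType R) (f : {linear V -> V}) n a (v : V) :
  iter n f (a *: v) = a *: iter n f v.
Proof. by elim: n => //= n ->; rewrite linearZ. Qed.

Lemma iter_linD (R : nzRingType) (V : lmodType R) (f : {linear V -> V}) n (v w : V) :
  iter n f (v + w) = iter n f v + iter n f w.
Proof. by elim: n => //= n ->; rewrite linearD. Qed.

Lemma iter_lin0 (R : nzRingType) (V : lmodType R) (f : {linear V -> V}) n :
  iter n f (0 : V) = 0.
Proof. by elim: n => //= n ->; rewrite linear0. Qed.

Lemma iter_lin_sum (R : nzRingType) (V : lmodType R) (f : {linear V -> V}) n
  I (r : seq I) (P : pred I) (F : I -> V) :
  iter n f (\sum_(i <- r | P i) F i) = \sum_(i <- r | P i) iter n f (F i).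
Proof.
by apply: (big_morph (iter n f)); [exact: iter_linD|exact: iter_lin0].
Qed.

HB.lock Definition divpow (R : comUnitRingType) (p q : R) (V : lmodType R)
  (f : V -> V) (n : nat) (v : V) : V := (qnum_fact p q n)^-1 *: iter n f v.

Lemma divpow_def (R : comUnitRingType) (p q : R) (V : lmodType R)
  (f : V -> V) (n : nat) (v : V) :
  divpow p q f n v = (qnum_fact p q n)^-1 *: iter n f v.
Proof. by rewrite divpow.unlock. Qed.

(** * Strings for a rank one subalgebra *)

Section RankOne.
Variables (R : comUnitRingType) (A : set R) (q : R).
Hypothesis HA : local_at A q.
Variable p : R.
Hypotheses (Ap : A p) (pp : p * p = 1).
Variables (V : lmodType R) (E F : {linear V -> V}).
(** [W k] stands for the weight space of mu + k alpha_i and [r0] for the weight of mu at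
    alpha_i^vee, so that [r0 + 2 * k] is the weight of [W k]. *)
Variables (W : int -> set V) (r0 : int).
Hypothesis W0 : forall k, W k 0.
Hypothesis WD : forall k v w, W k v -> W k w -> W k (v + w).
Hypothesis WZ : forall k a v, W k v -> W k (a *: v).
Hypothesis WE : forall k v, W k v -> W (k + 1) (E v).
Hypothesis WF : forall k v, W k v -> W (k - 1) (F v).
Hypothesis EF : forall k v, W k v ->
  E (F v) - p *: F (E v) = qnum p q (r0 + 2 * k) *: v.
Hypothesis nilF : forall v, exists n, iter n F v = 0.

Local Notation qn := (qnum p q).
Local Notation wt k := (r0 + 2 * k).

Local Notation Fd := (divpow p q F).

Lemma W_iterF n k v : W k v -> W (k - n%:Z) (iter n F v).
Proof.
move=> Wv; elim: n => [|n ih] /=; first by rewrite subr0.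
by have := WF ih; congr (W _ _); lia.
Qed.

(** The term in E v is kept because [iterF_desc] applies this where only F E v = 0 is known. *)
Lemma E_iterF j k v : W k v ->
  E (iter j.+1 F v) = p ^+ j.+1 *: iter j.+1 F (E v)
    + (p ^+ j * ((qn j.+1) * (qn (wt k - j%:Z)))) *: iter j F v.
Proof.
move=> Wv; elim: j => [|j ih].
  rewrite /= expr1 expr0 mul1r (qnum1 HA Ap) mul1r subr0 -(EF Wv).
  by rewrite addrC subrK.
have /(canRL (subrK _)) -> /= := EF (W_iterF j.+1 Wv).
rewrite ih linearD !linearZ /= scalerDr !scalerA -exprS addrCA.
congr (_ + _); rewrite -scalerDl; congr (_ *: _).
have -> : wt (k - j.+1%:Z) = wt k - (2 * j.+1)%:Z by lia.
rewrite -(qnum_sl2 HA Ap pp j.+1 (wt k)) addrC; congr (_ + _).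
have -> : wt k - j.+1%:Z + 1 = wt k - j%:Z by lia.
by rewrite exprS mulrA.
Qed.

Lemma divpow0 (f : V -> V) v : divpow p q f 0 v = v.
Proof. by rewrite !divpow_def qnum_fact0 invr1 scale1r. Qed.

Lemma W_Fd n k v : W k v -> W (k - n%:Z) (Fd n v).
Proof. by move=> Wv; rewrite divpow_def; apply: WZ; exact: W_iterF. Qed.

Lemma divpowD n v w : Fd n (v + w) = Fd n v + Fd n w.
Proof. by rewrite !divpow_def iter_linD scalerDr. Qed.

Lemma divpowZ n a v : Fd n (a *: v) = a *: Fd n v.
Proof. by rewrite !divpow_def iterS_lin !scalerA mulrC. Qed.

Lemma divpow_zero n : Fd n 0 = 0.
Proof. by rewrite !divpow_def iter_lin0 scaler0. Qed.

Lemma F_Fd n v : F (Fd n v) = (qn n.+1) *: Fd n.+1 v.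
Proof.
rewrite !divpow_def linearZ /= scalerA; congr (_ *: _).
rewrite qnum_factS invrM ?(unit_qnum_fact HA) ?(unit_qnumS HA) //.
by rewrite mulrA divrr ?mul1r ?(unit_qnumS HA).
Qed.

Lemma E_Fd n k u : W k u -> E u = 0 ->
  E (Fd n.+1 u) = (p ^+ n * (qn (wt k - n%:Z))) *: Fd n u.
Proof.
move=> Wu Eu; rewrite !divpow_def linearZ /= -/(iter n.+1 F u) (E_iterF n Wu) Eu.
rewrite iter_lin0 scaler0 add0r !scalerA; congr (_ *: _).
rewrite qnum_factS invrM ?(unit_qnum_fact HA) ?(unit_qnumS HA) //.
set g := (qnum_fact _ _ _)^-1; set r := (qn (_ - _)); set u' := (qn _).
rewrite (_ : u'^-1 * g * _ = (u'^-1 * u') * (p ^+ n * r * g)); last by ring.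
by rewrite mulVr ?mul1r ?(unit_qnumS HA).
Qed.

(* The coefficient of F^j v in E F^(j+1) v is a unit for j >= j0, so that the
   nilpotency of F descends to j0. *)
Lemma iterF_desc j0 k v : W k v -> F (E v) = 0 ->
  (forall j : nat, (j0 <= j)%N -> wt k != j%:Z) -> iter j0 F v = 0.
Proof.
move=> Wv FE hj; have [s hs] := nilF v.
have : iter (j0 + s) F v = 0 by rewrite iterD hs iter_lin0.
elim: s {hs} => [|s ih]; first by rewrite addn0.
rewrite addnS => h; apply: ih.
have := E_iterF (j0 + s) Wv; rewrite h linear0 iterSr FE iter_lin0.
rewrite scaler0 add0r => /esym/(congr1 (fun x => (p ^+ (j0 + s) *
  ((qn ((j0 + s).+1)) * (qn (wt k - (j0 + s)%:Z))))^-1 *: x)).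
rewrite scalerA mulVr ?scale1r ?scaler0 //.
rewrite !unitrM (unit_pX pp) /=.
apply/andP; split; apply: (unit_qnum HA) => //; rewrite subr_eq0.
by rewrite hj // leq_addr.
Qed.

Lemma highest_wt_ge0 k u : W k u -> E u = 0 -> u != 0 -> 0 <= wt k.
Proof.
move=> Wu Eu; apply: contraNT => lt0; apply/eqP.
apply: (@iterF_desc 0 k) => // [|j _]; first by rewrite Eu linear0.
by lia.
Qed.

Lemma iterF_eq0 n k u : W k u -> E u = 0 -> wt k < n%:Z -> iter n F u = 0.
Proof.
move=> Wu Eu lt; apply: (@iterF_desc n k) => // [|j hj]; first by rewrite Eu linear0.
by lia.
Qed.

Lemma Fd_eq0 n k u : W k u -> E u = 0 -> wt k < n%:Z -> Fd n u = 0.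
Proof. by move=> Wu Eu lt; rewrite !divpow_def (iterF_eq0 Wu) // scaler0. Qed.

(** The last clause forces c_k = 0 where F^(k) would kill it anyway; this is what makes the c_k
    unique. *)
Definition string_decomp (l : int) (c : nat -> V) : Prop :=
  forall k : nat, [/\ W (l + k%:Z) (c k), E (c k) = 0
    & ~~ (k%:Z <= wt (l + k%:Z)) -> c k = 0].

(** Induction on the order of nilpotency of E at m. The strings of E m are lifted by one more F,
    with coefficients chosen so that E returns E m; this fails for at most one k, whose term is the
    bottom of its string. The remainder [m1] thus satisfies F E m1 = 0. If the weight is nonnegative
    the exceptional k does not occur and E m1 = 0; if it is negative, [iterF_desc] gives m1 = 0. *)
Lemma string_decomp_exists n l m : W l m -> iter n E m = 0 ->
  exists2 c, string_decomp l c & m = \sum_(k < n) Fd k (c k).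
Proof.
elim: n l m => [|n ih] l m Wm /=.
  move=> m0; exists (fun=> 0); last by rewrite big_ord0.
  by move=> k; split=> //; rewrite linear0.
rewrite -[E (iter n E m)]/(iter n.+1 E m) iterSr => Enm; have [c hc Em] := ih _ _ (WE Wm) Enm.
(* The excluded k is the one for which E F^(k+1) c_k = 0. *)
pose a (k : nat) : R := if k%:Z == - wt l - 2 then 0 else (p ^+ k * (qn (wt l + k%:Z + 2)))^-1.
have hW k : W (l + k.+1%:Z) (c k) by have [+ _ _] := hc k; congr (W _ _); lia.
have EFc k : E (Fd k.+1 (c k)) = (p ^+ k * (qn (wt l + k%:Z + 2))) *: Fd k (c k).
  have [_ Ec _] := hc k; rewrite (E_Fd _ (hW k) Ec); congr (_ * (qn _) *: _); lia.
pose m1 := m - \sum_(k < n) Fd k.+1 (a k *: c k).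
have Wm1 : W l m1.
  apply: WD => //; rewrite -scaleN1r; apply: WZ.
  elim/big_ind: _ => // [v w|k _]; first exact: WD.
  have := W_Fd k.+1 (WZ (a k) (hW k)); congr (W _ _); lia.
have Em1 : E m1 = \sum_(k < n) if (k%:Z == - wt l - 2) then Fd k (c k) else 0.
  rewrite linearB linear_sum /= {1}Em -sumrB; apply: eq_bigr => k _.
  rewrite divpowZ linearZ /= EFc scalerA /a; case: ifP => [_|hk].
    by rewrite mul0r scale0r subr0.
  rewrite mulVr ?scale1r ?subrr // unitrM (unit_pX pp).
  by apply: (unit_qnum HA) => //; lia.
have FEm1 : F (E m1) = 0.
  rewrite Em1 linear_sum big1 // => k _; case: ifP => [hk|_]; last by rewrite linear0.
  have [_ Ec _] := hc k.
  rewrite F_Fd (Fd_eq0 (hW k) Ec) ?scaler0 //; lia.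
have m1_0 : ~~ (0 <= wt l) -> m1 = 0.
  by move=> lt; apply: (@iterF_desc 0 l) => // j _; lia.
have Em1_0 : E m1 = 0.
  have [le|/m1_0 ->] := boolP (0 <= wt l); last by rewrite linear0.
  by rewrite Em1 big1 // => k _; case: ifP => // hk; lia.
exists (fun k => if k is k'.+1 then a k' *: c k' else m1).
  move=> [|k]; first by split; rewrite ?addr0.
  have [_ Ec c0] := hc k; split; first exact: WZ.
    by rewrite linearZ /= Ec scaler0.
  move=> hk; rewrite /a; case: ifP => [|hk']; first by rewrite scale0r.
  by rewrite c0 ?scaler0 //; lia.
rewrite big_ord_recl divpow0 /= /m1.
by rewrite (eq_bigr (fun k : 'I_n => Fd k.+1 (a k *: c k))) // subrK.
Qed.

Lemma iterE_Fd n k u j : W k u -> E u = 0 -> (j <= n)%N -> n%:Z <= wt k ->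
  exists2 a, a \is a GRing.unit & iter j E (Fd n u) = a *: Fd (n - j) u.
Proof.
move=> Wu Eu; elim: j => [|j ih] jn nk.
  by exists 1; rewrite ?unitr1 //= subn0 scale1r.
have [a ua e] := ih (ltnW jn) nk.
exists (a * (p ^+ (n - j.+1) * (qn (wt k - (n - j.+1)%:Z)))).
  rewrite !unitrM ua (unit_pX pp) /=.
  by apply: (unit_qnum HA) => //; lia.
rewrite iterS e linearZ /= -scalerA; congr (_ *: _).
by rewrite -(E_Fd _ Wu Eu); congr (E (Fd _ u)); lia.
Qed.

Lemma iterE_Fd0 n k u j : W k u -> E u = 0 -> (n < j)%N -> iter j E (Fd n u) = 0.
Proof.
move=> Wu Eu; have h n' : iter n'.+1 E (Fd n' u) = 0.
  elim: n' => [|n' ih]; first by rewrite divpow0 /= Eu.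
  by rewrite iterSr (E_Fd _ Wu Eu) iterS_lin ih scaler0.
by move=> nj; rewrite -(subnK nj) iterD h iter_lin0.
Qed.

(** Applying E^n, with n the largest index, kills the shorter strings and returns a unit multiple of
    c_n. *)
Lemma string_decomp_uniq n l c : string_decomp l c ->
  \sum_(k < n) Fd k (c k) = 0 -> forall k, (k < n)%N -> c k = 0.
Proof.
move=> hc; elim: n => // n ih; rewrite big_ord_recr /= => s0.
suff cn : c n = 0.
  move=> k; rewrite ltnS leq_eqVlt => /predU1P[->//|]; apply: ih.
  by move: s0; rewrite cn divpow_zero addr0.
have [Wc Ec c0] := hc n.
have [nk|/c0//] := boolP (n%:Z <= wt (l + n%:Z)).
have /(congr1 (iter n E)) := s0.
rewrite iter_lin0 iter_linD iter_lin_sum big1 ?add0r; last first.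
  by move=> k _; have [Wk Ek _] := hc k; rewrite (iterE_Fd0 Wk Ek).
have [a ua ->] := iterE_Fd Wc Ec (leqnn n) nk.
rewrite subnn divpow0 => /(congr1 (fun x => a^-1 *: x)).
by rewrite scalerA mulVr // scale1r scaler0.
Qed.

(** In a string decomposition of z, the equation F z = 0 and uniqueness kill c_k for k > N, while
    the admissibility clause already gives c_k = 0 for k < N. Only F^(N) c_N remains. *)
Lemma lowest_wt_vector (N : nat) l z : W l z -> wt l = - N%:Z -> F z = 0 ->
  (exists n, iter n E z = 0) ->
  exists y, [/\ W (l + N%:Z) y, E y = 0 & z = Fd N y].
Proof.
move=> Wz wl Fz [n nz]; have [c hc ez] := string_decomp_exists Wz nz.
pose c' k := if k is k'.+1 then (qn k) *: c k' else 0.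
(* The terms dropped here are those with F^(k) c'_k = 0, so that the sum is unchanged and the
   decomposition becomes admissible. *)
pose c'' (k : nat) := if ~~ (k%:Z <= wt (l - 1 + k%:Z)) then 0 else c' k.
have hc'' : string_decomp (l - 1) c''.
  move=> k; rewrite /c''; case: ifP => [_|hk]; first by split=> //; rewrite linear0.
  split=> //; case: k hk => [|k] hk //=; rewrite ?linear0 //.
    by have [+ _ _] := hc k => Wc; apply: WZ; move: Wc; congr (W _ _); lia.
  by have [_ Ec _] := hc k; rewrite linearZ /= Ec scaler0.
have s0 : \sum_(k < n.+1) Fd k (c'' k) = 0.
  rewrite -[RHS]Fz ez linear_sum big_ord_recl {1}/c'' /c' /=.
  rewrite if_same divpow_zero add0r; apply: eq_bigr => k _.
  rewrite (_ : bump 0 k = k.+1) // F_Fd /c'' /=; case: ifP => hk; last by rewrite divpowZ.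
  rewrite divpow_zero; have [Wc Ec c0] := hc k.
  by rewrite (Fd_eq0 Wc Ec) ?scaler0 //; lia.
have c0 k : (k < n)%N -> k != N -> c k = 0.
  move=> kn kN; have := string_decomp_uniq hc'' s0 (k := k.+1) kn.
  rewrite /c'' /c'; case: ifP => [hk _|hk].
    by have [_ _ c0] := hc k; apply: c0; lia.
  move=> /(congr1 (fun x => (qn k.+1)^-1 *: x)).
  by rewrite scalerA mulVr ?scale1r ?scaler0 ?(unit_qnumS HA).
have [Nn|Nn] := ltnP N n.
  exists (c N); have [Wc Ec _] := hc N; split=> //.
  rewrite ez (bigD1 (Ordinal Nn)) //= big1 ?addr0 // => k kN.
  by rewrite c0 ?divpow_zero.
exists 0; split=> //; rewrite ?linear0 // divpow_zero ez big1 // => k _.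
by rewrite c0 ?divpow_zero //; have := ltn_ord k; lia.
Qed.
End RankOne.

(** * q-adic estimates along a string, and Nakayama's lemma *)

Section Estimate.
Variables (R : comUnitRingType) (A : set R) (q : R).
Hypothesis HA : local_at A q.
Variable p : R.
Hypotheses (Ap : A p) (pp : p * p = 1).
Variable V : lmodType R.

Local Notation qn := (qnum p q).
Local Notation ord := (ord_ge A q).

Lemma ord_ge_eq k l x : ord l x -> k = l -> ord k x.
Proof. by move=> h ->. Qed.

Lemma qnum_ord (n : int) : 0 < n ->
  [/\ ord (1 - n) (qn n), ord (n - 1) (qn n)^-1 & (qn n)^-1 * (qn n) = 1].
Proof.
case: n => [[|n]|] // _; have [u e hu] := qnum_lead HA Ap n.
have [uu Au] := one_ord_ge1 HA hu.
have un := unit_qnumS HA Ap n.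
split; last by rewrite mulVr.
- rewrite e mulrC; apply: ord_ge_eq (ord_geM HA (l := - n%:Z) _ _) _.
  + by apply/ord_ge0; exact: (one_ord_geA HA hu).
  + exact: ord_ge_exp.
  + by lia.
- rewrite e invrM ?unitrXz ?(localU HA) //.
  apply: ord_ge_eq (ord_geM HA (k := 0) (l := n%:Z) _ _) _.
  + by apply/ord_ge0.
  + by rewrite invr_expz opprK; exact: ord_ge_exp.
  + by lia.
Qed.

Section HighestWeightVector.
Variables (Psi : {linear V -> V}) (x : nat -> nat -> V) (m m' h : nat).
Variables (t1 t2 : nat -> nat -> R).
Hypotheses (At1 : forall a b, A (t1 a b)) (At2 : forall a b, A (t2 a b)).
Hypothesis t1K : forall a b, t1 a b * t1 a b = 1.
Hypothesis Psi_x : forall a b, (a <= m)%N -> (b <= m')%N ->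
  Psi (x a b) =
    (t1 a b * (qn (m%:Z - a%:Z + 1)) * q ^ ((2 * b)%:Z - m'%:Z)) *:
      (if a is a'.+1 then x a' b else 0) +
    (t2 a b * (qn (m'%:Z - b%:Z + 1))) *: (if b is b'.+1 then x a b' else 0).
Hypotheses (hm : (h <= m)%N) (hm' : (h <= m')%N).

(** The recursion makes the coefficient of x_(a, h-a-1) in the image under [Psi] vanish; the sign
    [t1] is its own inverse. [Psi] is E in [tensor_upper] and F, with reversed indices, in
    [tensor_lower]. *)
Fixpoint hwcoef (a : nat) : R :=
  if a is a'.+1 then
    - (hwcoef a' * (t2 a' (h - a')%N * (qn (m'%:Z - (h - a')%:Z + 1)))) *
      (t1 a (h - a)%N * (qn (m%:Z - a'%:Z))^-1 * q ^ (m'%:Z - (2 * (h - a))%:Z))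
  else 1.

(** In one step of the recursion the contributions of m' and a cancel, and the order grows by m - h
    + 1. *)
Lemma hwcoef_ord a : (a <= h)%N -> ord (a%:Z * (m%:Z - h%:Z + 1)) (hwcoef a).
Proof.
elim: a => [|a ih] ah /=.
  by rewrite mul0r; apply/ord_ge0; exact: (local1 HA).
have [o1 _ _] : [/\ ord (1 - (m'%:Z - (h - a)%:Z + 1)) (qn (m'%:Z - (h - a)%:Z + 1)),
   True & True] by have [|] := @qnum_ord (m'%:Z - (h - a)%:Z + 1); [lia|].
have [o2 _] : ord (m%:Z - a%:Z - 1) (qn (m%:Z - a%:Z))^-1 /\ True.
  by have [|] := @qnum_ord (m%:Z - a%:Z); [lia|].
have o3 := ord_ge_exp HA (m'%:Z - (2 * (h - a.+1))%:Z).
rewrite mulNr; apply: (ord_geN HA).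
apply: ord_ge_eq (ord_geM HA (ord_geM HA (ih (ltnW ah)) (ord_geMA HA (At2 _ _) o1))
  (ord_geM HA (ord_geMA HA (At1 _ _) o2) o3)) _.
by lia.
Qed.

(** Each x_(a, h-a-1) receives one term from index a and one from a + 1, and the recursion cancels
    the two. The two boundary terms are 0 by the conventions in the hypothesis on [Psi]. *)
Lemma hwcoef_kill : Psi (\sum_(a < h.+1) hwcoef a *: x a (h - a)%N) = 0.
Proof.
have tl (a : 'I_h.+1) : Psi (hwcoef a *: x a (h - a)%N) =
   (hwcoef a * (t1 a (h - a)%N * (qn (m%:Z - a%:Z + 1)) * q ^ ((2 * (h - a))%:Z - m'%:Z))) *:
      (if a : nat is a'.+1 then x a' (h - a)%N else 0) +
   (hwcoef a * (t2 a (h - a)%N * (qn (m'%:Z - (h - a)%:Z + 1)))) *: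
     (if (h - a)%N is b'.+1 then x a b' else 0).
  have := ltn_ord a => ah.
  by rewrite linearZ /= Psi_x ?scalerDr ?scalerA //; lia.
rewrite linear_sum (eq_bigr _ (fun a _ => tl a)) big_split /=.
rewrite big_ord_recl [X in _ + X]big_ord_recr /= scaler0 add0r subnn scaler0 addr0.
rewrite -big_split big1 //= => a _; have ah := ltn_ord a.
have -> : bump 0 a = a.+1 by [].
rewrite !add0n -{5}(subnSK ah) -scalerDl -[RHS](scale0r (x a (h - a.+1)%N)); congr (_ *: _).
have -> : m%:Z - a.+1%:Z + 1 = m%:Z - a%:Z by lia.
have [_ _ e2] : [/\ True, True & (qn (m%:Z - a%:Z))^-1 * (qn (m%:Z - a%:Z)) = 1].
  by have [|] := @qnum_ord (m%:Z - a%:Z); [lia|].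
set c := hwcoef a; set t := t1 _ _; set t' := t2 _ _.
set n1 := (qn (m'%:Z - _ + _)); set n2 := (qn (m%:Z - _)) in e2 *.
have e3 : q ^ (m'%:Z - (2 * (h - a.+1))%:Z) * q ^ ((2 * (h - a.+1))%:Z - m'%:Z) = 1.
  by rewrite -exprzDr ?(localU HA) // (_ : _ + _ = 0) ?expr0z //; lia.
rewrite (_ : - _ * _ * _ = - (c * (t' * n1)) * ((t * t) * (n2^-1 * n2) *
   (q ^ (m'%:Z - (2 * (h - a.+1))%:Z) * q ^ ((2 * (h - a.+1))%:Z - m'%:Z)))); last by ring.
by rewrite t1K e2 e3 !mulr1 addNr.
Qed.
End HighestWeightVector.

Section String.
(** [Phi] is F with G k = F^(k) w in [tensor_upper], and E with G k = F^(N-k) y in [tensor_lower];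
    [sg] is the sign with which it moves along the string. *)
Variables (Phi : {linear V -> V}) (x : nat -> nat -> V) (m h : nat).
Variables (s1 s2 : nat -> nat -> R) (sg : nat -> R) (c : nat -> R) (G : nat -> V).
Hypotheses (As1 : forall a b, A (s1 a b)) (As2 : forall a b, A (s2 a b)).
Hypotheses (Asg : forall k, A (sg k)).
Hypothesis sgK : forall k, sg k * sg k = 1.
Hypothesis Phi_x : forall a b, Phi (x a b) =
  (s1 a b * (qn a.+1)) *: x a.+1 b +
  (s2 a b * q ^ (m%:Z - (2 * a)%:Z) * (qn b.+1)) *: x a b.+1.
Hypothesis hm : (h <= m)%N.
Hypothesis Phi_G : forall k, (k < m - h)%N -> Phi (G k) = (sg k * (qn k.+1)) *: G k.+1.
Hypothesis G0 : G 0 = \sum_(a < h.+1) c a *: x a (h - a)%N.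
Hypothesis c0 : c 0 = 1.
Hypothesis c_ord : forall a, (a <= h)%N -> ord (a%:Z * (m%:Z - h%:Z + 1)) (c a).

Local Notation d := (m%:Z - h%:Z).

(* A lower bound for the q-adic order of the coefficient g a in string_coef. *)
Let bnd (k a : nat) : int :=
  if (a < k)%N then 1 else (a%:Z - k%:Z) * (d + 1 - k%:Z).

Let sgn k : R := \prod_(l < k) (s1 l h * sg l).

(** G (k + 1) is [Phi] (G k) divided by [k + 1], up to sign. The part of [Phi] that raises a changes
    the order by k - a, which turns (a-k)(d+1-k) at a into exactly the bound for k + 1 at a + 1; for
    k = 0 the bound is the order of [hwcoef]. The other part changes it by d - a, which is positive
    for a <= k < d, so that it cannot disturb the leading coefficient at a = k. *)
Lemma string_coef k : (k <= m - h)%N -> exists g : nat -> R,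
  [/\ G k = \sum_(a < (k + h).+1) g a *: x a (k + h - a)%N,
      forall a, (a <= k + h)%N -> ord (bnd k a) (g a)
    & ord 1 (g k - sgn k)].
Proof.
elim: k => [|k ih] kd.
  exists c; split=> [//|a ah|]; last first.
    by rewrite /sgn big_ord0 c0 subrr; exact: ord_ge_zero.
  by apply: ord_ge_eq (c_ord ah) _; rewrite /bnd /=; lia.
have [g [Gk gb gl]] := ih (ltnW kd).
have [o1 o2 o3] : [/\ True, ord (k.+1%:Z - 1) (qn k.+1)^-1 & (qn k.+1)^-1 * (qn k.+1) = 1].
  by have [|] := @qnum_ord k.+1.
pose T1 (a : nat) := if a is a'.+1 then g a' * (s1 a' (k + h - a')%N * (qn a)) else 0.
pose T2 (a : nat) := if (a <= k + h)%N then
  g a * (s2 a (k + h - a)%N * q ^ (m%:Z - (2 * a)%:Z) * (qn ((k + h - a).+1))) else 0.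
pose g' a := sg k * ((qn k.+1)^-1 * (T1 a + T2 a)).
have GS : G k.+1 = \sum_(a < (k.+1 + h).+1) g' a *: x a (k.+1 + h - a)%N.
  have -> : G k.+1 = (sg k * (qn k.+1)^-1) *: Phi (G k).
    rewrite Phi_G // scalerA mulrACA sgK mul1r o3 scale1r //.
  rewrite Gk linear_sum.
  have -> : \sum_(a < (k.+1 + h).+1) g' a *: x a (k.+1 + h - a)%N =
    (sg k * (qn k.+1)^-1) *: \sum_(a < (k + h).+2) (T1 a *: x a ((k + h).+1 - a)%N
      + T2 a *: x a ((k + h).+1 - a)%N).
    rewrite scaler_sumr; apply: eq_bigr => a _.
    by rewrite -scalerDl scalerA /g' mulrA.
  congr (_ *: _); rewrite big_split [X in _ = X + _]big_ord_recl [X in _ = _ + X]big_ord_recr /=.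
  rewrite scale0r add0r {2}/T2 ltnn scale0r addr0 -big_split; apply: eq_bigr => a _ /=.
  have ak : (a <= k + h)%N by rewrite -ltnS.
  rewrite linearZ /= Phi_x scalerDr !scalerA (_ : bump 0 a = a.+1) // subSS /T2 ak.
  by rewrite subSn.
have T1o a : (a <= k + h)%N -> ord (bnd k a + k%:Z - a%:Z) ((qn k.+1)^-1 * T1 a.+1).
  move=> ak; rewrite /T1.
  have [o4 _] : ord (1 - a.+1%:Z) (qn a.+1) /\ True by have [|] := @qnum_ord a.+1.
  apply: ord_ge_eq (ord_geM HA o2 (ord_geM HA (gb a ak) (ord_geMA HA (As1 _ _) o4))) _.
  by lia.
have T2o a : (a <= k + h)%N -> ord (bnd k a + d - a%:Z) ((qn k.+1)^-1 * T2 a).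
  move=> ak; rewrite /T2 ak.
  have [o4 _] : ord (1 - (k + h - a).+1%:Z) (qn ((k + h - a).+1)) /\ True.
    by have [|] := @qnum_ord (k + h - a).+1.
  apply: ord_ge_eq (ord_geM HA o2 (ord_geM HA (gb a ak)
    (ord_geM HA (ord_geMA HA (As2 _ _) (ord_ge_exp HA _)) o4))) _.
  by lia.
exists g'; split=> [//|a ak|].
  apply: (ord_geMA HA) => //; rewrite mulrDr; apply: (ord_geD HA).
    case: a ak => [|a] ak; first by rewrite mulr0; exact: ord_ge_zero.
    apply: (ord_ge_weak HA) (T1o a _); last by lia.
    rewrite /bnd; case: ifP => h1; case: ifP => h2; lia.
  have [ak'|ak'] := leqP a (k + h); last first.
    by rewrite /T2 leqNgt ak' mulr0; exact: ord_ge_zero.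
  apply: (ord_ge_weak HA) (T2o a ak').
  rewrite /bnd; case: ifP => h1; case: ifP => h2; try lia.
  have ak0 : a = k by lia.
  by rewrite ak0 subrr mul0r; lia.
rewrite /g' /T1 /sgn big_ord_recr /= -/(sgn k).
have kk : (k + h - k)%N = h by lia.
rewrite kk.
rewrite (_ : _ - _ = s1 k h * sg k * (g k - sgn k) * ((qn k.+1)^-1 * (qn k.+1))
   + sg k * ((qn k.+1)^-1 * T2 k.+1) + s1 k h * sg k * sgn k * ((qn k.+1)^-1 * (qn k.+1) - 1));
  last by ring.
rewrite o3 subrr mulr0 addr0 mulr1; apply: (ord_geD HA).
  by apply: (ord_geMA HA) => //; apply: (localM HA).
apply: (ord_geMA HA) => //.
have [ak'|ak'] := leqP k.+1 (k + h); last first.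
  by rewrite /T2 leqNgt ak' mulr0; exact: ord_ge_zero.
apply: (ord_ge_weak HA) (T2o _ ak').
rewrite /bnd; case: ifP => h1; lia.
Qed.

Lemma string_estimate k : (k <= m - h)%N -> exists r : nat -> R,
  (forall a, A (r a)) /\
  G k = sgn k *: x k h + q *: \sum_(a < (k + h).+1) r a *: x a (k + h - a)%N.
Proof.
move=> kd; have [g [-> gb gl]] := string_coef kd.
have [r0 Ar0 er0] := ord_ge1 HA gl.
have h1 a : exists r, A r /\ ((a <= k + h)%N -> a != k -> g a = q * r).
  have [ak|ak] := leqP a (k + h); last by exists 0; split=> //; exact: (local0 HA).
  have [->|ak'] := eqVneq a k; first by exists 0; split=> //; exact: (local0 HA).
  have /(ord_ge1 HA)[r Ar er] : ord 1 (g a).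
    apply: (ord_ge_weak HA) (gb a ak); rewrite /bnd; case: ifP => h1 //.
    (* Both factors of the bound are at least 1, the second because k <= d. *)
    have h2 : (k < a)%N by lia.
    by rewrite -[1]mulr1; apply: ler_pM => //; lia.
  by exists r; split.
have [r hr] := choice h1.
exists (fun a => if a == k then r0 else r a); split.
  by move=> a; case: ifP => // _; have [] := hr a.
have kk : (k < (k + h).+1)%N by lia.
rewrite (bigD1 (Ordinal kk)) //= [X in q *: X](bigD1 (Ordinal kk)) //= eqxx addKn.
rewrite scalerDr addrA scalerA -scalerDl -er0 [sgn k + _]addrC subrK; congr (_ + _).
rewrite scaler_sumr; apply: eq_bigr => a ak.
have ak' : (a != k :> nat) by apply: contra ak => /eqP e; apply/eqP/val_inj.
have [_ ->] := hr a => //; last by rewrite -ltnS.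
by rewrite (negbTE ak') scalerA.
Qed.
End String.

(** Elimination: 1 - q r_n is a unit, so the last relation expresses x_n modulo N through the
    earlier x_j with coefficients in qA. Substituting this into the other relations leaves relations
    of the same form with one generator less. *)
Lemma nakayama (N : set V) (n : nat) (x : nat -> V) :
  (forall v w, N v -> N w -> N (v + w)) -> (forall a v, A a -> N v -> N (a *: v)) ->
  (forall i, (i < n)%N -> exists r : nat -> R,
    (forall j, A (r j)) /\ N (x i - q *: \sum_(j < n) r j *: x j)) ->
  forall i, (i < n)%N -> N (x i).
Proof.
move=> ND NZ; elim: n => // n ih hx.
have [r [Ar]] := hx n (ltnSn n); rewrite big_ord_recr /= => Nn.
have [ur Avr] := localV HA (Ar n).
pose t := (1 - q * r n)^-1.
have hn : N (x n - (q * t) *: \sum_(j < n) r j *: x j).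
  have := NZ t _ Avr Nn; congr (N _).
  rewrite [q *: (_ + _)]scalerDr scalerA opprD [- _ - _]addrC addrA -{1}[x n]scale1r -scalerBl.
  by rewrite scalerBr scalerA mulVr // scale1r scalerA [t * q]mulrC.
have N0 : N 0 by have := NZ 0 _ (local0 HA) hn; rewrite scale0r.
have Nlt i : (i < n)%N -> N (x i).
  apply: ih => {}i ni; have [r' [Ar']] := hx i (ltnW ni).
  rewrite big_ord_recr /= => Ni.
  exists (fun j => r' j + q * (r' n * t * r j)); split.
    move=> j; apply: (localD HA) => //; apply: (localM HA); first exact: (localq HA).
    by do 2?[apply: (localM HA) => //].
  have := ND _ _ Ni (NZ (q * r' n) _ _ hn); rewrite /=.
  move=> /(_ (localM HA (localq HA) (Ar' n))); congr (N _).
  have -> : \sum_(j < n) (r' j + q * (r' n * t * r j)) *: x j =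
      \sum_(j < n) r' j *: x j + (q * (r' n * t)) *: \sum_(j < n) r j *: x j.
    rewrite scaler_sumr -big_split; apply: eq_bigr => j _ /=.
    by rewrite scalerDl scalerA !mulrA.
  rewrite scalerBr !scalerDr !scalerA opprD !addrA subrK.
  by rewrite opprD addrA; congr (_ - _ - _ *: _); ring.
have Ns : N (\sum_(j < n) r j *: x j).
  by apply: (big_ind (fun v => N v)) => // j _; apply: NZ => //; exact: Nlt.
move=> i; rewrite ltnS leq_eqVlt => /predU1P[->|]; last exact: Nlt.
rewrite -[x n](subrK ((q * t) *: \sum_(j < n) r j *: x j)); apply: ND => //.
by apply: NZ => //; apply: (localM HA) => //; exact: (localq HA).
Qed.
End Estimate.

(** * The tensor product of two strings *)

Section TensorString.
Variables (R : comUnitRingType) (A : set R) (q : R).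
Hypothesis HA : local_at A q.
Variable p : R.
Hypotheses (Ap : A p) (pp : p * p = 1).
Variables (T : lmodType R) (E F : {linear T -> T}).
Variables (W : int -> set T) (r0 : int).
Hypothesis W0 : forall k, W k 0.
Hypothesis WD : forall k v w, W k v -> W k w -> W k (v + w).
Hypothesis WZ : forall k a v, W k v -> W k (a *: v).
Hypothesis WE : forall k v, W k v -> W (k + 1) (E v).
Hypothesis WF : forall k v, W k v -> W (k - 1) (F v).
Hypothesis EF : forall k v, W k v ->
  E (F v) - p *: F (E v) = qnum p q (r0 + 2 * k) *: v.
Hypothesis nilE : forall v, exists n, iter n E v = 0.
Hypothesis nilF : forall v, exists n, iter n F v = 0.

Local Notation qn := (qnum p q).
Local Notation wt k := (r0 + 2 * k).
Local Notation Fd := (divpow p q F).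

(* x a b stands for F^(a) u (x) F^(b) v, where u and v are highest weight
   vectors of weights m and m', and e = p ^ (parity of u). *)
Variables (x : nat -> nat -> T) (m m' : nat) (e : R).
Hypotheses (Ae : A e) (ee : e * e = 1).
Hypothesis r0E : r0 = m%:Z + m'%:Z.
Hypothesis Wx : forall a b, W (- (a + b)%:Z) (x a b).
Hypothesis x_out : forall a b, (m < a)%N || (m' < b)%N -> x a b = 0.
Hypothesis Fx : forall a b, F (x a b) =
  qn a.+1 *: x a.+1 b +
  (e * p ^+ a * q ^ (m%:Z - (2 * a)%:Z) * qn b.+1) *: x a b.+1.
Hypothesis Ex : forall a b, (a <= m)%N -> (b <= m')%N -> E (x a b) =
  (p ^+ a.-1 * qn (m%:Z - a%:Z + 1) * q ^ ((2 * b)%:Z - m'%:Z)) *: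
    (if a is a'.+1 then x a' b else 0) +
  (e * p ^+ (a + m + b.-1) * qn (m'%:Z - b%:Z + 1)) *:
    (if b is b'.+1 then x a b' else 0).

Definition xspan (c : nat) : set T :=
  [set v | exists r : nat -> R, (forall a, A (r a)) /\
     v = \sum_(a < c.+1) r a *: x a (c - a)%N].

Lemma xspanD c v w : xspan c v -> xspan c w -> xspan c (v + w).
Proof.
move=> [r [Ar ->]] [s [As ->]]; exists (fun a => r a + s a); split.
  by move=> a; exact: (localD HA).
by rewrite -big_split; apply: eq_bigr => a _; rewrite scalerDl.
Qed.

Lemma xspanZ c a v : A a -> xspan c v -> xspan c (a *: v).
Proof.
move=> Aa [r [Ar ->]]; exists (fun i => a * r i); split.
  by move=> i; exact: (localM HA).
by rewrite scaler_sumr; apply: eq_bigr => i _; rewrite scalerA.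
Qed.

Lemma xspan0 c : xspan c 0.
Proof.
exists (fun=> 0); split=> [_|]; first exact: (local0 HA).
by rewrite big1 // => i _; rewrite scale0r.
Qed.

Lemma xspan_x c a b : (a + b)%N = c -> xspan c (x a b).
Proof.
move=> <-; exists (fun i => (i == a)%:R); split=> [i|].
  by case: eqP => _; [exact: (local1 HA)|exact: (local0 HA)].
have ha : (a < (a + b).+1)%N by rewrite ltnS leq_addr.
rewrite (bigD1 (Ordinal ha)) //= eqxx scale1r addKn big1 ?addr0 // => i hi.
rewrite (_ : (i == a :> nat) = false) ?scale0r //.
by apply: contraNF hi => /eqP e'; apply/eqP/val_inj.
Qed.

Let ApX n : A (p ^+ n).
Proof. exact: (localX HA). Qed.

Let AeX n : A (e * p ^+ n).
Proof. by apply: (localM HA). Qed.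

Let epK n : e * p ^+ n * (e * p ^+ n) = 1.
Proof. by rewrite mulrACA ee mul1r (pK pp). Qed.

Lemma W_lin k n (c : nat -> R) (y : nat -> T) :
  (forall a, (a < n)%N -> W k (y a)) -> W k (\sum_(a < n) c a *: y a).
Proof.
move=> h; apply: (big_ind (fun v => W k v)) => // [v w|a _]; first exact: WD.
by apply: WZ; exact: h.
Qed.

(** The leading coefficient is 1 here, because F acts on the first tensor factor without a sign. *)
Lemma tensor_upper h : (h <= m)%N -> (h <= m')%N -> exists w,
  [/\ W (- h%:Z) w, E w = 0 & forall k, (k <= m - h)%N ->
    exists2 s, xspan (k + h) s & Fd k w = x k h + q *: s].
Proof.
move=> hm hm'.
have Ex' a b : (a <= m)%N -> (b <= m')%N -> E (x a b) =
    ((fun a _ => p ^+ a.-1) a b * qn (m%:Z - a%:Z + 1) * q ^ ((2 * b)%:Z - m'%:Z)) *: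
      (if a is a'.+1 then x a' b else 0) +
    ((fun a b => e * p ^+ (a + m + b.-1)) a b * qn (m'%:Z - b%:Z + 1)) *:
      (if b is b'.+1 then x a b' else 0) by exact: Ex.
pose c := hwcoef q p m m' h (fun a _ => p ^+ a.-1) (fun a b => e * p ^+ (a + m + b.-1)).
pose w := \sum_(a < h.+1) c a *: x a (h - a)%N.
have Ew : E w = 0.
  by apply: (hwcoef_kill HA Ap) Ex' _ _ => // a b; exact: pK.
have Ww : W (- h%:Z) w.
  apply: (@W_lin _ _ c (fun a => x a (h - a)%N)) => a ah; have := Wx a (h - a)%N.
  by congr (W _ _); rewrite subnKC.
exists w; split=> // k kd.
have Fx' a b : F (x a b) = ((fun _ _ => 1) a b * qn a.+1) *: x a.+1 b +
    ((fun a _ => e * p ^+ a) a b * q ^ (m%:Z - (2 * a)%:Z) * qn b.+1) *: x a b.+1.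
  by rewrite Fx mul1r.
have FG l : (l < m - h)%N -> F (Fd l w) = ((fun=> 1) l * qn l.+1) *: Fd l.+1 w.
  by move=> _; rewrite (F_Fd HA Ap) mul1r.
have [|||||||r [Ar er]] := string_estimate HA Ap _ _ _ _ Fx' hm FG (c := c) _ _ _ kd.
- by move=> *; exact: (local1 HA).
- by move=> *; exact: AeX.
- by move=> *; exact: (local1 HA).
- by move=> *; rewrite mul1r.
- by rewrite divpow0.
- by [].
- by move=> a ah; apply: (hwcoef_ord HA Ap).
exists (\sum_(a < (k + h).+1) r a *: x a (k + h - a)%N); first by exists r.
by rewrite er big1 ?scale1r // => l _; rewrite mul1r.
Qed.

(** Reversing the indices and exchanging the factors gives F the shape asked of [Psi] and E the
    shape asked of [Phi]. The guard replaces the wrong values that truncated subtraction would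
    produce. *)
Let X i j := if (i <= m')%N && (j <= m)%N then x (m - j) (m' - i) else 0.

(** The vector z with F z = 0 and leading term x_(m-h, m') has weight -N, hence is F^(N) y for a
    highest weight vector y, and E climbs the string of y from its lower end. The sign picked up at
    step j is the product of the sign of E on the second factor and that of E on the divided powers
    of y. *)
Lemma tensor_lower h : (h <= m)%N -> (h <= m')%N ->
  let N := (m + m' - 2 * h)%N in
  exists y (sgn : nat -> R), [/\ W (- h%:Z) y, E y = 0,
    forall j, (j < m' - h)%N -> sgn j.+1 * sgn j = e * p ^+ (m - h),
    forall j, A (sgn j) /\ sgn j * sgn j = 1
  & forall j, (j <= m' - h)%N -> exists2 s, xspan (m - h + (m' - j)) s &
      Fd (N - j) y = sgn j *: x (m - h) (m' - j) + q *: s].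
Proof.
move=> hm hm' N.
pose t1 (i j : nat) : R := e * p ^+ (m - j).
pose t2 (i j : nat) : R := 1.
have FX i j : (i <= m')%N -> (j <= m)%N -> F (X i j) =
    (t1 i j * qn (m'%:Z - i%:Z + 1) * q ^ ((2 * j)%:Z - m%:Z)) *:
      (if i is i'.+1 then X i' j else 0) +
    (t2 i j * qn (m%:Z - j%:Z + 1)) *: (if j is j'.+1 then X i j' else 0).
  move=> im jm; rewrite /X im jm Fx addrC /t1 /t2 mul1r; congr (_ *: _ + _ *: _).
  - have -> : ((m' - i).+1 : int) = m'%:Z - i%:Z + 1 by lia.
    have -> : m%:Z - (2 * (m - j))%:Z = (2 * j)%:Z - m%:Z by lia.
    by rewrite mulrAC.
  - case: i im => [|i] im; first by rewrite x_out // subn0 ltnSn orbT.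
    by rewrite (ltnW im) /= subnSK.
  - by congr qn; lia.
  - case: j jm => [|j] jm; first by rewrite x_out // subn0 ltnSn.
    by rewrite (ltnW jm) /= subnSK.
pose c := hwcoef q p m' m h t1 t2.
pose z := \sum_(a < h.+1) c a *: X a (h - a)%N.
have Fz : F z = 0.
  apply: (hwcoef_kill HA Ap) FX _ _ => //.
  by move=> a b; exact: epK.
have Wz : W (- (m + m' - h)%:Z) z.
  apply: (@W_lin _ _ c (fun a => X a (h - a)%N)) => a ah; rewrite /X; case: ifP => // /andP[am hm1].
  have := Wx (m - (h - a)) (m' - a); congr (W _ _); lia.
have [y [Wy Ey zy]] : exists y, [/\ W (- (m + m' - h)%:Z + N%:Z) y, E y = 0 & z = Fd N y].
  apply: (lowest_wt_vector HA Ap pp W0 WD WZ WE WF EF nilF Wz _ Fz (nilE z)).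
  by rewrite r0E /N; lia.
have {}Wy : W (- h%:Z) y by move: Wy; congr (W _ _); lia.
pose s1 (i j : nat) : R := e * p ^+ ((m - j) + m + (m' - i).-1).
pose s2 (i j : nat) : R := p ^+ (m - j).-1.
pose sg (j : nat) : R := p ^+ (N - j.+1).
have EX i j : E (X i j) = (s1 i j * qn i.+1) *: X i.+1 j +
    (s2 i j * q ^ (m'%:Z - (2 * i)%:Z) * qn j.+1) *: X i j.+1.
  rewrite /X; have [im|im] := leqP i m'; last first.
    by rewrite ltnNge (ltnW im) /= linear0 !scaler0 addr0.
  have [jm|jm] := leqP j m; last first.
    by rewrite !andbF ltnNge (ltnW jm) /= linear0 !scaler0 addr0.
  rewrite /= Ex ?leq_subr // addrC; congr (_ *: _ + _ *: _).
  - by rewrite /s1; congr (_ * qn _); lia.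
  - have [im'|im'] := ltnP i m'; first by rewrite -(subnSK im').
    by rewrite (_ : (m' - i)%N = 0) //; lia.
  - rewrite /s2 mulrAC; congr (_ * _ * qn _); last by lia.
    by congr (q ^ _); lia.
  - have [jm'|jm'] := ltnP j m; first by rewrite -(subnSK jm').
    by rewrite (_ : (m - j)%N = 0) //; lia.
pose sgn j := \prod_(l < j) (s1 l h * sg l).
have Asgn j : A (sgn j) /\ sgn j * sgn j = 1.
  rewrite /sgn; elim: j => [|j [ih1 ih2]].
    by rewrite big_ord0 mulr1; split=> //; exact: (local1 HA).
  rewrite big_ord_recr /=; split.
    by apply: (localM HA) => //; apply: (localM HA); [exact: AeX|exact: ApX].
  by rewrite mulrACA ih2 mul1r mulrACA epK (pK pp) mulr1.
exists y, sgn; split=> // j jd.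
  have [_ s2j] := Asgn j.
  rewrite /sgn big_ord_recr /= -/(sgn j) mulrAC s2j mul1r /s1 /sg -mulrA -exprD.
  congr (_ * _).
  (* The exponents of the two signs add up to m - h plus an even number, and p squares to 1. *)
  have -> : (m - h + m + (m' - j).-1 + (N - j.+1))%N =
    ((m - h) + ((m + m' - j.+1 - h) + (m + m' - j.+1 - h)))%N by rewrite /N; lia.
  by rewrite [LHS]exprD exprD (pK pp) mulr1.
have EG l : (l < m' - h)%N -> E (Fd (N - l) y) = (sg l * qn l.+1) *: Fd (N - l.+1) y.
  move=> lm; have -> : (N - l)%N = (N - l.+1).+1 by rewrite /N; lia.
  rewrite (E_Fd HA Ap pp WF EF _ Wy Ey) /sg; congr (_ * qn _ *: _).
  by rewrite r0E /N; lia.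
have [|||||||r [Ar er]] := string_estimate HA Ap _ _ _ _ EX hm' EG (c := c) _ _ _ jd.
- by move=> *; exact: AeX.
- by move=> *; exact: ApX.
- by move=> *; exact: ApX.
- by move=> *; exact: (pK pp).
- by rewrite subn0.
- by [].
- move=> a ah; apply: (hwcoef_ord HA Ap) => // i l.
    by rewrite /t1; exact: AeX.
  by rewrite /t2; exact: (local1 HA).
exists (\sum_(a < (j + h).+1) r a *: X a (j + h - a)%N).
  apply: (big_ind (fun v => xspan _ v)); [exact: xspan0|by move=> *; exact: xspanD|].
  move=> a _; apply: xspanZ => //; rewrite /X; case: ifP => ha; last exact: xspan0.
  by apply: xspan_x; have := ltn_ord a; lia.
by rewrite er; congr (_ *: _ + _); rewrite /X (_ : (j <= m')%N && _) //; lia.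
Qed.

Section Operators.
Variables (et ft : T -> T) (L : set T).
Hypothesis etD : forall v w, et (v + w) = et v + et w.
Hypothesis etZ : forall a v, et (a *: v) = a *: et v.
Hypothesis ftD : forall v w, ft (v + w) = ft v + ft w.
Hypothesis ftZ : forall a v, ft (a *: v) = a *: ft v.
Hypothesis ft_Fd : forall k n w, W k w -> E w = 0 -> n%:Z <= wt k ->
  ft (Fd n w) = Fd n.+1 w.
Hypothesis et_Fd : forall k n w, W k w -> E w = 0 -> n%:Z <= wt k ->
  et (Fd n w) = if n is n'.+1 then Fd n' w else 0.
Hypothesis LD : forall v w, L v -> L w -> L (v + w).
Hypothesis LZ : forall a v, A a -> L v -> L (a *: v).
Hypothesis Lx : forall a b, L (x a b).

Let Aq : A q := localq HA.

Lemma xspan_L c s : xspan c s -> L s.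
Proof.
move=> [r [Ar ->]]; apply: (big_ind (fun v => L v)).
- by rewrite -(scale0r (x 0 0)); apply: LZ => //; exact: (local0 HA).
- exact: LD.
- by move=> a _; exact: LZ.
Qed.

Let L0 : L 0. Proof. exact: xspan_L (xspan0 0). Qed.

(* By Nakayama's lemma, approximations of the x_(a, b) modulo q suffice. *)
Lemma xspan_map (g : T -> T) c :
  (forall v w, g (v + w) = g v + g w) -> (forall a v, g (a *: v) = a *: g v) ->
  (forall a b, (a + b)%N = c -> (a <= m)%N -> (b <= m')%N ->
    exists2 s, xspan c s & L (g (x a b - q *: s))) ->
  forall s, xspan c s -> L (g s).
Proof.
move=> gD gZ hg.
have g0 : g 0 = 0 by rewrite -[X in g X](scale0r (0 : T)) gZ scale0r.
have hN : forall i, (i < c.+1)%N -> L (g (x i (c - i)%N)).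
  apply: (nakayama HA (N := [set v | L (g v)]) (x := fun i => x i (c - i)%N)).
  - by move=> v w; rewrite /= gD; exact: LD.
  - by move=> a v Aa; rewrite /= gZ; exact: LZ.
  move=> i ic; have [out|] := boolP ((m < i)%N || (m' < c - i)%N).
    exists (fun=> 0); split=> [_|]; first exact: (local0 HA).
    rewrite /= x_out // big1 ?scaler0 ?subrr ?g0 // => j _.
    by rewrite scale0r.
  rewrite negb_or -!leqNgt => /andP[im cm].
  by have [|s [r [Ar ->]] Ls] := hg i (c - i)%N _ im cm; [lia|exists r].
move=> s [r [Ar ->]].
rewrite (big_morph g gD g0); apply: (big_ind (fun v => L v)) => // a _.
by rewrite gZ; apply: LZ => //; exact: hN.
Qed.

(** Up to q, the string of w_b runs through the x_(k, b): in this region F moves the first index. *)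
Lemma upper_approx a b : (a + b <= m)%N -> (b <= m')%N -> exists w,
  [/\ W (- b%:Z) w, E w = 0, (m - b)%:Z <= wt (- b%:Z) & forall k, (k <= m - b)%N ->
    exists2 s, xspan (k + b) s & x k b - q *: s = Fd k w].
Proof.
move=> ab bm'; have bm : (b <= m)%N by lia.
have [w [Ww Ew hw]] := tensor_upper bm bm'.
exists w; split=> //; first by rewrite r0E; lia.
move=> k kd; have [s hs ->] := hw k kd; exists (- s).
  by rewrite -scaleN1r; apply: xspanZ => //; apply: (localN HA); exact: (local1 HA).
by rewrite scalerN opprK.
Qed.

(** Here h = m - a, and up to q and a sign the string of y runs through the x_(a, l): in this region
    F moves the second index. The product of consecutive signs is the sign of the tensor product
    rule. *)
Lemma lower_approx a b : (m <= a + b)%N -> (a <= m)%N -> (b <= m')%N ->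
  let N := (a + m' - (m - a))%N in
  exists y (sgn : nat -> R), [/\ W (- (m - a)%:Z) y, E y = 0 /\ wt (- (m - a)%:Z) = N,
    forall l, (m <= a + l)%N -> (l < m')%N -> sgn l * sgn l.+1 = e * p ^+ a,
    forall l, A (sgn l) /\ sgn l * sgn l = 1
  & forall l, (m <= a + l)%N -> (l <= m')%N -> exists2 s, xspan (a + l) s &
      x a l - q *: s = sgn l *: Fd (N - (m' - l)) y].
Proof.
move=> ab am bm' N.
have [||y [sg [Wy Ey sS sA hy]]] := @tensor_lower (m - a); [lia|lia|].
exists y, (fun l => sg (m' - l)%N); split=> //.
- by split=> //; rewrite r0E /N; lia.
- move=> l ml lm; rewrite (_ : m' - l = (m' - l.+1).+1)%N; last by lia.
  by rewrite sS ?subKn //; lia.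
move=> l ml lm; have [|s hs es] := hy (m' - l)%N; first by lia.
have [As s2] := sA (m' - l)%N.
exists (- (sg (m' - l)%N *: s)).
  rewrite -scaleN1r; apply: xspanZ; first by apply: (localN HA); exact: (local1 HA).
  by apply: xspanZ => //; move: hs; congr xspan; lia.
have -> : (N - (m' - l) = m + m' - 2 * (m - a) - (m' - l))%N by rewrite /N; lia.
rewrite es scalerDr !scalerA s2 scale1r !subKn // scalerN opprK scalerA.
by rewrite [q * _]mulrC.
Qed.

Let xspanN c s : xspan c s -> xspan c (- s).
Proof.
by move=> hs; rewrite -scaleN1r; apply: xspanZ => //; apply: (localN HA); exact: (local1 HA).
Qed.

Lemma xspan_ft c s : xspan c s -> L (ft s).
Proof.
apply: xspan_map => // a b abc am bm'.
(* For a + b = m both families contain x_(a, b), but the upper estimate ends there, so [ft] has to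
   use the lower family. *)
have [cm|cm] := ltnP c m.
  have [||w [Ww Ew mb hw]] := @upper_approx a b; [lia|lia|].
  have [|s1 hs1 e1] := hw a; first by lia.
  have [|s2 hs2 e2] := hw a.+1; first by lia.
  exists s1; first by rewrite -abc.
  rewrite e1 (ft_Fd Ww Ew); last by lia.
  rewrite -e2; apply: LD => //; rewrite -scalerN; apply: LZ => //.
  by apply: xspan_L; exact: xspanN hs2.
have [|||y [sg [Wy [Ey wy] sS sA hy]]] := @lower_approx a b; [lia|lia|lia|].
have [||s1 hs1 e1] := hy b; [lia|lia|].
exists s1; first by rewrite -abc.
rewrite e1 ftZ (ft_Fd Wy Ey); last by rewrite wy; lia.
have [As s2] := sA b; apply: LZ => //.
have [bm|bm] := ltnP b m'; last first.
  by rewrite (Fd_eq0 HA Ap pp WF EF nilF Wy Ey) //; lia.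
have [||s3 hs3 e3] := hy b.+1; [lia|lia|].
have [As' s2'] := sA b.+1.
have -> : (a + m' - (m - a) - (m' - b)).+1 = (a + m' - (m - a) - (m' - b.+1))%N by lia.
rewrite -[Fd _ y]scale1r -s2' -scalerA -e3; apply: LZ => //; apply: LD => //.
by rewrite -scalerN; apply: LZ => //; apply: xspan_L; exact: xspanN hs3.
Qed.

Lemma xspan_et c s : xspan c s -> L (et s).
Proof.
apply: xspan_map => // a b abc am bm'.
(* For a + b = m the operator [et] would leave the lower family, so the upper one is used. *)
have [cm|cm] := leqP c m.
  have [||w [Ww Ew mb hw]] := @upper_approx a b; [lia|lia|].
  have [|s1 hs1 e1] := hw a; first by lia.
  exists s1; first by rewrite -abc.
  rewrite e1 (et_Fd Ww Ew); last by lia.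
  case: a abc am e1 {hs1} => // a abc am e1.
  have [|s2 hs2 <-] := hw a; first by lia.
  apply: LD => //; rewrite -scalerN; apply: LZ => //.
  by apply: xspan_L; exact: xspanN hs2.
have [|||y [sg [Wy [Ey wy] sS sA hy]]] := @lower_approx a b; [lia|lia|lia|].
have [||s1 hs1 e1] := hy b; [lia|lia|].
exists s1; first by rewrite -abc.
rewrite e1 etZ (et_Fd Wy Ey); last by rewrite wy; lia.
have [As s2] := sA b; apply: LZ => //.
have [||s3 hs3 e3] := hy b.-1; [lia|lia|].
have [As' s2'] := sA b.-1.
have -> : (a + m' - (m - a) - (m' - b) = (a + m' - (m - a) - (m' - b.-1)).+1)%N by lia.
rewrite -[Fd _ y]scale1r -s2' -scalerA -e3; apply: LZ => //; apply: LD => //.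
by rewrite -scalerN; apply: LZ => //; apply: xspan_L; exact: xspanN hs3.
Qed.

Local Notation "v =q= w" := (exists2 l, L l & v - w = q *: l) (at level 70).

Let split_x (v s w : T) : v - q *: s = w -> v = w + q *: s.
Proof. by move=> <-; rewrite subrK. Qed.

Let split_q (v w s t : T) : v = w + q *: s -> forall v', v' = w + q *: t ->
  v - v' = q *: (s - t).
Proof. by move=> -> v' ->; rewrite opprD addrACA subrr add0r -scalerBr. Qed.

Let LB (v w : T) : L v -> L w -> L (v - w).
Proof.
move=> Lv Lw; apply: LD => //; rewrite -scaleN1r; apply: LZ => //.
by apply: (localN HA); exact: (local1 HA).
Qed.

(** Since [ft] maps the span of the x_(a, b) into [L], the error term q s stays in qL, and the value
    can be read off from the approximating string. *)
Lemma ft_tensor a b : (a <= m)%N -> (b <= m')%N ->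
  ft (x a b) =q= (if (b < m - a)%N then x a.+1 b else (e * p ^+ a) *: x a b.+1).
Proof.
move=> am bm'; case: ifP => hb.
  have [||w [Ww Ew mb hw]] := @upper_approx a b; [lia|lia|].
  have [|s1 hs1 e1] := hw a; first by lia.
  have [|s2 hs2 e2] := hw a.+1; first by lia.
  exists (ft s1 - s2); first by apply: LB; [exact: xspan_ft hs1|exact: xspan_L hs2].
  apply: split_q (split_x e2).
  by rewrite (split_x e1) ftD ftZ (ft_Fd Ww Ew) //; lia.
have [|||y [sg [Wy [Ey wy] sS sA hy]]] := @lower_approx a b; [lia|lia|lia|].
have [||s1 hs1 e1] := hy b; [lia|lia|].
have [As ss] := sA b.
have ftx : ft (x a b) = sg b *: Fd (a + m' - (m - a) - (m' - b)).+1 y + q *: ft s1.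
  by rewrite (split_x e1) ftD !ftZ (ft_Fd Wy Ey) // wy; lia.
have [bm|bm] := ltnP b m'; last first.
  exists (ft s1); first exact: xspan_ft hs1.
  rewrite ftx (Fd_eq0 HA Ap pp WF EF nilF Wy Ey); last by lia.
  by rewrite (x_out (b := b.+1)) ?scaler0 ?subr0 ?add0r // ltnS bm orbT.
have [||s3 hs3 e3] := hy b.+1; [lia|lia|].
have [As' s2'] := sA b.+1.
exists (ft s1 - (e * p ^+ a) *: s3).
  by apply: LB; [exact: xspan_ft hs1|apply: LZ => //; exact: xspan_L hs3].
apply: split_q ftx _ _; rewrite (split_x e3) scalerDr !scalerA [e * _ * q]mulrC.
congr (_ + _); rewrite -(sS b) //; last by lia.
by rewrite -mulrA s2' mulr1; congr (_ *: Fd _ y); lia.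
Qed.

Lemma et_tensor a b : (a <= m)%N -> (b <= m')%N ->
  et (x a b) =q= (if (m - a < b)%N then (e * p ^+ a) *: x a b.-1
                  else if a is a'.+1 then x a' b else 0).
Proof.
move=> am bm'; case: ifP => hb; last first.
  have [||w [Ww Ew mb hw]] := @upper_approx a b; [lia|lia|].
  have [|s1 hs1 e1] := hw a; first by lia.
  have etx : et (x a b) = (if a is a'.+1 then Fd a' w else 0) + q *: et s1.
    by rewrite (split_x e1) etD etZ (et_Fd Ww Ew) //; lia.
  have Ls1 := xspan_et hs1.
  case: a am hb hs1 e1 etx => [|a] am hb hs1 e1 etx.
    by exists (et s1) => //; rewrite etx add0r subr0.
  have [|s2 hs2 e2] := hw a; first by lia.
  exists (et s1 - s2); first by apply: LB => //; exact: xspan_L hs2.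
  exact: split_q etx _ (split_x e2).
have [|||y [sg [Wy [Ey wy] sS sA hy]]] := @lower_approx a b; [lia|lia|lia|].
have [||s1 hs1 e1] := hy b; [lia|lia|].
have [||s3 hs3 e3] := hy b.-1; [lia|lia|].
have [As ss] := sA b.
have [As' s2'] := sA b.-1.
have eN : (a + m' - (m - a) - (m' - b) = (a + m' - (m - a) - (m' - b.-1)).+1)%N by lia.
have etx : et (x a b) = sg b *: Fd (a + m' - (m - a) - (m' - b.-1))%N y + q *: et s1.
  by rewrite (split_x e1) etD !etZ eN (et_Fd Wy Ey) // wy; lia.
exists (et s1 - (e * p ^+ a) *: s3).
  by apply: LB; [exact: xspan_et hs1|apply: LZ => //; exact: xspan_L hs3].
apply: split_q etx _ _; rewrite (split_x e3) scalerDr !scalerA [e * _ * q]mulrC.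
congr (_ + _); rewrite -(sS b.-1); [|lia|lia].
by rewrite prednK; [rewrite mulrAC s2' mul1r|lia].
Qed.

Lemma x_approx a b : (a <= m)%N -> (b <= m')%N -> exists k n w,
  [/\ W k w, E w = 0, n%:Z <= wt k & x a b =q= Fd n w].
Proof.
move=> am bm'; have [ab|ab] := leqP (a + b) m.
  have [||w [Ww Ew mb hw]] := @upper_approx a b; [lia|lia|].
  have [|s1 hs1 e1] := hw a; first by lia.
  exists (- b%:Z), a, w; split=> //; first by lia.
  by exists s1; [exact: xspan_L hs1|rewrite -e1 opprB addrC subrK].
have [|||y [sg [Wy [Ey wy] sS sA hy]]] := @lower_approx a b; [lia|lia|lia|].
have [||s1 hs1 e1] := hy b; [lia|lia|].
(* The sign is absorbed into the highest weight vector. *)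
exists (- (m - a)%:Z), (a + m' - (m - a) - (m' - b))%N, (sg b *: y); split.
- exact: WZ.
- by rewrite linearZ /= Ey scaler0.
- by rewrite wy; lia.
by exists s1; [exact: xspan_L hs1|rewrite divpowZ -e1 opprB addrC subrK].
Qed.
End Operators.
End TensorString.

(** * The ring Q(q)[pi] and its subring A[pi] *)

Lemma qpoly_X2_decomp (K : fieldType) (h := 'X^2 - 1 : {poly K}) (x : {poly %/ h}) :
  exists a b : K, x = qpolyC h a + qpolyC h b * qpolyX h.
Proof.
have m : h \is monic by rewrite /h -[1]/(1%:P) monicXnsubC.
have s : size h = 3%N by rewrite /h -[1]/(1%:P) size_XnsubC.
have mk : mk_monic h = h by rewrite /mk_monic s m.
have sz : size (mk_monic h) = 3%N by rewrite mk s.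
have inC c : in_qpoly h c%:P = qpolyC h c.
  apply: val_inj; change (polyn (in_qpoly h c%:P) = polyn (qpolyC h c)).
  rewrite qpolyCE in_qpoly_small // sz.
  exact: leq_ltn_trans (size_polyC_leq1 c) _.
exists (polyn x)`_0, (polyn x)`_1.
rewrite -!inC /qpolyX -in_qpolyM -in_qpolyD; apply: val_inj.
change (polyn x = polyn (in_qpoly h (((polyn x)`_0)%:P + ((polyn x)`_1)%:P * 'X))).
have sx : (size (polyn x) <= 2)%N by apply: leq_trans (size_npoly x) _; rewrite sz.
move: (polyn x) sx => y sx.
rewrite in_qpoly_small; last first.
  rewrite sz; apply: leq_ltn_trans (size_polyD _ _) _; rewrite gtn_max.
  rewrite (leq_ltn_trans (size_polyC_leq1 _)) //=.
  apply: leq_ltn_trans (size_polyMleq _ _) _; rewrite size_polyX addn2 /=.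
  by rewrite !ltnS size_polyC_leq1.
apply/polyP => i; rewrite coefD coefC coefMX coefC.
case: i => [|[|i]] /=; rewrite ?addr0 ?add0r //.
by rewrite nth_default // (leq_trans sx).
Qed.

HB.instance Definition _ := GRing.isZmodMorphism.Build Qq Qqpi emb
  (qpolyC_is_zmod_morphism _).
HB.instance Definition _ := GRing.isMonoidMorphism.Build Qq Qqpi emb
  (qpolyC_is_monoid_morphism _).

Lemma Qqpi_decomp (x : Qqpi) : exists a b : Qq, x = emb a + emb b * ppi.
Proof. exact: qpoly_X2_decomp. Qed.

Lemma unit_emb a : a != 0 -> emb a \is a GRing.unit.
Proof.
move=> a0; apply/unitrP; exists (emb a^-1).
by rewrite -!rmorphM mulVf // divff // rmorph1.
Qed.

Lemma ppi_mul : ppi * ppi = 1. Proof. by rewrite -expr2 ppi2. Qed.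

Lemma regular_opp a : regular0 a -> regular0 (- a).
Proof.
by move=> [n [d [d0 ->]]]; exists (- n), d; rewrite tofracN mulNr.
Qed.

Lemma tofrac_neq0 (d : {poly rat}) : d.[0] != 0 -> tofrac d != 0.
Proof. by rewrite tofrac_eq0; apply: contraNneq => ->; rewrite horner0. Qed.

Lemma regular_add a b : regular0 a -> regular0 b -> regular0 (a + b).
Proof.
move=> [n [d [d0 ->]]] [n' [d' [d0' ->]]].
exists (n * d' + n' * d), (d * d'); rewrite hornerM mulf_neq0 //; split=> //.
by rewrite tofracD !tofracM addf_div ?tofrac_neq0.
Qed.

Lemma regular_mul a b : regular0 a -> regular0 b -> regular0 (a * b).
Proof.
move=> [n [d [d0 ->]]] [n' [d' [d0' ->]]].
exists (n * n'), (d * d'); rewrite hornerM mulf_neq0 //; split=> //.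
by rewrite !tofracM mulf_div.
Qed.

Lemma regular_poly (n : {poly rat}) : regular0 (tofrac n).
Proof. by exists n, 1; rewrite hornerC oner_neq0 tofrac1 divr1. Qed.

Lemma regular_loc a : regular0 a -> 1 - tofrac 'X * a != 0 /\ regular0 (1 - tofrac 'X * a)^-1.
Proof.
move=> [n [d [d0 ->]]].
have D0 : (d - 'X * n).[0] != 0 by rewrite hornerD hornerN hornerM hornerX mul0r subr0.
have -> : 1 - tofrac 'X * (tofrac n / tofrac d) = tofrac (d - 'X * n) / tofrac d.
  by rewrite tofracB tofracM mulrBl mulrA divff ?tofrac_neq0.
split; first by rewrite mulf_neq0 ?invr_eq0 ?tofrac_neq0.
by exists d, (d - 'X * n); rewrite invf_div.
Qed.

Lemma mul_add_pi (R : comNzRingType) (p a b c d : R) : p * p = 1 ->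
  (a + b * p) * (c + d * p) = a * c + b * d + (a * d + b * c) * p.
Proof.
move=> pp; have -> : (a + b * p) * (c + d * p) =
  a * c + b * d * (p * p) + (a * d + b * c) * p by ring.
by rewrite pp mulr1.
Qed.

(** Multiplication by the conjugate reduces inversion in Q(q)[pi] to inversion of the norm in
    Q(q). *)
Lemma mul_conj_pi (R : comNzRingType) (p u w t : R) : p * p = 1 ->
  (u - w * p) * ((u + w * p) * t) = (u * u - w * w) * t.
Proof.
move=> pp; have -> : (u - w * p) * ((u + w * p) * t) =
  (u * u - w * w * (p * p)) * t by ring.
by rewrite pp mulr1.
Qed.

(* A[pi], which contains the coefficients of the rank one calculus. *)
Definition Api : set Qqpi := [set x | exists a b : Qq,
  [/\ regular0 a, regular0 b & x = emb a + emb b * ppi]].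

Lemma Api_A x : A_scal x -> Api x.
Proof.
move=> [a ra <-]; exists a, 0; split=> //; last by rewrite rmorph0 mul0r addr0.
by rewrite -tofrac0; exact: regular_poly.
Qed.

Lemma Api_ppi : Api ppi.
Proof.
exists 0, 1; split; last by rewrite rmorph0 rmorph1 mul1r add0r.
  by rewrite -tofrac0; exact: regular_poly.
by rewrite -tofrac1; exact: regular_poly.
Qed.

Lemma A_scal_q : A_scal qq.
Proof. by exists (tofrac 'X) => //; exact: regular_poly. Qed.

Lemma unit_qq : qq \is a GRing.unit.
Proof. by apply: unit_emb; rewrite tofrac_eq0 polyX_eq0. Qed.

Lemma qq_local : local_at Api qq.
Proof.
have r1 : regular0 1 by rewrite -tofrac1; exact: regular_poly.
have AM x y : Api x -> Api y -> Api (x * y).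
  move=> [a [b [ra rb ->]]] [c [d [rc rd ->]]].
  exists (a * c + b * d), (a * d + b * c); split.
  - by apply: regular_add; exact: regular_mul.
  - by apply: regular_add; exact: regular_mul.
  - rewrite !rmorphD !rmorphM /=; exact: mul_add_pi ppi_mul.
split.
- by apply: Api_A; exists 1; rewrite ?rmorph1.
- move=> x y [a [b [ra rb ->]]] [c [d [rc rd ->]]].
  exists (a - c), (b - d); split.
  + by apply: regular_add => //; exact: regular_opp.
  + by apply: regular_add => //; exact: regular_opp.
  + by rewrite !rmorphB /=; ring.
- exact: AM.
- by apply: Api_A; exact: A_scal_q.
- exact: unit_qq.
move=> x [a [b [ra rb ->]]].
pose X : Qq := tofrac 'X.
pose u : Qq := 1 - X * a; pose w : Qq := X * b.
(* Chosen so that the norm of 1 - q (a + b pi) is 1 - q c with c regular. *)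
pose c : Qq := a + a - X * a * a + X * b * b.
have rX : regular0 X by exact: regular_poly.
have rc : regular0 c.
  apply: regular_add; last by do 2!apply: regular_mul => //.
  apply: regular_add; first exact: regular_add.
  by apply: regular_opp; do 2!apply: regular_mul => //.
have ec : u * u - w * w = 1 - X * c by rewrite /u /w /c; ring.
have [c0 rc'] := regular_loc rc.
pose t := (1 - X * c)^-1.
have rt : regular0 t by [].
have ru : regular0 u by apply: regular_add => //; apply: regular_opp; exact: regular_mul.
have rw : regular0 w by exact: regular_mul.
have ex : 1 - qq * (emb a + emb b * ppi) = emb u - emb w * ppi.
  by rewrite /u /w rmorphB !rmorphM rmorph1 /= /qq -/X; ring.
have e1 : (emb u - emb w * ppi) * ((emb u + emb w * ppi) * emb t) = 1.
  have -> : 1 = emb ((u * u - w * w) * t) by rewrite ec divff // rmorph1.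
  by rewrite (mul_conj_pi _ _ _ ppi_mul) -!rmorphM -rmorphB -rmorphM.
have un : emb u - emb w * ppi \is a GRing.unit.
  by apply/unitrP; exists ((emb u + emb w * ppi) * emb t); rewrite mulrC e1.
rewrite ex; split=> //.
have -> : (emb u - emb w * ppi)^-1 = (emb u + emb w * ppi) * emb t.
  by apply: (mulrI un); rewrite divrr // e1.
exists (u * t), (w * t); split; [exact: regular_mul|exact: regular_mul|].
by rewrite !rmorphM /=; ring.
Qed.

Lemma Api_X n : Api (qq ^+ n).
Proof. by apply: (localX qq_local); exact: (localq qq_local). Qed.

Lemma local_atX (R : comUnitRingType) (A : set R) (q : R) d :
  (0 < d)%N -> local_at A q -> local_at A (q ^+ d).
Proof.
case: d => // d _ H; split.
- exact: (local1 H).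
- exact: (localB H).
- exact: (localM H).
- by apply: (localX H); exact: (localq H).
- by rewrite unitrX // (localU H).
- move=> a Aa; rewrite exprS -mulrA; apply: (localV H).
  by apply: (localM H) => //; apply: (localX H); exact: (localq H).
Qed.

Section Scalars.
Variable D : root_data.
Implicit Types i : rI D.

Lemma q_local i : local_at Api (q_ i).
Proof. by apply: local_atX qq_local; exact: rd_gt0. Qed.

Lemma Api_pi i : Api (pi_ i).
Proof. by apply: (localX qq_local); exact: Api_ppi. Qed.

Lemma pi_mul i : pi_ i * pi_ i = 1.
Proof. by rewrite /pi_ -exprMn ppi_mul expr1n. Qed.

Lemma qintE i n : qint i n = qnum (pi_ i) (q_ i) n.
Proof. by rewrite /qint qnum_def -exprz_inv. Qed.

Lemma qfactE i n : qfact i n = qnum_fact (pi_ i) (q_ i) n.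
Proof. by rewrite /qfact qnum_fact_def; apply: eq_bigr => k _; rewrite qintE. Qed.

Lemma divFE (M : Udata D) i n (m : M) :
  divF i n m = divpow (pi_ i) (q_ i) (opF M i) n m.
Proof. by rewrite /divF divpow_def qfactE. Qed.
End Scalars.

Lemma scalerAC (R : comNzRingType) (V : lmodType R) (a b : R) (v : V) :
  a *: (b *: v) = b *: (a *: v).
Proof. by rewrite !scalerA mulrC. Qed.

(* Locked, so that unification does not unfold integer powers in Qqpi. *)
HB.lock Definition qz (z : int) : Qqpi := qq ^ z.
HB.lock Definition pz (z : int) : Qqpi := ppi ^ z.
HB.lock Definition qiz (D : root_data) (i : rI D) (z : int) : Qqpi := q_ i ^ z.
HB.lock Definition piz (D : root_data) (i : rI D) (z : int) : Qqpi := pi_ i ^ z.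

Lemma qzE z : qz z = qq ^ z. Proof. by rewrite qz.unlock. Qed.
Lemma pzE z : pz z = ppi ^ z. Proof. by rewrite pz.unlock. Qed.
Lemma qizE (D : root_data) (i : rI D) z : qiz i z = q_ i ^ z.
Proof. by rewrite qiz.unlock. Qed.
Lemma pizE (D : root_data) (i : rI D) z : piz i z = pi_ i ^ z.
Proof. by rewrite piz.unlock. Qed.

(** * Weights *)

Section Weights.
Variable D : root_data.
Local Notation wt := 'Hom(hh D, rat^o).
Implicit Types (i j : rI D) (mu nu : wt) (h k : hh D).

Lemma PwtB mu nu : Pwt mu -> Pwt nu -> Pwt (mu - nu).
Proof.
have [b [_ hb]] := Pwt_lattice D.
move=> /hb[z ->] /hb[y ->]; apply/hb; exists (fun l => z l - y l).
by rewrite -sumrB; apply: eq_bigr => k _; rewrite mulrzBr.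
Qed.

Lemma Pwt0 : Pwt (0 : wt).
Proof.
have [b [_ hb]] := Pwt_lattice D.
by apply/hb; exists (fun=> 0); rewrite big1.
Qed.

Lemma PwtN mu : Pwt mu -> Pwt (- mu).
Proof. by rewrite -sub0r; apply: PwtB; exact: Pwt0. Qed.

Lemma PwtD mu nu : Pwt mu -> Pwt nu -> Pwt (mu + nu).
Proof. by move=> hm hn; rewrite -[nu]opprK; apply: PwtB => //; exact: PwtN. Qed.

Lemma PwtMz mu (z : int) : Pwt mu -> Pwt (mu *~ z).
Proof.
move=> hm; have hn n : Pwt (mu *+ n).
  by elim: n => [|n ih]; rewrite ?mulr0n ?mulrS; [exact: Pwt0|exact: PwtD].
by case: z => n; [exact: hn|apply: PwtN; exact: hn].
Qed.

Lemma ipairE h mu : Pcowt h -> Pwt mu -> (ipair h mu)%:~R = mu h :> rat.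
Proof. by move=> hh hm; rewrite /ipair numqK //; exact: hh. Qed.

Lemma ipair_eq h mu (z : int) : mu h = z%:~R -> ipair h mu = z.
Proof. by rewrite /ipair => ->; rewrite numq_int. Qed.

Lemma ipairD h mu nu : Pcowt h -> Pwt mu -> Pwt nu ->
  ipair h (mu + nu) = ipair h mu + ipair h nu.
Proof.
by move=> hh hm hn; apply: ipair_eq; rewrite lfunE /= rmorphD /= !ipairE.
Qed.

Lemma ipairN h mu : Pcowt h -> Pwt mu -> ipair h (- mu) = - ipair h mu.
Proof.
by move=> hh hm; apply: ipair_eq; rewrite lfunE /= rmorphN /= !ipairE.
Qed.

Lemma Pcowt_alphav i : Pcowt (alphav i).
Proof. by move=> mu; exact: alphav_int. Qed.

Lemma PcowtMn h n : Pcowt h -> Pcowt (h *+ n).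
Proof.
by move=> hh mu hm; rewrite raddfMn /= rpredMn //; exact: hh.
Qed.

Lemma PcowtN h : Pcowt h -> Pcowt (- h).
Proof. by move=> hh mu hm; rewrite raddfN /= rpredN; exact: hh. Qed.

Lemma PcowtD h k : Pcowt h -> Pcowt k -> Pcowt (h + k).
Proof. by move=> hh hk mu hm; rewrite raddfD /= rpredD; [|exact: hh|exact: hk]. Qed.

Lemma Pcowt0 : Pcowt (0 : hh D).
Proof. by move=> mu _; rewrite linear0 rpred0. Qed.

Definition awt i mu : int := ipair (alphav i) mu.

Lemma awtD i mu nu : Pwt mu -> Pwt nu -> awt i (mu + nu) = awt i mu + awt i nu.
Proof. exact: ipairD (@Pcowt_alphav i). Qed.

Lemma awt_alpha i j : awt i (alpha j) = cartan i j.
Proof. by apply: ipair_eq; rewrite alpha_alphav. Qed.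

Lemma awtN i mu : Pwt mu -> awt i (- mu) = - awt i mu.
Proof. exact: ipairN (@Pcowt_alphav i). Qed.

Lemma awt0 i : awt i 0 = 0.
Proof. by apply: ipair_eq; rewrite lfunE. Qed.

Lemma awtMz i mu z : Pwt mu -> awt i (mu *~ z) = awt i mu * z.
Proof.
move=> hm; have hn n : awt i (mu *+ n) = awt i mu * n%:Z.
  elim: n => [|n ih]; first by rewrite mulr0n mulr0 awt0.
  rewrite mulrS awtD //; last exact: (PwtMz n).
  by rewrite ih -addn1 PoszD mulrDr mulr1 addrC.
case: z => n; first exact: hn.
by rewrite NegzE mulrNz awtN ?hn ?mulrN //; exact: (PwtMz n.+1).
Qed.

Lemma ipair_dalphav i mu : Pwt mu ->
  ipair (alphav i *+ rd i) mu = (rd i)%:Z * awt i mu.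
Proof.
move=> hm; apply: ipair_eq; rewrite raddfMn /= -ipairE //; last exact: Pcowt_alphav.
by rewrite rmorphM /= mulr_natl.
Qed.

Lemma q_exp i (z : int) : qz ((rd i)%:Z * z) = qiz i z.
Proof. by rewrite qzE qizE -exprz_exp. Qed.

Lemma ppi_odd n : ppi ^+ n = ppi ^+ odd n.
Proof. by rewrite -{1}(odd_double_half n) exprD -mul2n exprM ppi2 expr1n mulr1. Qed.

(** This is where the congruence of p(i) and d_i modulo 2 enters: it turns the powers of pi^(d_i) by
    which J~_i acts into the powers of pi_i that occur in the q-integers. *)
Lemma pi_exp i (z : int) : pz ((rd i)%:Z * z) = piz i z.
Proof. by rewrite pzE pizE -exprz_exp /pi_ -par_rd -ppi_odd. Qed.

Lemma unit_ppi : ppi \is a GRing.unit.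
Proof. exact: unit_p ppi_mul. Qed.

Lemma unit_pi i : pi_ i \is a GRing.unit.
Proof. exact: unit_p (pi_mul i). Qed.

Lemma unit_q i : q_ i \is a GRing.unit.
Proof. exact: localU (q_local i). Qed.

Lemma qzD (a b : int) : qz (a + b) = qz a * qz b.
Proof. by rewrite !qzE; exact: exprzDr unit_qq _ _. Qed.

Lemma pzD (a b : int) : pz (a + b) = pz a * pz b.
Proof. by rewrite !pzE; exact: exprzDr unit_ppi _ _. Qed.

Lemma qizD i (a b : int) : qiz i (a + b) = qiz i a * qiz i b.
Proof. by rewrite !qizE; exact: exprzDr (unit_q i) _ _. Qed.

Lemma pizD i (a b : int) : piz i (a + b) = piz i a * piz i b.
Proof. by rewrite !pizE; exact: exprzDr (unit_pi i) _ _. Qed.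

Lemma qz0 : qz 0 = 1. Proof. by rewrite qzE. Qed.
Lemma qiz0 i : qiz i 0 = 1. Proof. by rewrite qizE. Qed.
Section Modules.
Variable M : Udata D.
Implicit Types m : M.

Lemma opEZ i a m : opE M i (a *: m) = a *: opE M i m. Proof. exact: linearZ_LR. Qed.
Lemma opFZ i a m : opF M i (a *: m) = a *: opF M i m. Proof. exact: linearZ_LR. Qed.
Lemma opKZ h a m : opK M h (a *: m) = a *: opK M h m. Proof. exact: linearZ_LR. Qed.
Lemma opJZ h a m : opJ M h (a *: m) = a *: opJ M h m. Proof. exact: linearZ_LR. Qed.
Lemma JtZ i a m : Jt M i (a *: m) = a *: Jt M i m. Proof. exact: linearZ_LR. Qed.
Lemma grZ t a m : gr t (a *: m) = a *: gr t m. Proof. exact: linearZ_LR. Qed.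
Lemma opKD h m m' : opK M h (m + m') = opK M h m + opK M h m'.
Proof. exact: linearD. Qed.
Lemma opJD h m m' : opJ M h (m + m') = opJ M h m + opJ M h m'.
Proof. exact: linearD. Qed.
Lemma opED i m m' : opE M i (m + m') = opE M i m + opE M i m'.
Proof. exact: linearD. Qed.
Lemma opFD i m m' : opF M i (m + m') = opF M i m + opF M i m'.
Proof. exact: linearD. Qed.
Lemma grD t m m' : gr t (m + m') = gr t m + gr t m'.
Proof. exact: linearD. Qed.
Lemma opE0 i : opE M i 0 = 0. Proof. exact: linear0. Qed.
Lemma opF0 i : opF M i 0 = 0. Proof. exact: linear0. Qed.
Lemma opK0 h : opK M h 0 = 0. Proof. exact: linear0. Qed.
Lemma opJ0 h : opJ M h 0 = 0. Proof. exact: linear0. Qed.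
Lemma gr0 t : gr t (0 : M) = 0. Proof. exact: linear0. Qed.

Lemma wtspaceP mu m : wtspace M mu m <-> forall h, Pcowt h ->
  opK M h m = qz (ipair h mu) *: m /\ opJ M h m = pz (ipair h mu) *: m.
Proof. by split=> hm h hh; have := hm h hh; rewrite qzE pzE. Qed.

Lemma wtspace_zero mu : wtspace M mu 0.
Proof. by apply/wtspaceP => h _; rewrite opK0 opJ0 !scaler0. Qed.

Lemma wtspaceD mu m m' : wtspace M mu m -> wtspace M mu m' -> wtspace M mu (m + m').
Proof.
move=> /wtspaceP hm /wtspaceP hm'; apply/wtspaceP => h hh.
have [e1 e2] := hm h hh; have [e3 e4] := hm' h hh.
by rewrite opKD opJD e1 e2 e3 e4 !scalerDr.
Qed.

Lemma wtspaceZ mu a m : wtspace M mu m -> wtspace M mu (a *: m).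
Proof.
move=> /wtspaceP hm; apply/wtspaceP => h hh; have [e1 e2] := hm h hh.
by rewrite opKZ opJZ e1 e2; split; exact: scalerAC.
Qed.

Lemma wtspace_sum mu I (r : seq I) (P : pred I) (f : I -> M) :
  (forall l, P l -> wtspace M mu (f l)) -> wtspace M mu (\sum_(l <- r | P l) f l).
Proof.
by move=> h; apply: (big_ind (wtspace M mu)) => //; [exact: wtspace_zero|exact: wtspaceD].
Qed.

Lemma Kt_wt i mu m : Pwt mu -> wtspace M mu m -> Kt M i m = qiz i (awt i mu) *: m.
Proof.
move=> hP /wtspaceP hm; have [|-> _] := hm (alphav i *+ rd i).
  by apply: PcowtMn; exact: Pcowt_alphav.
by rewrite ipair_dalphav // q_exp.
Qed.

Lemma Jt_wt i mu m : Pwt mu -> wtspace M mu m -> Jt M i m = piz i (awt i mu) *: m.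
Proof.
move=> hP /wtspaceP hm; have [|_ ->] := hm (alphav i *+ rd i).
  by apply: PcowtMn; exact: Pcowt_alphav.
by rewrite ipair_dalphav // pi_exp.
Qed.

Lemma Ktinv_wt i mu m : Pwt mu -> wtspace M mu m ->
  Ktinv M i m = qiz i (- awt i mu) *: m.
Proof.
move=> hP /wtspaceP hm; have hc : Pcowt (alphav i *+ rd i).
  by apply: PcowtMn; exact: Pcowt_alphav.
have [|-> _] := hm (- (alphav i *+ rd i)); first exact: PcowtN.
rewrite (_ : ipair _ mu = (rd i)%:Z * (- awt i mu)) ?q_exp //.
rewrite mulrN -ipair_dalphav //; apply: ipair_eq.
by rewrite raddfN rmorphN /= ipairE.
Qed.

Hypothesis HU : is_Umodule M.

Lemma KE_rel h i m : Pcowt h ->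
  [/\ opK M h (opE M i m) = qz (ipair h (alpha i)) *: opE M i (opK M h m),
      opJ M h (opE M i m) = pz (ipair h (alpha i)) *: opE M i (opJ M h m),
      opK M h (opF M i m) = qz (- ipair h (alpha i)) *: opF M i (opK M h m)
    & opJ M h (opF M i m) = pz (- ipair h (alpha i)) *: opF M i (opJ M h m)].
Proof. by move=> hh; have [_ _ _ /(_ h i m hh) + _] := HU; rewrite !qzE !pzE. Qed.

Lemma E_wt i mu m : Pwt mu -> wtspace M mu m -> wtspace M (mu + alpha i) (opE M i m).
Proof.
move=> hP /wtspaceP hm; apply/wtspaceP => h hh.
have [-> -> _ _] := KE_rel i m hh.
have [-> ->] := hm h hh; rewrite !opEZ ipairD //; last exact: alpha_Pwt.
by rewrite qzD pzD; split; rewrite scalerAC scalerA.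
Qed.

Lemma F_wt i mu m : Pwt mu -> wtspace M mu m -> wtspace M (mu - alpha i) (opF M i m).
Proof.
move=> hP /wtspaceP hm; apply/wtspaceP => h hh.
have [_ _ -> ->] := KE_rel i m hh.
have [-> ->] := hm h hh; rewrite !opFZ.
have Pa := alpha_Pwt i; rewrite ipairD //; last exact: PwtN.
by rewrite ipairN // qzD pzD; split; rewrite scalerAC scalerA.
Qed.

Lemma qnum_awt i z : qnum (pi_ i) (q_ i) z =
  (pi_ i * q_ i - (q_ i)^-1)^-1 * (piz i z * qiz i z - qiz i (- z)).
Proof.
by rewrite qnum_def mulrC exprzMu ?unit_pi ?unit_q // pizE !qizE.
Qed.

Lemma EF_wt i mu m : Pwt mu -> wtspace M mu m ->
  opE M i (opF M i m) - pi_ i *: opF M i (opE M i m) =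
  qnum (pi_ i) (q_ i) (awt i mu) *: m.
Proof.
move=> hP hm; have [_ _ _ _ [_ _ /(_ i i m)]] := HU.
rewrite mulnn eqxx (_ : (par i ^ 2)%N = par i); last by case: (par i).
rewrite -/(pi_ i) => ->; rewrite qnum_awt -scalerA; congr (_ *: _).
rewrite (Kt_wt _ hP hm) JtZ (Jt_wt _ hP hm) (Ktinv_wt _ hP hm).
by rewrite scalerA scalerBl; congr (_ *: _ - _); exact: mulrC.
Qed.
End Modules.
End Weights.

(** * Kashiwara operators *)

Section RankOneModule.
Variables (D : root_data) (M : Udata D) (i : rI D).
Hypothesis HM : in_Oint M.
Local Notation wt := 'Hom(hh D, rat^o).
Implicit Types (mu nu : wt) (m u v : M).

Let HU : is_Umodule M. Proof. by case: HM => -[]. Qed.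

Lemma nilE_M v : exists n, iter n (opE M i) v = 0. Proof. by case: HM. Qed.
Lemma nilF_M v : exists n, iter n (opF M i) v = 0. Proof. by case: HM. Qed.

Definition wstring mu (k : int) : set M := wtspace M (mu + alpha i *~ k).

Lemma Pwt_string mu k : Pwt mu -> Pwt (mu + alpha i *~ k).
Proof. by move=> hP; apply: PwtD => //; apply: PwtMz; exact: alpha_Pwt. Qed.

Lemma awt_string mu k : Pwt mu -> awt i (mu + alpha i *~ k) = awt i mu + 2 * k.
Proof.
move=> hP; have Pa := alpha_Pwt i; rewrite awtD //; last exact: PwtMz.
by rewrite awtMz // awt_alpha cartan_diag.
Qed.

Lemma wstring_zero mu k : wstring mu k 0. Proof. exact: wtspace_zero. Qed.
Lemma wstringD mu k v w : wstring mu k v -> wstring mu k w -> wstring mu k (v + w).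
Proof. exact: wtspaceD. Qed.
Lemma wstringZ mu k a v : wstring mu k v -> wstring mu k (a *: v).
Proof. exact: wtspaceZ. Qed.

Lemma wstringE mu : Pwt mu ->
  forall k v, wstring mu k v -> wstring mu (k + 1) (opE M i v).
Proof.
move=> hP k v hv; have := E_wt HU i (Pwt_string k hP) hv.
by rewrite /wstring mulrzDr mulr1z addrA.
Qed.

Lemma wstringF mu : Pwt mu ->
  forall k v, wstring mu k v -> wstring mu (k - 1) (opF M i v).
Proof.
move=> hP k v hv; have := F_wt HU i (Pwt_string k hP) hv.
by rewrite /wstring mulrzBr mulr1z addrA.
Qed.

Lemma wstringEF mu : Pwt mu -> forall k v, wstring mu k v ->
  opE M i (opF M i v) - pi_ i *: opF M i (opE M i v) =
  qnum (pi_ i) (q_ i) (awt i mu + 2 * k) *: v.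
Proof. by move=> hP k v hv; rewrite (EF_wt HU i (Pwt_string k hP) hv) awt_string. Qed.

Definition kstring mu (c : nat -> M) : Prop := forall k,
  [/\ wtspace M (mu + alpha i *+ k) (c k), opE M i (c k) = 0
    & ~~ (k%:Z <= ipair (alphav i) (mu + alpha i *+ k)) -> c k = 0].

Lemma kstringP mu c : Pwt mu ->
  kstring mu c <-> string_decomp (opE M i) (wstring mu) (awt i mu) 0 c.
Proof.
move=> hP; have e k : ipair (alphav i) (mu + alpha i *+ k) = awt i mu + 2 * (0 + k%:Z).
  by rewrite add0r -awt_string.
by split=> h k; have := h k; rewrite e /wstring add0r.
Qed.

Lemma kstring_exists mu m : Pwt mu -> wtspace M mu m ->
  exists n c, kstring mu c /\ m = \sum_(k < n) divF i k (c k).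
Proof.
move=> hP hm; have [n en] := nilE_M m.
have hm0 : wstring mu 0 m by rewrite /wstring mulr0z addr0.
have [c hc em] := string_decomp_exists (q_local i) (Api_pi i) (pi_mul i)
  (@wstring_zero mu) (@wstringD mu) (@wstringZ mu) (wstringE hP) (wstringF hP)
  (wstringEF hP) nilF_M hm0 en.
exists n, c; split; first exact/kstringP.
by rewrite em; apply: eq_bigr => k _; rewrite divFE.
Qed.

Lemma kstring_uniq mu n c : Pwt mu -> kstring mu c ->
  \sum_(k < n) divF i k (c k) = 0 -> forall k, (k < n)%N -> c k = 0.
Proof.
move=> hP /(kstringP c hP) hc s0.
apply: (string_decomp_uniq (q_local i) (Api_pi i) (pi_mul i)
  (wstringF hP) (wstringEF hP)) hc _.
by rewrite -[RHS]s0; apply: eq_bigr => k _; rewrite divFE.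
Qed.

Definition highest mu u : Prop := [/\ Pwt mu, wtspace M mu u & opE M i u = 0].

Lemma highest_string mu u : highest mu u -> wstring mu 0 u.
Proof. by case=> _ hu _; rewrite /wstring mulr0z addr0. Qed.

Lemma highest_ge0 mu u : highest mu u -> u != 0 -> 0 <= awt i mu.
Proof.
move=> hu; have [hP _ Eu] := hu => u0; rewrite -[awt i mu]addr0 -(mulr0 2).
exact: (highest_wt_ge0 (q_local i) (Api_pi i) (pi_mul i)
  (wstringF hP) (wstringEF hP) nilF_M (highest_string hu) Eu u0).
Qed.

Lemma divF_eq0 mu u n : highest mu u -> awt i mu < n%:Z -> divF i n u = 0.
Proof.
move=> hu lt; have [hP _ Eu] := hu; rewrite divFE.
apply: (Fd_eq0 (q_local i) (Api_pi i) (pi_mul i)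
  (wstringF hP) (wstringEF hP) nilF_M (highest_string hu) Eu).
by rewrite mulr0 addr0.
Qed.

Lemma F_divF n u : opF M i (divF i n u) = qnum (pi_ i) (q_ i) n.+1 *: divF i n.+1 u.
Proof. by rewrite !divFE (F_Fd (q_local i) (Api_pi i)). Qed.

Lemma E_divF mu u n : highest mu u -> opE M i (divF i n.+1 u) =
  (pi_ i ^+ n * qnum (pi_ i) (q_ i) (awt i mu - n%:Z)) *: divF i n u.
Proof.
move=> hu; have [hP _ Eu] := hu; rewrite !divFE.
rewrite (E_Fd (q_local i) (Api_pi i) (pi_mul i) (wstringF hP) (wstringEF hP) _
  (highest_string hu) Eu).
by rewrite mulr0 addr0.
Qed.

Lemma divF0 u : divF i 0 u = u.
Proof. by rewrite divFE divpow0. Qed.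

Lemma divFD n v w : divF i n (v + w) = divF i n v + divF i n w :> M.
Proof. by rewrite !divFE divpowD. Qed.

Lemma divFZ n a v : divF i n (a *: v) = a *: divF i n v :> M.
Proof. by rewrite !divFE divpowZ. Qed.

Lemma divF_zero n : divF i n 0 = 0 :> M.
Proof. by rewrite divFE divpow_zero. Qed.

Lemma divF_wt mu n v : Pwt mu -> wtspace M mu v -> wtspace M (mu - alpha i *+ n) (divF i n v).
Proof.
move=> hP hv; rewrite divFE divpow_def; apply: wtspaceZ.
have hv0 : wstring mu 0 v by rewrite /wstring mulr0z addr0.
have := W_iterF (wstringF hP) n hv0.
by rewrite /wstring sub0r mulrNz.
Qed.

Lemma divF_string mu c k : Pwt mu -> kstring mu c -> wtspace M mu (divF i k (c k)).
Proof.
move=> hP hc; have [hw _ _] := hc k.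
have := divF_wt k (Pwt_string k hP) hw.
by rewrite /= -[alpha i *~ k%:Z]/(alpha i *+ k) addrK.
Qed.

Section Graph.
Variable g : nat -> M -> M.
Hypothesis gD : forall k v w, g k (v + w) = g k v + g k w.
Hypothesis gZ : forall k a v, g k (a *: v) = a *: g k v.

Let g0 k : g k 0 = 0. Proof. by have := gZ k 0 0; rewrite !scale0r. Qed.

(** The relation from which [etilde] and [ftilde] choose a value, with [g] in place of F^(k-1) or
    F^(k+1). Proving it linear, total and single-valued treats both operators at once. *)
Definition kgraph m x : Prop := exists t n c, [/\ kdecomp i t n c,
    m = \sum_(mu <- t) \sum_(k < n) divF i k (c mu k)
  & x = \sum_(mu <- t) \sum_(k < n) g k (c mu k)].

(** Padding by zeros brings two decompositions to the same weights and the same length, so that they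
    can be added term by term. *)
Lemma kdecomp_extend t n (c : wt -> nat -> M) t' n' : kdecomp i t n c ->
  uniq t' -> {subset t <= t'} -> (forall mu, mu \in t' -> Pwt mu) -> (n <= n')%N ->
  exists c', kdecomp i t' n' c' /\ forall g' : nat -> M -> M, (forall k, g' k 0 = 0) ->
     \sum_(mu <- t') \sum_(k < n') g' k (c' mu k) = \sum_(mu <- t) \sum_(k < n) g' k (c mu k).
Proof.
move=> [ut hc] ut' tt' Pt' nn'.
pose c' mu k := if (mu \in t) && (k < n)%N then c mu k else 0.
exists c'; split.
  split=> // mu mt'; split; first exact: Pt'.
  move=> k; rewrite /c'; case: ifP => [/andP[mt _]|_].
    by have [_] := hc mu mt; exact.
  by split=> //; [exact: wtspace_zero|exact: opE0].
move=> g' g'0.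
rewrite (bigID (mem t)) /= addrC big1 ?add0r => [|mu nt]; last first.
  by rewrite big1 // => k _; rewrite /c' (negbTE nt) g'0.
rewrite -big_filter.
have pt : perm_eq [seq mu <- t' | mu \in t] t.
  apply: uniq_perm => //; first exact: filter_uniq.
  move=> mu; rewrite mem_filter; case mt: (mu \in t) => //=.
  exact: tt'.
rewrite (perm_big _ pt) /= big_seq [RHS]big_seq; apply: eq_bigr => mu mt.
rewrite (big_ord_widen n' (fun k => g' k (c mu k)) nn') [RHS]big_mkcond /=.
by apply: eq_bigr => k _; rewrite /c' mt /=; case: ifP.
Qed.

Lemma kgraphD m m' x x' : kgraph m x -> kgraph m' x' -> kgraph (m + m') (x + x').
Proof.
move=> [t1 [n1 [c1 [h1 -> ->]]]] [t2 [n2 [c2 [h2 -> ->]]]].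
pose t := undup (t1 ++ t2); pose n := maxn n1 n2.
have Pt mu : mu \in t -> Pwt mu.
  rewrite mem_undup mem_cat => /orP[mt|mt].
    by have [_ /(_ mu mt)[]] := h1.
  by have [_ /(_ mu mt)[]] := h2.
have [|c1' [k1 e1]] := kdecomp_extend h1 (undup_uniq (t1 ++ t2)) _ Pt (leq_maxl n1 n2).
  by move=> mu mt; rewrite mem_undup mem_cat mt.
have [|c2' [k2 e2]] := kdecomp_extend h2 (undup_uniq (t1 ++ t2)) _ Pt (leq_maxr n1 n2).
  by move=> mu mt; rewrite mem_undup mem_cat mt orbT.
exists t, n, (fun mu k => c1' mu k + c2' mu k); split.
- split; first exact: undup_uniq.
  move=> mu mt; split; first exact: Pt.
  have [_ /(_ mu mt)[_ {}k1]] := k1; have [_ /(_ mu mt)[_ {}k2]] := k2.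
  move=> k; have [w1 E1 z1] := k1 k; have [w2 E2 z2] := k2 k; split.
  + exact: wtspaceD.
  + by rewrite opED E1 E2 addr0.
  + by move=> hk; rewrite z1 // z2 // addr0.
- rewrite -(e1 (divF i) divF_zero) -(e2 (divF i) divF_zero) -big_split; apply: eq_bigr => mu _; rewrite -big_split.
  by apply: eq_bigr => k _; rewrite divFD.
- rewrite -(e1 g g0) -(e2 g g0) -big_split; apply: eq_bigr => mu _; rewrite -big_split.
  by apply: eq_bigr => k _; rewrite gD.
Qed.

Lemma kgraphZ a m x : kgraph m x -> kgraph (a *: m) (a *: x).
Proof.
move=> [t [n [c [[ut h] -> ->]]]]; exists t, n, (fun mu k => a *: c mu k); split.
- split=> // mu mt; have [hP {}h] := h mu mt; split=> // k; have [w0 E0 z0] := h k.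
  split; first exact: wtspaceZ.
    by rewrite opEZ E0 scaler0.
  by move=> hk; rewrite z0 // scaler0.
- rewrite scaler_sumr; apply: eq_bigr => mu _; rewrite scaler_sumr.
  by apply: eq_bigr => k _; rewrite divFZ.
- rewrite scaler_sumr; apply: eq_bigr => mu _; rewrite scaler_sumr.
  by apply: eq_bigr => k _; rewrite gZ.
Qed.

Lemma kgraph_string mu n c : Pwt mu -> kstring mu c ->
  kgraph (\sum_(k < n) divF i k (c k)) (\sum_(k < n) g k (c k)).
Proof.
move=> hP hc; exists [:: mu], n, (fun _ => c); split; rewrite ?big_seq1 //.
by split=> // nu; rewrite inE => /eqP ->; split.
Qed.

Lemma kgraph_total m : exists x, kgraph m x.
Proof.
have [[_ [_ hs _] _] _ _ _] := HM.
have [t [w [_ ht ->]]] := hs m I.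
rewrite big_seq; elim/big_rec: _ => [|mu y mt [x hx]].
  exists 0, [::], 0%N, (fun _ _ => 0); split; rewrite ?big_nil //.
have [hP hw] := ht mu mt.
have [n [c [hc ->]]] := kstring_exists hP hw.
by exists (\sum_(k < n) g k (c k) + x); apply: kgraphD hx; exact: (kgraph_string n hP hc).
Qed.

(** The directness of the weight decomposition isolates one weight, where the uniqueness of string
    decompositions applies. *)
Lemma kgraph_zero x : kgraph 0 x -> x = 0.
Proof.
move=> [t [n [c [[ut h] e ->]]]].
have [[_ [_ _ hu] _] _ _ _] := HM.
have hs := hu t (fun mu => \sum_(k < n) divF i k (c mu k)) ut _ (esym e).
rewrite big_seq big1 // => mu mt; rewrite big1 // => k _.
have [hP hc] := h mu mt.
rewrite (kstring_uniq hP hc (hs _ mu mt) (ltn_ord k)) // => nu nt.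
have [hP' hc'] := h nu nt; split=> //; apply: wtspace_sum => l _.
exact: divF_string.
Qed.

Lemma kgraph_fun m x y : kgraph m x -> kgraph m y -> x = y.
Proof.
move=> hx hy; apply/eqP; rewrite -subr_eq0; apply/eqP; apply: kgraph_zero.
by have := kgraphD hx (kgraphZ (-1) hy); rewrite !scaleN1r subrr.
Qed.

Lemma kgraph_highest mu u n : highest mu u -> n%:Z <= awt i mu ->
  kgraph (divF i n u) (g n u).
Proof.
move=> [hP hu Eu] hn.
pose c k := if k == n then u else 0.
have hc : kstring (mu - alpha i *+ n) c.
  move=> k; rewrite /c; case: eqP => [->|_].
    by rewrite subrK; split=> //; rewrite -/(awt i mu) hn.
  by split=> //; [exact: wtspace_zero|exact: opE0].
have := @kgraph_string _ n.+1 c (PwtB hP (PwtMz n (alpha_Pwt i))) hc.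
rewrite !big_ord_recr /= /c eqxx big1 ?add0r => [|k _]; last first.
  by rewrite ltn_eqF ?divF_zero.
by rewrite big1 ?add0r // => k _; rewrite ltn_eqF ?g0.
Qed.
End Graph.

Let predD k v w : divF_pred i k (v + w) = divF_pred i k v + divF_pred i k w :> M.
Proof. by case: k => [|k] /=; rewrite ?addr0 ?divFD. Qed.
Let predZ k a v : divF_pred i k (a *: v) = a *: divF_pred i k v :> M.
Proof. by case: k => [|k] /=; rewrite ?scaler0 ?divFZ. Qed.
Let succD k v w : divF i k.+1 (v + w) = divF i k.+1 v + divF i k.+1 w :> M.
Proof. exact: divFD. Qed.
Let succZ k a v : divF i k.+1 (a *: v) = a *: divF i k.+1 v :> M.
Proof. exact: divFZ. Qed.

Lemma etilde_graph m : kgraph (divF_pred i) m (etilde M i m).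
Proof.
have [x hx] := kgraph_total predD predZ m.
exact: (@xgetPex _ 0 (kgraph (divF_pred i) m) (ex_intro _ x hx)).
Qed.

Lemma ftilde_graph m : kgraph (fun k => divF i k.+1) m (ftilde M i m).
Proof.
have [x hx] := kgraph_total succD succZ m.
exact: (@xgetPex _ 0 (kgraph (fun k => divF i k.+1) m) (ex_intro _ x hx)).
Qed.

Lemma etilde_eq m x : kgraph (divF_pred i) m x -> etilde M i m = x.
Proof. by move=> h; exact: (kgraph_fun predD predZ (etilde_graph m) h). Qed.

Lemma ftilde_eq m x : kgraph (fun k => divF i k.+1) m x -> ftilde M i m = x.
Proof. by move=> h; exact: (kgraph_fun succD succZ (ftilde_graph m) h). Qed.

Lemma etildeD v w : etilde M i (v + w) = etilde M i v + etilde M i w.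
Proof. by apply: etilde_eq; apply: kgraphD => //; exact: etilde_graph. Qed.

Lemma etildeZ a v : etilde M i (a *: v) = a *: etilde M i v.
Proof. by apply: etilde_eq; apply: kgraphZ => //; exact: etilde_graph. Qed.

Lemma ftildeD v w : ftilde M i (v + w) = ftilde M i v + ftilde M i w.
Proof. by apply: ftilde_eq; apply: kgraphD => //; exact: ftilde_graph. Qed.

Lemma ftildeZ a v : ftilde M i (a *: v) = a *: ftilde M i v.
Proof. by apply: ftilde_eq; apply: kgraphZ => //; exact: ftilde_graph. Qed.

Lemma etilde_divF mu u n : highest mu u -> n%:Z <= awt i mu ->
  etilde M i (divF i n u) = if n is n'.+1 then divF i n' u else 0.
Proof. by move=> hu hn; apply: etilde_eq; exact: (kgraph_highest predZ hu hn). Qed.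

Lemma ftilde_divF mu u n : highest mu u -> n%:Z <= awt i mu ->
  ftilde M i (divF i n u) = divF i n.+1 u.
Proof. by move=> hu hn; apply: ftilde_eq; exact: (kgraph_highest succZ hu hn). Qed.
End RankOneModule.

(** * Twisted commutators and their polynomials *)

Section SerreProduct.
Variables (R : comUnitRingType) (V : lmodType R).

(* The composite of the operators Z |-> f Z - c_k Z f, k < n, applied to Y. *)
Fixpoint twisted_comm (c : nat -> R) (f : V -> V) (n : nat) (Y : V -> V) (x : V) : V :=
  if n is n'.+1 then
    f (twisted_comm c f n' Y x) - c n' *: twisted_comm c f n' Y (f x)
  else Y x.

(** Left and right composition with f commute, so a composite of twisted commutators is governed by
    a polynomial in which the power of 'X counts the copies of f on the right of Y. *)
Definition twist_poly (c : nat -> R) (n : nat) : {poly R} :=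
  \prod_(k < n) (1 - (c k)%:P * 'X).

Lemma twist_polyS c n s : (twist_poly c n.+1)`_s =
  (twist_poly c n)`_s - c n * (if s is s'.+1 then (twist_poly c n)`_s' else 0).
Proof.
rewrite /twist_poly big_ord_recr /= mulrBr mulr1 coefB mulrA coefMX.
case: s => [|s] /=; first by rewrite mulr0.
by rewrite coefMC mulrC.
Qed.

Lemma size_twist_poly c n : (size (twist_poly c n) <= n.+1)%N.
Proof.
apply/leq_sizeP => s; elim: n s => [|n ih] s.
  by rewrite /twist_poly big_ord0 coef1; case: s.
case: s => // s ns; rewrite twist_polyS !ih ?mulr0 ?subr0 //.
exact: ltnW.
Qed.

Lemma twisted_commE c (f : {linear V -> V}) n Y x : twisted_comm c f n Y x =
  \sum_(s < n.+1) (twist_poly c n)`_s *: iter (n - s) f (Y (iter s f x)).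
Proof.
elim: n x => [|n ih] x.
  by rewrite big_ord1 /twist_poly big_ord0 coef1 scale1r.
rewrite /= !ih linear_sum /=.
have -> : \sum_(s < n.+2) (twist_poly c n.+1)`_s *: iter (n.+1 - s) f (Y (iter s f x))
  = \sum_(s < n.+2) (twist_poly c n)`_s *: iter (n.+1 - s) f (Y (iter s f x)) -
    \sum_(s < n.+2) (c n * (if s : nat is s'.+1 then (twist_poly c n)`_s' else 0)) *:
      iter (n.+1 - s) f (Y (iter s f x)).
  by rewrite -sumrB; apply: eq_bigr => s _; rewrite twist_polyS scalerBl.
congr (_ - _).
  rewrite [RHS]big_ord_recr /= nth_default ?size_twist_poly // scale0r addr0.
  apply: eq_bigr => s _; rewrite linearZ /= subSn //; by rewrite -ltnS.
rewrite [RHS]big_ord_recl /= mulr0 scale0r add0r scaler_sumr.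
by apply: eq_bigr => s _; rewrite scalerA -iterSr.
Qed.

(** The polynomial does not depend on the order of its factors. This is what allows opposite orders
    on the two halves of Delta(X_j). *)
Lemma twisted_comm_rev c (f : {linear V -> V}) n Y x :
  twisted_comm (fun k => c (n.-1 - k)%N) f n Y x = twisted_comm c f n Y x.
Proof.
rewrite !twisted_commE; suff -> : twist_poly (fun k => c (n.-1 - k)%N) n = twist_poly c n by [].
rewrite /twist_poly [RHS](reindex_inj rev_ord_inj) /=; apply: eq_bigr => k _.
by rewrite subnS predn_sub.
Qed.

Lemma eq_twisted_comm c c' f n Y x : (forall k, (k < n)%N -> c k = c' k) ->
  twisted_comm c f n Y x = twisted_comm c' f n Y x.
Proof.
elim: n x => //= n ih x h; rewrite h ?ltnSn //.
by rewrite !ih // => k kn; apply: h; exact: ltnW.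
Qed.

Lemma twisted_commD c (f : {linear V -> V}) n Y1 Y2 Y x : (forall x, Y x = Y1 x + Y2 x) ->
  twisted_comm c f n Y x = twisted_comm c f n Y1 x + twisted_comm c f n Y2 x.
Proof.
move=> h; elim: n x => [|n ih] x /=; first exact: h.
by rewrite !ih linearD scalerDr opprD addrACA.
Qed.

Lemma twisted_comm_lin c (f Y : {linear V -> V}) n :
  (forall x y, twisted_comm c f n Y (x + y) = twisted_comm c f n Y x + twisted_comm c f n Y y)
  /\ (forall a x, twisted_comm c f n Y (a *: x) = a *: twisted_comm c f n Y x).
Proof.
elim: n => [|n [ihD ihZ]] /=.
  by split=> *; rewrite ?linearD ?linearZ.
split=> [x y|a x].
  by rewrite (linearD f x) !ihD linearD scalerDr opprD addrACA.
by rewrite (linearZ_LR f) !ihZ linearZ_LR scalerBr !scalerA [a * _]mulrC.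
Qed.
End SerreProduct.

(** * The quantum binomial theorem with a sign *)

Section QBinomial.
Variables (R : comUnitRingType) (A : set R) (q : R).
Hypothesis HA : local_at A q.
Variable p : R.
Hypotheses (Ap : A p) (pp : p * p = 1).
Local Notation qn := (qnum p q).
Local Notation qf := (qnum_fact p q).

Lemma qnum_add (a b : nat) :
  qn (a + b)%N = (p * q) ^+ a * qn b + q ^- b * qn a.
Proof.
have uD := unit_qnum_den HA Ap.
have eN (n : nat) : q ^ (- n%:Z) = q ^- n by rewrite exprnN.
have h (n : nat) : (p * q - q^-1) * qn n = (p * q) ^+ n - q ^- n.
  by rewrite (qnumE HA Ap) eN.
apply: (mulrI uD); rewrite mulrDr !(mulrCA (p * q - q^-1)) !h !exprD.
by rewrite invrM ?unitrX ?(localU HA) //; ring.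
Qed.

Definition gbin n s : R := qf n / (qf s * qf (n - s)).

Lemma gbin_pascal n s : (s < n)%N ->
  gbin n.+1 s.+1 = (p * q) ^+ s.+1 * gbin n s.+1 + q ^- (n - s) * gbin n s.
Proof.
move=> sn; rewrite /gbin subSS.
have uf k : qf k \is a GRing.unit by exact: (unit_qnum_fact HA Ap).
have un (k : nat) : qn k.+1 \is a GRing.unit by exact: (unit_qnumS HA Ap).
have -> : (n - s = (n - s.+1).+1)%N by lia.
set b := (n - s.+1)%N.
have U : qf s.+1 * qf b.+1 \is a GRing.unit by rewrite unitrM !uf.
apply: (mulIr U); rewrite mulrVK // mulrDl -!mulrA.
have e1 : (qf s.+1 * qf b)^-1 * (qf s.+1 * qf b.+1) = qn b.+1.
  by rewrite [qf b.+1]qnum_factS mulrA mulKr // unitrM !uf.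
have e2 : (qf s * qf b.+1)^-1 * (qf s.+1 * qf b.+1) = qn s.+1.
  by rewrite [qf s.+1]qnum_factS (mulrAC (qf s)) mulKr // unitrM !uf.
rewrite e1 e2 qnum_factS.
have -> : qn n.+1 = qn (s.+1 + b.+1)%N by congr (qn _); rewrite /b; lia.
by rewrite qnum_add; ring.
Qed.

Lemma gbin0 n : gbin n 0 = 1.
Proof. by rewrite /gbin qnum_fact0 mul1r subn0 divrr // (unit_qnum_fact HA Ap). Qed.

Lemma gbinn n : gbin n n = 1.
Proof. by rewrite /gbin subnn qnum_fact0 mulr1 divrr // (unit_qnum_fact HA Ap). Qed.

(** The quantum binomial theorem for a geometric progression of ratio p q^(-2); the induction on n
    is the Pascal rule. *)
Lemma qbinomial (z : R) n s : (s <= n)%N ->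
  (twist_poly (fun k => z * p ^+ k * q ^- (2 * k)) n)`_s =
  (- z) ^+ s * p ^+ ('C(s, 2) + s * n.-1) * q ^- (s * n.-1) * gbin n s.
Proof.
set c := (fun k => _).
elim: n s => [|n ih] s.
  by rewrite leqn0 => /eqP ->; rewrite /twist_poly big_ord0 coef1 gbin0 !mul0n !expr0 invr1 !mulr1.
rewrite twist_polyS; case: s => [|s] sn.
  by rewrite mulr0 subr0 ih // !gbin0 !mul0n.
rewrite (ih s) //=.
have uqX k : q ^+ k \is a GRing.unit by rewrite unitrX // (localU HA).
have p2 k r : p ^+ (k + 2 * r) = p ^+ k.
  by rewrite exprD exprM expr2 pp expr1n mulr1.
have eq2 k : (2 * k = k + k)%N by lia.
have binS : 'C(s.+1, 2) = ('C(s, 2) + s)%N by rewrite binS bin1.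
have e2 : c n * ((- z) ^+ s * p ^+ ('C(s, 2) + s * n.-1) * q ^- (s * n.-1) * gbin n s) =
  - ((- z) ^+ s.+1 * p ^+ ('C(s.+1, 2) + s.+1 * n) * q ^- (s.+1 * n) * (q ^- (n - s) * gbin n s)).
  rewrite /c exprS.
  have -> : p ^+ ('C(s.+1, 2) + s.+1 * n) = p ^+ n * p ^+ ('C(s, 2) + s * n.-1).
    rewrite -exprD binS; case: n {ih} sn => [|n] sn /=.
      by have -> : s = 0%N by lia.
    rewrite (_ : (_ + _ + _)%N = (n.+1 + ('C(s, 2) + s * n) + 2 * s)%N) ?p2 //.
    by rewrite mulnS mulSn; lia.
  have e3 : q ^- (s.+1 * n) * q ^- (n - s) = q ^- (2 * n) * q ^- (s * n.-1).
    rewrite -!invrM //; congr (_^-1); rewrite -!exprD; congr (_ ^+ _).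
    case: n {ih} sn => [|n] sn /=; first by have -> : s = 0%N by lia.
    by rewrite !mulnS mulSn; lia.
  transitivity (z * p ^+ n * ((- z) ^+ s * p ^+ ('C(s, 2) + s * n.-1) * gbin n s) *
    (q ^- (2 * n) * q ^- (s * n.-1))); first by ring.
  by rewrite -e3; ring.
rewrite e2 opprK.
have [sn'|] := ltnP s n; last first.
  move=> ns; have {ns sn} -> : s = n by lia.
  rewrite nth_default ?size_twist_poly // add0r subnn expr0 invr1 mul1r.
  by rewrite gbinn gbinn.
rewrite ih // gbin_pascal // !mulrDr; congr (_ + _).
have -> : p ^+ ('C(s.+1, 2) + s.+1 * n.-1) = p ^+ ('C(s.+1, 2) + s.+1 * n) * p ^+ s.+1.
  rewrite -exprD; case: n {ih sn e2} sn' => // n _ /=.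
  rewrite (_ : (_ + _ + s.+1)%N = ('C(s.+1, 2) + s.+1 * n + 2 * s.+1)%N) ?p2 //.
  by rewrite mulnS; lia.
have -> : q ^- (s.+1 * n.-1) = q ^- (s.+1 * n) * q ^+ s.+1.
  apply: (mulIr (uqX (s.+1 * n.-1)%N)); rewrite mulVr // -mulrA -exprD.
  rewrite (_ : (_ + _)%N = (s.+1 * n)%N) ?mulVr //.
  by case: n {ih sn e2} sn' => // n _ /=; rewrite mulnS; lia.
by rewrite exprMn; ring.
Qed.
(** The factor (p q)^(n-1) in the coefficients absorbs the powers with exponent s (n-1) that
    [qbinomial] produces. *)
Lemma serre_twisted (V : lmodType R) (w : R) (f : {linear V -> V}) Y n x :
  \sum_(s < n.+1) ((-1) ^+ s * (w ^+ s * p ^+ 'C(s, 2)) * gbin n s) *: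
    iter (n - s) f (Y (iter s f x)) =
  twisted_comm (fun k => w * (p * q) ^+ n.-1 * p ^+ k * q ^- (2 * k)) f n Y x.
Proof.
rewrite twisted_commE; apply: eq_bigr => s _; congr (_ *: _).
rewrite qbinomial -1?ltnS //; congr (_ * _).
have uqX k : q ^+ k \is a GRing.unit by rewrite unitrX // (localU HA).
have -> : (- (w * (p * q) ^+ n.-1)) ^+ s =
    (-1) ^+ s * w ^+ s * (p ^+ (s * n.-1) * q ^+ (s * n.-1)).
  have h (y : R) : y ^+ n.-1 ^+ s = y ^+ (s * n.-1) by rewrite -exprM mulnC.
  rewrite -[in LHS]mulN1r [(p * q) ^+ n.-1]exprMn.
  by rewrite !exprMn !h mulrA.
rewrite exprD; set b := _ * w ^+ s; set y := p ^+ 'C(s, 2).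
have e1 : p ^+ (s * n.-1) * p ^+ (s * n.-1) = 1 := pK pp _.
have e2 : q ^+ (s * n.-1) * q ^- (s * n.-1) = 1 by rewrite divrr.
move: e1 e2; move: (p ^+ (s * n.-1)) (q ^+ (s * n.-1)) (q ^- (s * n.-1)) => u v v' e1 e2.
have -> : b * (u * v) * (y * u) * v' = b * y * (u * u) * (v * v') by ring.
by rewrite e1 e2 !mulr1 mulrA.
Qed.
End QBinomial.

HB.lock Definition psign (b : bool) : Qqpi := ppi ^+ b.

Lemma psignE b : psign b = ppi ^+ b. Proof. by rewrite psign.unlock. Qed.

Lemma psign0 : psign false = 1. Proof. by rewrite psignE. Qed.

Lemma psignD a b : psign (a (+) b) = psign a * psign b.
Proof. by rewrite !psignE; case: a; case: b; rewrite ?mulr1 ?mul1r // ppi_mul. Qed.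

Lemma psignK a : psign a * psign a = 1.
Proof. by rewrite -psignD addbb psign0. Qed.

Section TensorBilinear.
Variables (R : comNzRingType) (M M' : lmodType R).
Implicit Types (m : M).

Lemma tensDl m1 m2 (m' : M') : tens (m1 + m2) m' = tens m1 m' + tens m2 m'.
Proof. exact: linearDl. Qed.
Lemma tensDr m (m1 m2 : M') : tens m (m1 + m2) = tens m m1 + tens m m2 :> tensor M M'.
Proof. exact: linearDr. Qed.
Lemma tensZl a m (m' : M') : tens (a *: m) m' = a *: tens m m'.
Proof. exact: linearZl_LR. Qed.
Lemma tensZr a m (m' : M') : tens m (a *: m') = a *: tens m m'.
Proof. exact: linearZr_LR. Qed.
Lemma tens0l (m' : M') : tens 0 m' = 0 :> tensor M M'.
Proof. by rewrite -(scale0r (0 : M)) tensZl scale0r. Qed.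
Lemma tens0r m : tens m 0 = 0 :> tensor M M'.
Proof. by rewrite -(scale0r (0 : M')) tensZr scale0r. Qed.
Lemma tensBl m1 m2 (m' : M') : tens (m1 - m2) m' = tens m1 m' - tens m2 m'.
Proof. by rewrite -scaleN1r tensDl tensZl scaleN1r. Qed.
Lemma tensBr m (m1 m2 : M') : tens m (m1 - m2) = tens m m1 - tens m m2 :> tensor M M'.
Proof. by rewrite -scaleN1r tensDr tensZr scaleN1r. Qed.
Lemma tens_suml I (r : seq I) (P : pred I) (f : I -> M) (m' : M') :
  tens (\sum_(j <- r | P j) f j) m' = \sum_(j <- r | P j) tens (f j) m'.
Proof.
by apply: (big_morph (fun m => tens m m')) => [m1 m2|]; [exact: tensDl|exact: tens0l].
Qed.
Lemma tens_sumr I (r : seq I) (P : pred I) m (f : I -> M') :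
  tens m (\sum_(j <- r | P j) f j) = \sum_(j <- r | P j) tens m (f j).
Proof.
by apply: (big_morph (fun m' : M' => tens m m')) => [m1 m2|]; [exact: tensDr|exact: tens0r].
Qed.
End TensorBilinear.

(** * Operators on the tensor product *)

Section Homogeneous.
Variables (D : root_data) (M : Udata D).
Local Notation wt := 'Hom(hh D, rat^o).
Implicit Types (t u : bool) (mu nu : wt) (m v : M).

Definition homv t mu m : Prop := [/\ Pwt mu, wtspace M mu m & gr t m = m].

Lemma homvD t mu m v : homv t mu m -> homv t mu v -> homv t mu (m + v).
Proof.
by move=> [hP hm gm] [_ hv gv]; split=> //; [exact: wtspaceD|rewrite grD gm gv].
Qed.

Lemma homvZ t mu a m : homv t mu m -> homv t mu (a *: m).
Proof. by move=> [hP hm gm]; split=> //; [exact: wtspaceZ|rewrite grZ gm]. Qed.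

Hypothesis HU : is_Umodule M.

Lemma gr_gr t u m : gr t (gr u m) = if t == u then gr u m else 0.
Proof. by have [[-> _] _ _ _ _] := HU. Qed.

Lemma gr_sum m : gr false m + gr true m = m.
Proof. by have [[_ ->] _ _ _ _] := HU. Qed.

Lemma gr_homv t mu m u : homv t mu m -> gr u m = if u == t then m else 0.
Proof. by move=> [_ _ gm]; rewrite -gm gr_gr gm. Qed.

Lemma gr_E t i m : opE M i (gr t m) = gr (t (+) par i) (opE M i m).
Proof. by have [_ [h _] _ _ _] := HU; have [-> _] := h t m i. Qed.

Lemma gr_F t i m : opF M i (gr t m) = gr (t (+) par i) (opF M i m).
Proof. by have [_ [h _] _ _ _] := HU; have [_ ->] := h t m i. Qed.

Lemma homvE t mu i m : homv t mu m -> homv (t (+) par i) (mu + alpha i) (opE M i m).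
Proof.
move=> [hP hm gm]; split; [|exact: E_wt|by rewrite -gr_E gm].
by apply: PwtD => //; exact: alpha_Pwt.
Qed.

Lemma homvF t mu i m : homv t mu m -> homv (t (+) par i) (mu - alpha i) (opF M i m).
Proof.
move=> [hP hm gm]; split; [|exact: F_wt|by rewrite -gr_F gm].
by apply: PwtB => //; exact: alpha_Pwt.
Qed.

Lemma sgn_homv u t mu m : homv t mu m -> sgn_op M u m = psign (u && t) *: m.
Proof.
move=> hm; change (gr false m + ppi ^+ u *: gr true m = psign (u && t) *: m).
rewrite !(gr_homv _ hm) psignE; case: t hm => _ /=.
  by rewrite add0r andbT.
by rewrite andbF scaler0 addr0 scale1r.
Qed.
End Homogeneous.

Lemma homv_decomp (D : root_data) (M : Udata D) (m : M) : is_weight_module M ->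
  exists s : seq M, (forall v, v \in s -> exists t mu, homv t mu v) /\
    m = \sum_(v <- s) v.
Proof.
move=> [HU [_ hs _] hg]; have [t [w [_ ht ->]]] := hs m Logic.I.
elim: t ht => [|mu t ih] ht; first by exists [::]; rewrite !big_nil.
have [|s [hs' e]] := ih; first by move=> nu nt; apply: ht; rewrite inE nt orbT.
have [hP hw] := ht mu (mem_head _ _).
exists (gr false (w mu) :: gr true (w mu) :: s); split; last first.
  by rewrite !big_cons -e addrA gr_sum.
move=> v; rewrite !inE => /or3P[/eqP ->|/eqP ->|/hs'//].
  by exists false, mu; split; rewrite ?(gr_gr HU) //; exact: hg.
by exists true, mu; split; rewrite ?(gr_gr HU) //; exact: hg.
Qed.

Section TensorModule.
Variables (D : root_data) (M M' : Udata D).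
Hypotheses (HM : is_weight_module M) (HM' : is_weight_module M').
Local Notation wt := 'Hom(hh D, rat^o).
Local Notation T := (tensU M M').
Implicit Types (t u : bool) (mu nu : wt) (m : M).

Let HU : is_Umodule M. Proof. by case: HM. Qed.
Let HU' : is_Umodule M'. Proof. by case: HM'. Qed.

(** On tensors of vectors homogeneous for weight and parity, K~_i, J~_i and the sign rule become
    scalars; statements about the tensor product are reduced to these. *)
Lemma tensor_ind (P : T -> Prop) : P 0 -> (forall x y, P x -> P y -> P (x + y)) ->
  (forall t mu m t' nu (m' : M'), homv t mu m -> homv t' nu m' -> P (tens m m')) ->
  forall x, P x.
Proof.
move=> P0 PD Pt x; have [s ->] := tensor_gen x.
elim: s => [|[m m'] s ih]; first by rewrite big_nil.
rewrite big_cons /=; apply: (PD _ _ _ ih).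
have [r [hr ->]] := homv_decomp m HM; have [r' [hr' ->]] := homv_decomp m' HM'.
rewrite tens_suml big_seq; apply: (big_ind P) => // v /(hr v)[t [mu hv]].
rewrite tens_sumr big_seq; apply: (big_ind P) => // v' /(hr' v')[t' [nu hv']].
exact: Pt hv hv'.
Qed.

Lemma stens_homv u (a : {linear M -> M}) (b : {linear M' -> M'}) t mu m (m' : M') :
  homv t mu m -> stens u a b (tens m m') = psign (u && t) *: tens (a m) (b m').
Proof.
move=> hm; rewrite /stens tmapE; change (tens (a (sgn_op M u m)) (b m') = psign (u && t) *: tens (a m) (b m')).
by rewrite (sgn_homv HU _ hm) linearZ_LR tensZl.
Qed.

Lemma tE i t mu m t' nu (m' : M') : homv t mu m -> homv t' nu m' ->
  opE T i (tens m m') = qiz i (- awt i nu) *: tens (opE M i m) m' +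
    (psign (par i && t) * piz i (awt i mu)) *: tens m (opE M' i m').
Proof.
move=> hm hm'; have [hP hw _] := hm; have [hP' hw' _] := hm'.
change (stens false (opE M i) (Ktinv M' i) (tens m m') +
  stens (par i) (Jt M i) (opE M' i) (tens m m') =
  qiz i (- awt i nu) *: tens (opE M i m) m' +
    (psign (par i && t) * piz i (awt i mu)) *: tens m (opE M' i m')).
rewrite !(stens_homv _ _ _ _ hm) (Ktinv_wt _ hP' hw') (Jt_wt _ hP hw).
by rewrite andFb psign0 scale1r tensZr tensZl scalerA.
Qed.

Lemma tF i t mu m t' nu (m' : M') : homv t mu m -> homv t' nu m' ->
  opF T i (tens m m') = tens (opF M i m) m' +
    (psign (par i && t) * qiz i (awt i mu)) *: tens m (opF M' i m').
Proof.
move=> hm hm'; have [hP hw _] := hm.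
change (stens false (opF M i) idfun (tens m m') +
  stens (par i) (Kt M i) (opF M' i) (tens m m') = tens (opF M i m) m' +
    (psign (par i && t) * qiz i (awt i mu)) *: tens m (opF M' i m')).
rewrite !(stens_homv _ _ _ _ hm) (Kt_wt _ hP hw).
by rewrite andFb psign0 scale1r tensZl scalerA.
Qed.

Lemma tK h t mu m t' nu (m' : M') : Pcowt h -> homv t mu m -> homv t' nu m' ->
  opK T h (tens m m') = qz (ipair h (mu + nu)) *: tens m m'.
Proof.
move=> hc hm hm'; have [hP /wtspaceP/(_ h hc)[e _] _] := hm.
have [hP' /wtspaceP/(_ h hc)[e' _] _] := hm'.
change (stens false (opK M h) (opK M' h) (tens m m') = qz (ipair h (mu + nu)) *: tens m m').
rewrite (stens_homv _ _ _ _ hm) andFb psign0 scale1r e e' tensZl tensZr.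
by rewrite scalerA -qzD ipairD.
Qed.

Lemma tJ h t mu m t' nu (m' : M') : Pcowt h -> homv t mu m -> homv t' nu m' ->
  opJ T h (tens m m') = pz (ipair h (mu + nu)) *: tens m m'.
Proof.
move=> hc hm hm'; have [hP /wtspaceP/(_ h hc)[_ e] _] := hm.
have [hP' /wtspaceP/(_ h hc)[_ e'] _] := hm'.
change (stens false (opJ M h) (opJ M' h) (tens m m') = pz (ipair h (mu + nu)) *: tens m m').
rewrite (stens_homv _ _ _ _ hm) andFb psign0 scale1r e e' tensZl tensZr.
by rewrite scalerA -pzD ipairD.
Qed.

Lemma tgr u t mu m t' nu (m' : M') : homv t mu m -> homv t' nu m' ->
  gr u (tens m m' : T) = if u == t (+) t' then tens m m' else 0.
Proof.
move=> hm hm'.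
change (stens false (gr u) (gr false) (tens m m') +
  stens false (gr (~~ u)) (gr true) (tens m m') =
  if u == t (+) t' then tens m m' else 0).
rewrite !(stens_homv _ _ _ _ hm) !andFb psign0 !scale1r.
rewrite !(gr_homv HU _ hm) !(gr_homv HU' _ hm').
by case: u; case: t {hm}; case: t' {hm'} => //=;
  rewrite ?tens0l ?tens0r ?add0r ?addr0 ?tens0l ?tens0r.
Qed.

Lemma thomv t mu m t' nu (m' : M') : homv t mu m -> homv t' nu m' ->
  homv (t (+) t') (mu + nu) (tens m m' : T).
Proof.
move=> hm hm'; have [hP _ _] := hm; have [hP' _ _] := hm'; split.
- exact: PwtD.
- by apply/wtspaceP => h hh; rewrite (tK hh hm hm') (tJ hh hm hm').
- by rewrite (tgr _ hm hm') eqxx.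
Qed.

Lemma thomvE i t mu m t' nu (m' : M') : homv t mu m -> homv t' nu m' ->
  homv (t (+) t' (+) par i) (mu + nu + alpha i) (opE T i (tens m m')).
Proof.
move=> hm hm'; rewrite (tE i hm hm'); apply: homvD; apply: homvZ.
  have := thomv (homvE HU i hm) hm'.
  by rewrite addrAC -!addbA [par i (+) t']addbC.
by have := thomv hm (homvE HU' i hm'); rewrite addrA addbA.
Qed.

Lemma thomvF i t mu m t' nu (m' : M') : homv t mu m -> homv t' nu m' ->
  homv (t (+) t' (+) par i) (mu + nu - alpha i) (opF T i (tens m m')).
Proof.
move=> hm hm'; rewrite (tF i hm hm'); apply: homvD; last apply: homvZ.
  have := thomv (homvF HU i hm) hm'.
  by rewrite addrAC -!addbA [par i (+) t']addbC.
by have := thomv hm (homvF HU' i hm'); rewrite addrA addbA.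
Qed.
End TensorModule.

Section ModuleAlgebra.
Variables (R : comNzRingType) (V : lmodType R).
Implicit Types (A B C X Y Z : V).

(** One step of [twisted_tensor1]. [B] is the term where X_i acts on the other tensor factor, and
    the scalar condition cancels its two occurrences. *)
Lemma twisted_step_left (P F G u g P' : R) A B C : G * P = u * g * P' ->
  P *: (F *: A + G *: B) - u *: (F *: (P *: C) + g *: (P' *: B)) =
  (P * F) *: (A - u *: C).
Proof.
move=> h; rewrite !scalerDr !scalerA opprD addrACA scalerN scalerA.
have -> : P * G = u * g * P' by rewrite mulrC.
by rewrite subrr addr0; congr (_ - _ *: _); ring.
Qed.

(** The same for [twisted_tensor2], where [A] is the term that cancels. *)
Lemma twisted_step_right (P F F' u g P' : R) A B C : P * F' = u * F * P' ->
  P *: (F' *: A + g *: B) - u *: (F *: (P' *: A) + g *: (P *: C)) =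
  (P * g) *: (B - u *: C).
Proof.
move=> h; rewrite !scalerDr !scalerA opprD addrACA scalerN scalerA.
by rewrite h subrr add0r; congr (_ - _ *: _); ring.
Qed.

(** [Y] and [Z] are the mixed terms, with E and F on different factors; the two scalar conditions
    cancel them and leave one commutator in each factor. *)
Lemma EF_tensor_expand (a b g c d e P : R) X1 X2 Y Z W1 W2 : b = P * d -> g * c = P * a * e ->
  (a *: X1 + b *: Y) + g *: (c *: Z + d *: W1) -
    P *: (a *: (X2 + e *: Z) + d *: (Y + g *: W2)) =
  a *: (X1 - P *: X2) + (g * d) *: (W1 - P *: W2).
Proof.
move=> -> h; rewrite !scalerDr !scalerA h !scalerN !scalerA.
have -> : P * d * g = g * d * P by ring.
rewrite [P * a]mulrC.
set t1 := a *: X1; set t2 := _ *: Y; set t3 := _ *: Z; set t4 := _ *: W1.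
set s := _ *: X2; set u := _ *: W2.
rewrite !opprD [t1 + t2 + _]addrACA [- s - t3 + _]addrACA [X in _ + X]addrACA.
by rewrite (addrACA (t1 + t3)) (addrACA t1) (addrACA t2) !subrr addr0 add0r.
Qed.

End ModuleAlgebra.

Section CartanScalars.
Variable D : root_data.
Implicit Types i j : rI D.

Lemma qiz_sym i j : qiz j (cartan j i) = qiz i (cartan i j).
Proof. by rewrite -!q_exp rd_sym. Qed.

Lemma qiz_symN i j : qiz j (- cartan j i) = qiz i (- cartan i j).
Proof. by rewrite -!q_exp !mulrN rd_sym. Qed.

Lemma qizX i z k : qiz i z ^+ k = qiz i (z * k%:Z).
Proof. by rewrite !qizE -exprz_exp. Qed.

Lemma psignX b k : psign b ^+ k = psign (b && odd k).
Proof.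
by case: b; rewrite ?psign0 ?expr1n //= !psignE /= expr1 [LHS]ppi_odd.
Qed.

Lemma pi_even i (z : int) : (par i -> (2 %| z)%Z) -> piz i z = 1.
Proof.
rewrite pizE /pi_; case: (par i) => [/(_ isT)/dvdzP[b ->]|_]; last by rewrite expr0 exp1rz.
by rewrite expr1 mulrC -exprz_exp -[ppi ^ 2]/(ppi ^+ 2) ppi2 exp1rz.
Qed.

(** Equivalently, J~_i commutes with every E_j and F_j. *)
Lemma piz_cartan i j : piz i (cartan i j) = 1.
Proof. by apply: pi_even => pi; exact: cartan_even. Qed.

Lemma piz_2 i (k : int) : piz i (2 * k) = 1.
Proof. by apply: pi_even => _; apply: dvdz_mulr. Qed.

Lemma pi_psign i (k : nat) : pi_ i ^+ k = psign (par i && odd k).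
Proof.
rewrite psignE /pi_; case: (par i) => /=; last by rewrite expr1n.
by rewrite expr1 [LHS]ppi_odd.
Qed.

Lemma psign_awt i t u v : psign (par i && (t (+) u (+) (par i && v))) =
  psign (par i && t) * psign (par i && u) * psign (par i && v).
Proof. by rewrite !andb_addr !psignD andbA andbb. Qed.

Lemma ppi_par i j : ppi ^+ (par i * par j) = psign (par i && par j).
Proof. by rewrite mulnb psignE. Qed.

(* The Serre relation is the composite of twisted commutators with these
   coefficients; with n = 1 - a_ij, reversing their order replaces q by its
   inverse. *)
Definition serre_coef i j (k : nat) : Qqpi :=
  psign (par i && par j) * psign (par i && odd k) * qiz i (- cartan i j - (2 * k)%:Z).

(** Here n - 1 = - a_ij, which is even for odd i, so that reversing k keeps its parity. *)
Lemma serre_coef_rev i j k : i != j -> (k < `|1 - cartan i j|)%N ->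
  serre_coef i j (`|1 - cartan i j|%N.-1 - k) =
  psign (par i && par j) * psign (par i && odd k) * qiz i (cartan i j + (2 * k)%:Z).
Proof.
move=> ij kn; have aij := cartan_offdiag ij.
rewrite /serre_coef; congr (_ * psign _ * qiz i _); last by lia.
case pi: (par i) => //=; have := cartan_even j pi => /dvdzP[b eb].
by rewrite oddB; lia.
Qed.

Lemma serre_twistedE (M : Udata D) (X : rI D -> {linear M -> M}) i j m : i != j ->
  let n := `|1 - cartan i j|%N in
  \sum_(s < n.+1) ((-1) ^+ s * pi_ i ^+ (s * par j + 'C(s, 2)) * qbin i n s) *:
      iter (n - s) (X i) (X j (iter s (X i) m)) =
  twisted_comm (serre_coef i j) (X i) n (X j) m.
Proof.
move=> ij n; have aij := cartan_offdiag ij.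
have := serre_twisted (q_local i) (Api_pi i) (pi_mul i) (pi_ i ^+ par j) (X i) (X j) n m.
rewrite (_ : \sum_(s < n.+1) _ = \sum_(s < n.+1) ((-1) ^+ s * pi_ i ^+ (s * par j + 'C(s, 2))
    * qbin i n s) *: iter (n - s) (X i) (X j (iter s (X i) m))); last first.
  apply: eq_bigr => s _; congr (_ * _ * _ *: _).
    by rewrite -exprM mulnC -exprD.
  by rewrite /qbin !qfactE.
move=> ->; apply: eq_twisted_comm => k kn; rewrite /serre_coef.
have -> : pi_ i ^+ par j = psign (par i && par j).
  by rewrite pi_psign; case: (par j).
rewrite pi_psign exprMn pi_psign.
have -> : psign (par i && odd n.-1) = 1.
  case pi: (par i) => /=; last exact: psign0.
  have := cartan_even j pi => /dvdzP[b eb].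
  by rewrite (_ : odd n.-1 = false) ?psign0 // /n; lia.
rewrite mul1r -!mulrA; congr (_ * _); rewrite mulrCA; congr (_ * _).
rewrite qizE -[q_ i ^+ n.-1]/(q_ i ^ n.-1) [q_ i ^- (2 * k)]exprnN.
by rewrite -(exprzDr (unit_q i)); congr (_ ^ _); rewrite /n; lia.
Qed.
End CartanScalars.

(** * Relations on the tensor product *)

Section SerreTensor.
Variables (D : root_data) (M M' : Udata D).
Hypotheses (HM : is_weight_module M) (HM' : is_weight_module M').
Local Notation wt := 'Hom(hh D, rat^o).
Local Notation T := (tensU M M').
Variables (X : rI D -> {linear M -> M}) (X' : rI D -> {linear M' -> M'}).
Variables (XT : rI D -> {linear T -> T}) (d : int).
Hypothesis homX : forall t mu i m, homv t mu m ->
  homv (t (+) par i) (mu + alpha i *~ d) (X i m).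
Hypothesis homX' : forall t mu i m, homv t mu m ->
  homv (t (+) par i) (mu + alpha i *~ d) (X' i m).
(** E and F are treated at once, with [d] equal to 1 or -1. [f] and [g] are the scalars with which
    the coproduct lets X_i act on the first and on the second factor. *)
Variables (f : rI D -> wt -> Qqpi) (g : rI D -> bool -> wt -> Qqpi).
Hypothesis rule : forall i t mu m t' nu m', homv t mu m -> homv t' nu m' ->
  XT i (tens m m') = f i nu *: tens (X i m) m' + g i t mu *: tens m (X' i m').
Variables (i j : rI D) (Y1 Y2 : {linear T -> T}).
Hypothesis XTj : forall x, XT j x = Y1 x + Y2 x.
Hypothesis Y1E : forall t mu m t' nu m', homv t mu m -> homv t' nu m' ->
  Y1 (tens m m') = f j nu *: tens (X j m) m'.
Hypothesis Y2E : forall t mu m t' nu m', homv t mu m -> homv t' nu m' ->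
  Y2 (tens m m') = g j t mu *: tens m (X' j m').
Variables (n : nat) (u v : nat -> Qqpi).
Hypothesis u0 : forall m, twisted_comm u (X i) n (X j) m = 0.
Hypothesis v0 : forall m, twisted_comm v (X' i) n (X' j) m = 0.
Hypothesis uv : forall x, twisted_comm u (XT i) n Y2 x = twisted_comm v (XT i) n Y2 x.

(** The scalars picked up when X_j and k copies of X_i all act on the first factor, respectively on
    the second; [tk] and [mk] give the parity and the weight reached by that factor. [cond1] and
    [cond2] below say that the mixed terms cancel at each step. *)
Let Phi k nu : Qqpi := f j nu * f i nu ^+ k.
Let Psi k t mu : Qqpi := g j t mu * g i t mu ^+ k.
Let tk (t : bool) k := t (+) par j (+) (par i && odd k).
Let mk (mu : wt) k := mu + alpha j *~ d + alpha i *+ k *~ d.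

Hypothesis cond1 : forall k t mu nu, (k < n)%N -> Pwt mu -> Pwt nu ->
  g i (tk t k) (mk mu k) * Phi k nu = u k * g i t mu * Phi k (nu + alpha i *~ d).
Hypothesis cond2 : forall k t mu nu, (k < n)%N -> Pwt mu -> Pwt nu ->
  Psi k t mu * f i (mk nu k) = v k * f i nu * Psi k (t (+) par i) (mu + alpha i *~ d).

Let tkS t k : tk t k (+) par i = tk t k.+1.
Proof. by rewrite /tk /=; case: t; case: (par i); case: (par j); case: (odd k). Qed.

Let tkS' t k : tk (t (+) par i) k = tk t k.+1.
Proof. by rewrite /tk /=; case: t; case: (par i); case: (par j); case: (odd k). Qed.

Let mkS mu k : mk mu k + alpha i *~ d = mk mu k.+1.
Proof. by rewrite /mk mulrS mulrzDl addrAC -!addrA [alpha j *~ d + _]addrCA; rewrite !addrA addrAC. Qed.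

Let mkS' mu k : mk (mu + alpha i *~ d) k = mk mu k.+1.
Proof. by rewrite -mkS /mk -!addrA; congr (_ + _); rewrite addrCA; congr (_ + _); rewrite addrC. Qed.

Lemma twisted_homv (N : Udata D) (Z : rI D -> {linear N -> N}) c k t mu m :
  (forall t mu l m, homv t mu m -> homv (t (+) par l) (mu + alpha l *~ d) (Z l m)) ->
  homv t mu m -> homv (tk t k) (mk mu k) (twisted_comm c (Z i) k (Z j) m).
Proof.
move=> hZ; elim: k t mu m => [|k ih] t mu m hm /=.
  by have := hZ _ _ j _ hm; rewrite /tk /mk /= andbF addbF mul0rz addr0.
apply: homvD.
  by have := hZ _ _ i _ (ih _ _ _ hm); rewrite tkS mkS.
rewrite -scaleN1r; do 2!apply: homvZ.
by have := ih _ _ _ (hZ _ _ i _ hm); rewrite tkS' mkS'.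
Qed.

Lemma twisted_tensor1 k t mu m t' nu m' : (k <= n)%N -> homv t mu m -> homv t' nu m' ->
  twisted_comm u (XT i) k Y1 (tens m m') =
  Phi k nu *: tens (twisted_comm u (X i) k (X j) m) m'.
Proof.
elim: k t mu m t' nu m' => [|k ih] t mu m t' nu m' kn hm hm' /=.
  by rewrite (Y1E hm hm') /Phi mulr1.
have [hP _ _] := hm; have [hP' _ _] := hm'.
have [ZD ZZ] := twisted_comm_lin u (XT i) Y1 k.
rewrite (ih _ _ _ _ _ _ (ltnW kn) hm hm') linearZ_LR.
rewrite (rule i (twisted_homv u k homX hm) hm') (rule i hm hm') ZD !ZZ.
rewrite (ih _ _ _ _ _ _ (ltnW kn) (homX i hm) hm').
rewrite (ih _ _ _ _ _ _ (ltnW kn) hm (homX' i hm')).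
rewrite (twisted_step_left _ _ _ _ (cond1 t kn hP hP')) tensBl tensZl.
by congr (_ *: _); rewrite /Phi exprSr mulrA.
Qed.

Lemma twisted_tensor2 k t mu m t' nu m' : (k <= n)%N -> homv t mu m -> homv t' nu m' ->
  twisted_comm v (XT i) k Y2 (tens m m') =
  Psi k t mu *: tens m (twisted_comm v (X' i) k (X' j) m').
Proof.
elim: k t mu m t' nu m' => [|k ih] t mu m t' nu m' kn hm hm' /=.
  by rewrite (Y2E hm hm') /Psi mulr1.
have [hP _ _] := hm; have [hP' _ _] := hm'.
have [ZD ZZ] := twisted_comm_lin v (XT i) Y2 k.
rewrite (ih _ _ _ _ _ _ (ltnW kn) hm hm') linearZ_LR.
rewrite (rule i hm (twisted_homv v k homX' hm')) (rule i hm hm') ZD !ZZ.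
rewrite (ih _ _ _ _ _ _ (ltnW kn) (homX i hm) hm').
rewrite (ih _ _ _ _ _ _ (ltnW kn) hm (homX' i hm')).
rewrite (twisted_step_right _ _ _ _ (cond2 t kn hP hP')) tensBr tensZr.
by congr (_ *: _); rewrite /Psi exprSr mulrA.
Qed.

Lemma twisted_tensor x : twisted_comm u (XT i) n (XT j) x = 0.
Proof.
rewrite (twisted_commD _ _ _ _ XTj) uv.
have [D1 Z1] := twisted_comm_lin u (XT i) Y1 n.
have [D2 Z2] := twisted_comm_lin v (XT i) Y2 n.
move: x; apply: (tensor_ind HM HM').
- have e (g0 : T -> T) : (forall a y, g0 (a *: y) = a *: g0 y) -> g0 0 = 0.
    by move=> h; have := h 0 0; rewrite !scale0r.
  by rewrite (e _ Z1) (e _ Z2) addr0.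
- by move=> x y hx hy; rewrite D1 D2 addrACA hx hy addr0.
move=> t mu m t' nu m' hm hm'.
rewrite (twisted_tensor1 (leqnn n) hm hm') (twisted_tensor2 (leqnn n) hm hm').
by rewrite u0 v0 tens0l tens0r !scaler0 addr0.
Qed.
End SerreTensor.

Section ScalarIdentities.
Variable R : comNzRingType.
Implicit Types a b c s x y w : R.

(** This and the next two identities verify [cond1] for E and [cond2] for F and E. Signs and powers
    of q_i are replaced by variables, so that only their multiplicative relations matter. *)
Lemma serreE_scalar_left a b c x y z w (X X1 : R) k : X * X1 * w ^+ k = 1 ->
  a * b * c * x * (y * z ^+ k) = b * c * X * (a * x) * (y * X1 * (z * w) ^+ k).
Proof.
move=> h; rewrite exprMn -[LHS]mul1r -h; ring.
Qed.

Lemma serreF_scalar a b ab c s x y w (X1 X1' X2 : R) k :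
  ab * ab = 1 -> c = s ^+ k -> c * c = 1 -> X1 * X1' = 1 -> X2 * w ^+ k = 1 ->
  a * x * (b * y) ^+ k = ab * c * (X1 * X2) * (a * ab * (x * X1') * (b * s * (y * w)) ^+ k).
Proof.
move=> h1 h2 h3 h4 h5; rewrite !exprMn -h2.
transitivity ((ab * ab) * (c * c) * (X1 * X1') * (X2 * w ^+ k) *
   (a * x * (b ^+ k * y ^+ k))); last by ring.
by rewrite h1 h3 h4 h5 !mul1r.
Qed.

Lemma serreE_scalar_right a b ab c s x y z W k : ab * ab = 1 -> c = s ^+ k -> c * c = 1 ->
  a * x * (b * y) ^+ k * (z * W) = ab * c * W * z * (a * ab * x * (b * s * y) ^+ k).
Proof.
move=> h1 h2 h3; rewrite !exprMn -h2.
transitivity ((ab * ab) * (c * c) * (a * x * (b ^+ k * y ^+ k) * (z * W))); last by ring.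
by rewrite h1 h3 !mul1r.
Qed.
End ScalarIdentities.

Section TensorRelations.
Variables (D : root_data) (M M' : Udata D).
Hypotheses (HM : is_weight_module M) (HM' : is_weight_module M').
Local Notation wt := 'Hom(hh D, rat^o).
Local Notation T := (tensU M M').

Let HU : is_Umodule M. Proof. by case: HM. Qed.
Let HU' : is_Umodule M'. Proof. by case: HM'. Qed.

Let awt_mk i j (mu : wt) (k : nat) (d : int) : Pwt mu ->
  awt i (mu + alpha j *~ d + alpha i *+ k *~ d) =
  awt i mu + (cartan i j + (2 * k)%:Z) * d.
Proof.
move=> hP; have Pa := alpha_Pwt i; have Pb := alpha_Pwt j.
have Pk : Pwt (alpha i *+ k) by exact: (PwtMz k Pa).
rewrite awtD; [|apply: PwtD => //; exact: PwtMz|exact: PwtMz].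
rewrite awtD //; last exact: PwtMz.
rewrite !awtMz // awt_alpha -[alpha i *+ k]/(alpha i *~ k) awtMz // awt_alpha.
by rewrite cartan_diag -addrA -mulrDl.
Qed.

Lemma serre_F_tensor : serre (@opF _ T).
Proof.
move=> i j x ij; change (\sum_(s < (`|1 - cartan i j|%N).+1)
  ((-1) ^+ s * pi_ i ^+ (s * par j + 'C(s, 2)) * qbin i `|1 - cartan i j|%N s) *:
   iter (`|1 - cartan i j|%N - s) (opF T i) (opF T j (iter s (opF T i) x)) = 0).
rewrite (serre_twistedE (@opF _ T) x ij).
set n := `|1 - cartan i j|%N.
have tw (N : Udata D) : is_Umodule N -> forall m, twisted_comm (serre_coef i j) (opF N i) n (opF N j) m = 0.
  move=> hN m; rewrite -(serre_twistedE (@opF _ N) m ij).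
  by have [_ _ _ _ [_ hs _]] := hN; exact: hs.
pose v k := serre_coef i j (n.-1 - k)%N.
apply: (@twisted_tensor D M M' HM HM' (@opF _ M) (@opF _ M') (@opF _ T) (-1) _ _
  (fun _ _ => 1) (fun l t mu => psign (par l && t) * qiz l (awt l mu)) _ i j
  (stens false (opF M j) idfun) (stens (par j) (Kt M j) (opF M' j)) _ _ _ n _ v).
- by move=> t mu l m hm; rewrite mulrNz mulr1z; exact: homvF.
- by move=> t mu l m hm; rewrite mulrNz mulr1z; exact: homvF.
- by move=> l t mu m t' nu m' hm hm'; rewrite (tF HM l hm hm') scale1r.
- by [].
- move=> t mu m t' nu m' hm hm'; rewrite (stens_homv HM _ _ _ _ hm).
  by rewrite andFb psign0.
- move=> t mu m t' nu m' hm hm'; rewrite (stens_homv HM _ _ _ _ hm).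
  by have [hP hw _] := hm; rewrite (Kt_wt _ hP hw) tensZl scalerA.
- exact: tw.
- by move=> m; rewrite /v twisted_comm_rev; exact: tw.
- by move=> y; rewrite /v twisted_comm_rev.
- move=> k t mu nu kn hP hP'; rewrite expr1n mulr1 !mulr1 psign_awt awt_mk //.
  rewrite /serre_coef qizD; have -> : - cartan i j - (2 * k)%:Z = (cartan i j + (2 * k)%:Z) * -1 by lia.
  move: (psign _) (psign _) (psign _) (qiz _ _) (qiz _ _) => a b c x1 x2; ring.
- move=> k t mu nu kn hP hP'; have Pa := alpha_Pwt i.
  rewrite !mulr1 awtD ?awtMz //; last exact: PwtMz.
  rewrite awtD ?awtMz //; last exact: PwtMz.
  rewrite !awt_alpha cartan_diag /v serre_coef_rev //.
  rewrite !andb_addr !psignD andbb [par j && par i]andbC !qizD mulrN1 qiz_symN.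
  apply: serreF_scalar; rewrite ?psignK ?psignX ?qizX -?qizD ?subrr ?qiz0 //.
  by rewrite (_ : _ + _ = 0) ?qiz0 //; lia.
Qed.

(** The two orders exchange their roles compared with F: Delta(E_i) carries the power of q_i on the
    second factor, Delta(F_i) on the first. *)
Lemma serre_E_tensor : serre (@opE _ T).
Proof.
move=> i j x ij; change (\sum_(s < (`|1 - cartan i j|%N).+1)
  ((-1) ^+ s * pi_ i ^+ (s * par j + 'C(s, 2)) * qbin i `|1 - cartan i j|%N s) *:
   iter (`|1 - cartan i j|%N - s) (opE T i) (opE T j (iter s (opE T i) x)) = 0).
rewrite (serre_twistedE (@opE _ T) x ij).
set n := `|1 - cartan i j|%N.
have tw (N : Udata D) : is_Umodule N -> forall m, twisted_comm (serre_coef i j) (opE N i) n (opE N j) m = 0.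
  move=> hN m; rewrite -(serre_twistedE (@opE _ N) m ij).
  by have [_ _ _ _ [hs _ _]] := hN; exact: hs.
pose v k := serre_coef i j (n.-1 - k)%N.
rewrite -twisted_comm_rev.
apply: (@twisted_tensor D M M' HM HM' (@opE _ M) (@opE _ M') (@opE _ T) 1 _ _
  (fun l nu => qiz l (- awt l nu)) (fun l t mu => psign (par l && t) * piz l (awt l mu)) _ i j
  (stens false (opE M j) (Ktinv M' j)) (stens (par j) (Jt M j) (opE M' j)) _ _ _ n v
  (serre_coef i j)).
- by move=> t mu l m hm; rewrite mulr1z; exact: homvE.
- by move=> t mu l m hm; rewrite mulr1z; exact: homvE.
- by move=> l t mu m t' nu m' hm hm'; rewrite (tE HM l hm hm').
- by [].
- move=> t mu m t' nu m' hm hm'; rewrite (stens_homv HM _ _ _ _ hm).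
  by have [hP hw _] := hm'; rewrite (Ktinv_wt _ hP hw) tensZr andFb psign0 scale1r.
- move=> t mu m t' nu m' hm hm'; rewrite (stens_homv HM _ _ _ _ hm).
  by have [hP hw _] := hm; rewrite (Jt_wt _ hP hw) tensZl scalerA.
- by move=> m; rewrite /v twisted_comm_rev; exact: tw.
- exact: tw.
- by move=> y; rewrite /v twisted_comm_rev.
- move=> k t mu nu kn hP hP'; have Pa := alpha_Pwt i.
  rewrite psign_awt awt_mk // mulr1 !pizD piz_cartan PoszM piz_2 !mulr1.
  rewrite !awtD ?awtMz ?mulr1 //; do ?exact: PwtMz.
  rewrite !awt_alpha cartan_diag /v serre_coef_rev // !opprD !qizD qiz_symN.
  apply: serreE_scalar_left; rewrite -?qizD ?qizX -?qizD.
  by rewrite (_ : _ + _ = 0) ?qiz0 //; lia.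
- move=> k t mu nu kn hP hP'; have Pa := alpha_Pwt i.
  rewrite awt_mk // !awtD ?awtMz ?mulr1 //; do ?exact: PwtMz.
  rewrite !awt_alpha cartan_diag /serre_coef.
  rewrite !andb_addr !psignD andbb [par j && par i]andbC !pizD piz_cartan.
  rewrite -(pizD i 1 1) (piz_2 i 1) !mulr1 opprD qizD.
  rewrite (_ : - (cartan i j + _) = - cartan i j - (2 * k)%:Z); last by lia.
  by apply: serreE_scalar_right; rewrite ?psignK ?psignX.
Qed.

Lemma tensU_ext (f g : T -> T) : (forall x y, f (x + y) = f x + f y) ->
  (forall x y, g (x + y) = g x + g y) ->
  (forall t mu m t' nu m', homv t mu m -> homv t' nu m' ->
     f (tens m m') = g (tens m m')) -> forall x, f x = g x.
Proof.
move=> fD gD fg; have h0 (h : T -> T) : (forall x y, h (x + y) = h x + h y) -> h 0 = 0.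
  by move=> hD; apply: (addrI (h 0)); rewrite -hD !addr0.
apply: (tensor_ind HM HM'); first by rewrite !h0.
  by move=> x y hx hy; rewrite fD gD hx hy.
by move=> t mu m t' nu m'; exact: fg.
Qed.

Lemma EF_tensor i j x :
  opE T i (opF T j x) - ppi ^+ (par i * par j) *: opF T j (opE T i x) =
  if i == j then (pi_ i * q_ i - (q_ i)^-1)^-1 *: (Jt T i (Kt T i x) - Ktinv T i x)
  else 0.
Proof.
move: x; apply: tensU_ext => [x y|x y|t mu m t' nu m' hm hm'].
- by rewrite opFD !opED opFD scalerDr opprD addrACA.
- case: eqP => _; last by rewrite addr0.
  by rewrite /Kt /Ktinv !opKD /Jt opJD -scalerDr opprD addrACA.
have [hP hw _] := hm; have [hP' hw' _] := hm'.
rewrite ppi_par (tF HM j hm hm') (tE HM i hm hm') opED opFD !opEZ !opFZ.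
rewrite (tE HM i (homvF HU j hm) hm') (tE HM i hm (homvF HU' j hm')).
rewrite (tF HM j (homvE HU i hm) hm') (tF HM j hm (homvE HU' i hm')).
have Pj := alpha_Pwt j; have Pi := alpha_Pwt i.
rewrite !awtD ?awtN //; try exact: PwtN.
rewrite !awt_alpha.
rewrite EF_tensor_expand; first last.
- rewrite opprB [in RHS]qizD -qiz_sym [cartan i j - _]addrC qizD.
  rewrite !andb_addr !psignD [par j && par i]andbC.
  rewrite -[LHS]mul1r -(psignK (par i && par j)).
  move: (psign (par i && par j)) (psign _) (qiz _ _) (qiz _ _) (qiz _ _) => a b c d e.
  ring.
- rewrite !andb_addr !psignD -[in RHS](subrK (cartan i j) (awt i mu)) [in RHS]pizD.
  by rewrite piz_cartan mulr1 -mulrA mulrCA.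
rewrite -(tensZl (psign (par i && par j))) -(tensZr (psign (par i && par j))) -tensBl -tensBr.
case: eqP => [<-|ij]; last first.
  have e (N : Udata D) (w : N) : is_Umodule N ->
      opE N i (opF N j w) - psign (par i && par j) *: opF N j (opE N i w) = 0.
    move=> [_ _ _ _ [_ _ /(_ i j w)]]; rewrite ppi_par => ->.
    by case: eqP ij.
  by rewrite !e // tens0l tens0r !scaler0 addr0.
have [hPT hwT _] := thomv HM HM' hm hm'.
rewrite (Kt_wt i hPT hwT) JtZ (Jt_wt i hPT hwT) (Ktinv_wt i hPT hwT).
rewrite scalerA -scalerBl scalerA andbb psignE -/(pi_ i).
rewrite (EF_wt HU i hP hw) (EF_wt HU' i hP' hw') tensZl tensZr !scalerA -scalerDl.
(* What remains is [x] q_i^(-y) + (pi_i q_i)^x [y] = [x + y] for the weights x and y of the two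
   factors; the two parity signs multiply to 1. *)
congr (_ *: _); rewrite !qnum_awt awtD // opprD pizD !qizD.
set k := (_ - _)^-1.
move: (psignK (par i && t)).
move: (psign _) (piz i (awt i mu)) (qiz i (awt i mu)) (qiz i (- awt i mu)) => a b c d aa.
move: (piz i (awt i nu)) (qiz i (awt i nu)) (qiz i (- awt i nu)) => e f g.
rewrite (_ : a * c * (a * b) = b * c); last by rewrite mulrACA aa mul1r mulrC.
ring.
Qed.

Lemma tensU_graded : is_graded T.
Proof.
split=> [t u|] x; move: x.
  case: eqP => [<-|tu]; apply: tensU_ext => //; try by move=> x y; rewrite !grD.
  + move=> t1 mu m t2 nu m' hm hm'; rewrite (tgr HM HM' t hm hm').
    by case: eqP => e; rewrite ?gr0 // (tgr HM HM' t hm hm') e eqxx.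
  + by move=> x y; rewrite addr0.
  + move=> t1 mu m t2 nu m' hm hm'; rewrite (tgr HM HM' u hm hm').
    case: (u =P _) => e; rewrite ?gr0 // (tgr HM HM' t hm hm').
    by case: eqP => // e'; case: tu; rewrite e e'.
apply: (@tensU_ext (fun x => gr false x + gr true x) id) => //.
  by move=> x y; rewrite !grD addrACA.
move=> t1 mu m t2 nu m' hm hm'; rewrite !(tgr HM HM' _ hm hm').
by case: (t1 (+) t2); rewrite ?addr0 ?add0r.
Qed.

End TensorRelations.

Section TensorUmodule.
Variables (D : root_data) (M M' : Udata D).
Hypotheses (HM : is_weight_module M) (HM' : is_weight_module M').
Local Notation wt := 'Hom(hh D, rat^o).
Local Notation T := (tensU M M').

Let HU : is_Umodule M. Proof. by case: HM. Qed.
Let HU' : is_Umodule M'. Proof. by case: HM'. Qed.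

Let gr_homv_T t mu (x : T) u : homv t mu x -> gr u x = if u == t then x else 0.
Proof. by move=> [_ _ gx]; have [h _] := tensU_graded HM HM'; rewrite -gx h gx. Qed.

Lemma gr_E_tensor t i x : opE T i (gr t x) = gr (t (+) par i) (opE T i x).
Proof.
move: x; apply: (@tensU_ext _ _ _ HM HM' (fun x => opE T i (gr t x))
  (fun x => gr (t (+) par i) (opE T i x))).
- by move=> x y; rewrite grD opED.
- by move=> x y; rewrite opED grD.
move=> t1 mu m t2 nu m' hm hm'; rewrite (tgr HM HM' _ hm hm').
rewrite (gr_homv_T _ (thomvE HM HM' i hm hm')).
by rewrite (inj_eq (can_inj (addbK _))); case: eqP => // _; rewrite opE0.
Qed.

Lemma gr_F_tensor t i x : opF T i (gr t x) = gr (t (+) par i) (opF T i x).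
Proof.
move: x; apply: (@tensU_ext _ _ _ HM HM' (fun x => opF T i (gr t x))
  (fun x => gr (t (+) par i) (opF T i x))).
- by move=> x y; rewrite grD opFD.
- by move=> x y; rewrite opFD grD.
move=> t1 mu m t2 nu m' hm hm'; rewrite (tgr HM HM' _ hm hm').
rewrite (gr_homv_T _ (thomvF HM HM' i hm hm')).
by rewrite (inj_eq (can_inj (addbK _))); case: eqP => // _; rewrite opF0.
Qed.

Lemma tensU_lext (f g : {linear T -> T}) :
  (forall mu nu m m', Pwt (mu + nu) -> wtspace T (mu + nu) (tens m m') ->
     (forall i, wtspace T (mu + nu + alpha i) (opE T i (tens m m'))) ->
     (forall i, wtspace T (mu + nu - alpha i) (opF T i (tens m m'))) ->
     f (tens m m') = g (tens m m')) -> f =1 g.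
Proof.
move=> h; apply: (tensU_ext HM HM') => [x y|x y|t mu m t' nu m' hm hm'].
- exact: raddfD.
- exact: raddfD.
have [hP hw _] := thomv HM HM' hm hm'.
apply: (h mu nu) => // i; first by case: (thomvE HM HM' i hm hm').
by case: (thomvF HM HM' i hm hm').
Qed.

Let pz_sq z : pz z * pz z = 1.
Proof.
rewrite -pzD -mulr2n -mulr_natl natz pzE -exprz_exp.
by rewrite -[ppi ^ 2]/(ppi ^+ 2) ppi2 exp1rz.
Qed.

Lemma KJ_tensor h k (x : T) : Pcowt h -> Pcowt k ->
  [/\ opK T 0 x = x, opK T (h + k) x = opK T h (opK T k x),
      opJ T (h *+ 2) x = x, opJ T (h + k) x = opJ T h (opJ T k x)
    & opJ T h (opK T k x) = opK T k (opJ T h x)].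
Proof.
move=> hh hk; have hhk := PcowtD hh hk; have h2 := PcowtMn 2 hh.
have e l n mu : Pcowt l -> Pcowt n -> Pwt mu -> ipair (l + n) mu = ipair l mu + ipair n mu.
  by move=> hl hn hP; apply: ipair_eq; rewrite raddfD rmorphD /= !ipairE.
split; move: x.
- apply: (@tensU_lext (opK T 0) idfun) => mu nu m m' hP /wtspaceP hw _ _.
  change (opK T 0 (tens m m') = tens m m').
  have [-> _] := hw _ (@Pcowt0 D).
  by rewrite (ipair_eq (z := 0)) ?qz0 ?scale1r // linear0.
- apply: (@tensU_lext (opK T (h + k)) (opK T h \o opK T k)) => mu nu m m' hP /wtspaceP hw _ _.
  change (opK T (h + k) (tens m m') = opK T h (opK T k (tens m m'))).
  have [-> _] := hw _ hhk; have [-> _] := hw _ hk; have [ek _] := hw _ hh.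
  by rewrite opKZ ek e // qzD scalerA mulrC.
- apply: (@tensU_lext (opJ T (h *+ 2)) idfun) => mu nu m m' hP /wtspaceP hw _ _.
  change (opJ T (h *+ 2) (tens m m') = tens m m').
  have [_ ->] := hw _ h2.
  by rewrite mulr2n e // pzD pz_sq scale1r.
- apply: (@tensU_lext (opJ T (h + k)) (opJ T h \o opJ T k)) => mu nu m m' hP /wtspaceP hw _ _.
  change (opJ T (h + k) (tens m m') = opJ T h (opJ T k (tens m m'))).
  have [_ ->] := hw _ hhk; have [_ ->] := hw _ hk; have [_ ek] := hw _ hh.
  by rewrite opJZ ek e // pzD scalerA mulrC.
apply: (@tensU_lext (opJ T h \o opK T k) (opK T k \o opJ T h)) => mu nu m m' hP /wtspaceP hw _ _.
  change (opJ T h (opK T k (tens m m')) = opK T k (opJ T h (tens m m'))).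
have [e1 e2] := hw _ hk; have [e3 e4] := hw _ hh.
by rewrite e1 opJZ e4 opKZ e1 scalerAC.
Qed.

Lemma KE_tensor h i (x : T) : Pcowt h ->
  [/\ opK T h (opE T i x) = qq ^ ipair h (alpha i) *: opE T i (opK T h x),
      opJ T h (opE T i x) = ppi ^ ipair h (alpha i) *: opE T i (opJ T h x),
      opK T h (opF T i x) = qq ^ (- ipair h (alpha i)) *: opF T i (opK T h x)
    & opJ T h (opF T i x) = ppi ^ (- ipair h (alpha i)) *: opF T i (opJ T h x)].
Proof.
move=> hh; rewrite -!qzE -!pzE; have Pa := alpha_Pwt i; split; move: x.
- apply: (@tensU_lext (opK T h \o opE T i) (qz (ipair h (alpha i)) \*: (opE T i \o opK T h)))
    => mu nu m m' hP /wtspaceP hw /(_ i)/wtspaceP hE _.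
  change (opK T h (opE T i (tens m m')) = qz (ipair h (alpha i)) *: opE T i (opK T h (tens m m'))).
  have [-> _] := hE _ hh; have [-> _] := hw _ hh.
  by rewrite opEZ ipairD // qzD scalerA mulrC.
- apply: (@tensU_lext (opJ T h \o opE T i) (pz (ipair h (alpha i)) \*: (opE T i \o opJ T h)))
    => mu nu m m' hP /wtspaceP hw /(_ i)/wtspaceP hE _.
  change (opJ T h (opE T i (tens m m')) = pz (ipair h (alpha i)) *: opE T i (opJ T h (tens m m'))).
  have [_ ->] := hE _ hh; have [_ ->] := hw _ hh.
  by rewrite opEZ ipairD // pzD scalerA mulrC.
- apply: (@tensU_lext (opK T h \o opF T i) (qz (- ipair h (alpha i)) \*: (opF T i \o opK T h)))
    => mu nu m m' hP /wtspaceP hw _ /(_ i)/wtspaceP hF.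
  change (opK T h (opF T i (tens m m')) = qz (- ipair h (alpha i)) *: opF T i (opK T h (tens m m'))).
  have [-> _] := hF _ hh; have [-> _] := hw _ hh.
  by rewrite opFZ ipairD ?ipairN //; [rewrite qzD scalerA mulrC|exact: PwtN].
- apply: (@tensU_lext (opJ T h \o opF T i) (pz (- ipair h (alpha i)) \*: (opF T i \o opJ T h)))
    => mu nu m m' hP /wtspaceP hw _ /(_ i)/wtspaceP hF.
  change (opJ T h (opF T i (tens m m')) = pz (- ipair h (alpha i)) *: opF T i (opJ T h (tens m m'))).
  have [_ ->] := hF _ hh; have [_ ->] := hw _ hh.
  by rewrite opFZ ipairD ?ipairN //; [rewrite pzD scalerA mulrC|exact: PwtN].
Qed.

Lemma grK_tensor t h (x : T) : Pcowt h ->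
  opK T h (gr t x) = gr t (opK T h x) /\ opJ T h (gr t x) = gr t (opJ T h x).
Proof.
move=> hh; split; move: x.
  apply: (@tensU_ext _ _ _ HM HM' (fun x => opK T h (gr t x)) (fun x => gr t (opK T h x))).
  - by move=> x y; rewrite grD opKD.
  - by move=> x y; rewrite opKD grD.
  move=> t1 mu m t2 nu m' hm hm'; rewrite (tK HM hh hm hm') grZ (tgr HM HM' _ hm hm').
  by case: eqP => _; rewrite ?opK0 ?scaler0 // (tK HM hh hm hm').
apply: (@tensU_ext _ _ _ HM HM' (fun x => opJ T h (gr t x)) (fun x => gr t (opJ T h x))).
- by move=> x y; rewrite grD opJD.
- by move=> x y; rewrite opJD grD.
move=> t1 mu m t2 nu m' hm hm'; rewrite (tJ HM hh hm hm') grZ (tgr HM HM' _ hm hm').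
by case: eqP => _; rewrite ?opJ0 ?scaler0 // (tJ HM hh hm hm').
Qed.

Lemma tensU_Umodule : is_Umodule T.
Proof.
split.
- exact: tensU_graded.
- split=> [t x i|t x h]; last exact: grK_tensor.
  by split; [exact: gr_E_tensor|exact: gr_F_tensor].
- by move=> h k x; exact: KJ_tensor.
- by move=> h i x; exact: KE_tensor.
by split; [exact: serre_E_tensor|exact: serre_F_tensor|exact: EF_tensor].
Qed.
End TensorUmodule.

(** * Separation of weights by P^vee *)

Section WeightSeparation.
Variable D : root_data.
Local Notation wt := 'Hom(hh D, rat^o).
Implicit Types (mu nu : wt).

(* A multiple of any vector separating mu and nu lies in the dual lattice. *)
Lemma Pcowt_separates mu nu : Pwt mu -> Pwt nu -> mu <> nu ->
  exists2 h, Pcowt h & ipair h mu != ipair h nu.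
Proof.
move=> hm hn mn; have [b [_ hb]] := Pwt_lattice D.
have [h0 hh0] : exists h, mu h <> nu h.
  by apply: contrapT => /forallNP e; apply: mn; apply/lfunP => h; apply: contrapT; exact: e.
pose N := \prod_(k < size b) denq (b`_k h0).
have N0 : (N%:~R : rat) != 0.
  by rewrite intr_eq0; apply/prodf_neq0 => k _; exact: denq_neq0.
have hh : Pcowt (N%:~R *: h0).
  move=> la /hb[z ->]; rewrite sum_lfunE rpred_sum // => k _.
  rewrite -scaler_int lfunE /= linearZ /=.
  change ((z k)%:~R * (N%:~R * b`_k h0) \is a Num.int).
  rewrite rpredM ?rpred_int // /N (bigD1 k) //= rmorphM /= mulrAC.
  by rewrite [_%:~R * b`_k h0]mulrC -numqE rpredM ?rpred_int.
exists (N%:~R *: h0) => //; apply/eqP => /(congr1 (fun x : int => x%:~R : rat)).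
rewrite !ipairE // !linearZ /= => /(mulfI N0); exact: hh0.
Qed.

(** Since Q(q)^pi has zero divisors, a nonzero difference would not be enough; it is a unit because
    1 - q^(n+1) is one. *)
Lemma unit_qz_sub (a b : int) : a != b -> qz a - qz b \is a GRing.unit.
Proof.
have key (n : nat) : 1 - qz n.+1 \is a GRing.unit.
  have [+ _] := localV qq_local (Api_X n); rewrite -exprS qzE; exact.
have uq c : qz c \is a GRing.unit by rewrite qzE; exact: unitrXz unit_qq.
wlog ab : a b / (b <= a)%R => [th|] nab.
  case: (leP b a) => ab; first exact: th.
  have -> : qz a - qz b = - (qz b - qz a) by move: (qz a) (qz b) => x y; ring.
  by rewrite unitrN; apply: th; rewrite ?ltW // eq_sym.
have [n e] : exists n : nat, a = b + n.+1%:Z.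
  by exists `|a - b|%N.-1; lia.
rewrite e qzD; have -> : qz b * qz n.+1 - qz b = - (qz b * (1 - qz n.+1)).
  by move: (qz b) (qz _) => x y; ring.
by rewrite unitrN unitrM uq; exact: key.
Qed.
End WeightSeparation.

Lemma big_uniq_sub (V : zmodType) (T : eqType) (s s' : seq T) (F : T -> V) :
  uniq s -> uniq s' -> {subset s <= s'} ->
  (forall j, j \notin s -> F j = 0) -> \sum_(j <- s) F j = \sum_(j <- s') F j.
Proof.
move=> us us' ss F0; rewrite [RHS](bigID (mem s)) /=.
rewrite [X in _ = _ + X]big1 ?addr0 => [|j]; last exact: F0.
rewrite -[RHS]big_filter; apply: perm_big; apply: uniq_perm => //; first by rewrite filter_uniq.
by move=> j; rewrite mem_filter andb_idr //; exact: ss.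
Qed.

Section Decomposition.
Variables (V : zmodType) (T : choiceType) (J : set T) (W : T -> set V).

Definition decomposable x := exists (t : seq T) (w : T -> V),
  [/\ uniq t, forall j, j \in t -> J j /\ W j (w j) & x = \sum_(j <- t) w j].

Hypothesis W0 : forall j, W j 0.
Hypothesis WD : forall j x y, W j x -> W j y -> W j (x + y).

Lemma decomp_add x y : decomposable x -> decomposable y -> decomposable (x + y).
Proof.
move=> [t [w [ut ht ->]]] [t' [w' [ut' ht' ->]]].
exists (undup (t ++ t')).
exists (fun j => (if j \in t then w j else 0) + (if j \in t' then w' j else 0)).
split; first exact: undup_uniq.
  move=> j; rewrite mem_undup mem_cat => jt; split.
    by case/orP: jt => [/ht|/ht'] [].
  apply: WD; first by case: ifP => [/ht[]|_].
  by case: ifP => [/ht'[]|_].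
have E (s : seq T) (v : T -> V) : uniq s -> {subset s <= undup (t ++ t')} ->
    \sum_(j <- s) v j = \sum_(j <- undup (t ++ t')) if j \in s then v j else 0.
  move=> us ss; rewrite -(big_uniq_sub us (undup_uniq _) ss).
    by rewrite big_seq [RHS]big_seq; apply: eq_bigr => j ->.
  by move=> j /negbTE ->.
by rewrite big_split /=; congr (_ + _); apply: E => // j jt;
  rewrite mem_undup mem_cat jt ?orbT.
Qed.
End Decomposition.

(** * The tensor product lies in O^int *)

Section TensorOint.
Variables (D : root_data) (M M' : Udata D).
Local Notation wt := 'Hom(hh D, rat^o).
Local Notation T := (tensU M M').

(** K_h - q^<h, nu> removes the component of weight nu from a relation and, if h separates mu from
    nu, multiplies the component of weight mu by a unit. This gives a shorter relation. *)
Lemma wtspace_indep (N : Udata D) (t : seq wt) (w : wt -> N) : uniq t ->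
  (forall mu, mu \in t -> Pwt mu /\ wtspace N mu (w mu)) ->
  \sum_(mu <- t) w mu = 0 -> forall mu, mu \in t -> w mu = 0.
Proof.
elim: t w => [|nu t ih] w //= /andP[nut ut] ht e.
have sub mu : mu \in t -> mu \in nu :: t by rewrite inE orbC => ->.
have zt mu : mu \in t -> w mu = 0.
  move=> mut; have [hP _] := ht mu (sub _ mut).
  have [hP' _] := ht nu (mem_head _ _).
  have mn : mu <> nu by move=> E; rewrite -E mut in nut.
  have [h hh ne] := Pcowt_separates hP hP' mn.
  pose w' la := (qz (ipair h la) - qz (ipair h nu)) *: w la.
  have : w' mu = 0.
    apply: (ih w') => // [la lat|].
      by have [hPl hwl] := ht la (sub _ lat); split=> //; exact: wtspaceZ.
    have : opK N h (\sum_(la <- nu :: t) w la) - qz (ipair h nu) *: (\sum_(la <- nu :: t) w la) = 0.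
      by rewrite e opK0 scaler0 subrr.
    rewrite linear_sum scaler_sumr -sumrB big_cons.
    have E la : la \in nu :: t -> opK N h (w la) - qz (ipair h nu) *: w la = w' la.
      by move=> /ht[_ /wtspaceP/(_ h hh)[-> _]]; rewrite -scalerBl.
    rewrite E ?mem_head // {1}/w' subrr scale0r add0r => e0.
    rewrite -[RHS]e0 big_seq [RHS]big_seq; apply: eq_bigr => la lat.
    by rewrite E //; exact: sub.
  rewrite /w' => /(congr1 (fun x => (qz (ipair h mu) - qz (ipair h nu))^-1 *: x)).
  by rewrite scaler0 scalerA mulVr ?scale1r //; exact: unit_qz_sub.
move=> mu; rewrite inE => /predU1P[->|]; last exact: zt.
by move: e; rewrite big_cons big1_seq ?addr0 // => la /andP[_]; exact: zt.
Qed.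

Hypotheses (HM : is_weight_module M) (HM' : is_weight_module M').

Lemma tensU_weight_module : is_weight_module T.
Proof.
split; [exact: tensU_Umodule| |]; last first.
  move=> mu hP t x hx h hh; have [e1 e2] := grK_tensor HM HM' t x hh.
  have [hx1 hx2] := (proj1 (wtspaceP mu x) hx) h hh.
  by rewrite e1 e2 -qzE -pzE hx1 hx2 !grZ.
split=> // [x _|t w]; last exact: wtspace_indep.
move: x; apply: (tensor_ind HM HM').
- by exists [::], (fun=> 0); split=> //; rewrite big_nil.
- by move=> x y; apply: decomp_add => mu; [exact: wtspace_zero|exact: wtspaceD].
move=> t mu m t' nu m' hm hm'; have [hP hw _] := thomv HM HM' hm hm'.
exists [:: mu + nu], (fun=> tens m m'); split=> //; last by rewrite big_seq1.
by move=> la; rewrite inE => /eqP ->.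
Qed.

Section Words.
Variables (X : rI D -> {linear M -> M}) (X' : rI D -> {linear M' -> M'}).
Variable XT : rI D -> {linear T -> T}.
Hypothesis homX : forall t mu i m, homv t mu m ->
  exists t1 mu1, homv t1 mu1 (X i m).
Hypothesis homX' : forall t mu i m, homv t mu m ->
  exists t1 mu1, homv t1 mu1 (X' i m).
Variables (f : rI D -> wt -> Qqpi) (g : rI D -> bool -> wt -> Qqpi).
Hypothesis rule : forall i t mu m t' nu m', homv t mu m -> homv t' nu m' ->
  XT i (tens m m') = f i nu *: tens (X i m) m' + g i t mu *: tens m (X' i m').

(** Expanding the coproducts writes a word acting on m (x) m' as a combination of u m (x) v m', with
    u and v complementary subwords. The predicate restricts the letters: all letters are allowed for
    the E_i, a single one when the nilpotency of F_i is at stake. *)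
Lemma word_tensor (a : pred (rI D)) w t mu m t' nu m' : all a w ->
  homv t mu m -> homv t' nu m' ->
  (forall u v, all a u -> all a v -> (size u + size v)%N = size w ->
     tens (foldr (fun i x => X i x) m u) (foldr (fun i x => X' i x) m' v) = 0 :> T) ->
  foldr (fun i x => XT i x) (tens m m') w = 0.
Proof.
elim/last_ind: w t mu m t' nu m' => [|w i ih] t mu m t' nu m' aw hm hm' h.
  exact: (h [::] [::]).
have lin c1 c2 x y : foldr (fun i x => XT i x) (c1 *: x + c2 *: y) w =
   c1 *: foldr (fun i x => XT i x) x w + c2 *: foldr (fun i x => XT i x) y w.
  by elim: (w) => //= j w' ->; rewrite raddfD /= !linearZ_LR.
move: aw; rewrite all_rcons => /andP[ai aw].
rewrite -cats1 foldr_cat /= (rule i hm hm') lin.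
have [t1 [mu1 h1]] := homX i hm; have [t2 [mu2 h2]] := homX' i hm'.
rewrite (ih _ _ _ _ _ _ aw h1 hm') ?(ih _ _ _ _ _ _ aw hm h2) ?scaler0 ?addr0 //.
  move=> u v au av e; have := h u (rcons v i).
  rewrite all_rcons ai au av !size_rcons addnS e -cats1 foldr_cat; exact.
move=> u v au av e; have := h (rcons u i) v.
rewrite all_rcons ai au av !size_rcons addSn e -cats1 foldr_cat; exact.
Qed.

Lemma word_nilp (a : pred (rI D)) :
  (forall m : M, exists n, forall w, all a w -> (n <= size w)%N ->
     foldr (fun i x => X i x) m w = 0) ->
  (forall m : M', exists n, forall w, all a w -> (n <= size w)%N ->
     foldr (fun i x => X' i x) m w = 0) ->
  forall x : T, exists n, forall w, all a w -> (n <= size w)%N ->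
     foldr (fun i x => XT i x) x w = 0.
Proof.
move=> nM nM'; apply: (tensor_ind HM HM').
- exists 0%N => w _ _; elim: w => //= j w ->; exact: raddf0.
- move=> x y [n hn] [n' hn']; exists (maxn n n') => w aw; rewrite geq_max => /andP[nw nw'].
  suff -> : foldr (fun i x => XT i x) (x + y) w =
    foldr (fun i x => XT i x) x w + foldr (fun i x => XT i x) y w.
    by rewrite hn // hn' // addr0.
  by elim: (w) => //= j w' ->; exact: raddfD.
move=> t mu m t' nu m' hm hm'; have [n hn] := nM m; have [n' hn'] := nM' m'.
exists (n + n')%N => w aw nw; apply: (word_tensor aw hm hm') => u v au av e.
case: (leqP n (size u)) => nu1; first by rewrite hn // tens0l.
by rewrite (hn' v) ?tens0r //; lia.
Qed.
End Words.
End TensorOint.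

Lemma tensU_Oint (D : root_data) (M M' : Udata D) : in_Oint M -> in_Oint M' ->
  in_Oint (tensU M M').
Proof.
move=> [HM _ FM WM] [HM' _ FM' WM'].
have HU : is_Umodule M by case: HM.
have HU' : is_Umodule M' by case: HM'.
have W (x : tensU M M') : exists n, forall w : seq (rI D), all predT w -> (n <= size w)%N ->
    foldr (fun i x => opE (tensU M M') i x) x w = 0.
  apply: (@word_nilp D M M' HM HM' (@opE _ M) (@opE _ M') (@opE _ (tensU M M')) _ _
   (fun i nu => qiz i (- awt i nu)) (fun i t mu => psign (par i && t) * piz i (awt i mu)) _ predT).
  - by move=> t mu i m hm; do 2!eexists; exact: homvE hm.
  - by move=> t mu i m hm; do 2!eexists; exact: homvE hm.
  - by move=> i t mu m t' nu m' hm hm'; exact: (tE HM i hm hm').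
  - by move=> m; have [n hn] := WM m; exists n => w _; exact: hn.
  - by move=> m; have [n hn] := WM' m; exists n => w _; exact: hn.
split; first exact: tensU_weight_module.
- move=> i x; have [n hn] := W x; exists n.
  have := hn (nseq n i); rewrite all_predT size_nseq => <- //.
  by elim: (n) => //= k ->.
- move=> i x.
  have nseqP (w : seq (rI D)) : all (pred1 i) w -> w = nseq (size w) i by move/all_pred1P.
  have fold (N : Udata D) n (m : N) : foldr (fun i x => opF N i x) m (nseq n i) = iter n (opF N i) m.
    by elim: n => //= k ->.
  have it (N : Udata D) (m : N) : (exists n, iter n (opF N i) m = 0) ->
    exists n, forall w, all (pred1 i) w -> (n <= size w)%N ->
     foldr (fun i x => opF N i x) m w = 0.
    move=> [n hn]; exists n => w /nseqP ->; rewrite size_nseq fold => nw.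
    rewrite -(subnK nw) iterD hn.
    by elim: (_ - _)%N => //= k ->; exact: opF0.
  have [n hn] : exists n, forall w : seq (rI D), all (pred1 i) w -> (n <= size w)%N ->
    foldr (fun i x => opF (tensU M M') i x) x w = 0.
    apply: (@word_nilp D M M' HM HM' (@opF _ M) (@opF _ M') (@opF _ (tensU M M')) _ _
     (fun i nu => 1) (fun i t mu => psign (par i && t) * qiz i (awt i mu)) _ (pred1 i)).
    + by move=> t mu j m hm; do 2!eexists; exact: homvF hm.
    + by move=> t mu j m hm; do 2!eexists; exact: homvF hm.
    + by move=> j t mu m t' nu m' hm hm'; rewrite (tF HM _ hm hm') scale1r.
    + by move=> m; apply: it; exact: FM.
    + by move=> m; apply: it; exact: FM'.
  by exists n; rewrite -fold; apply: hn; rewrite ?size_nseq // all_nseq /= eqxx orbT.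
by move=> x; have [n hn] := W x; exists n => w; apply: hn; exact: all_predT.
Qed.

Lemma tensU_Oint_pm (D : root_data) (s : bool) (M M' : Udata D) :
  in_Oint_pm s M -> in_Oint_pm s M' -> in_Oint_pm s (tensU M M').
Proof.
move=> [HM pM] [HM' _]; split; first exact: tensU_Oint.
move=> x; have [t ->] := tensor_gen x; rewrite !scaler_sumr.
by apply: eq_bigr => p _; rewrite -!tensZl pM.
Qed.

(** * Bases of tensor products *)

Section Coordinates.
Variables (R : comNzRingType) (V : lmodType R) (S : set R) (b X : set V).
Hypotheses (S0 : S 0) (SB : forall a c, S a -> S c -> S (a - c)).
Hypothesis SM : forall a c, S a -> S c -> S (a * c).
Hypothesis basis : basis_over S b X.

Let SD a c : S a -> S c -> S (a + c).
Proof. by move=> Sa Sc; rewrite -[c]opprK; apply: SB => //; rewrite -sub0r; exact: SB. Qed.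

Definition combination (p : seq V * (V -> R)) (x : V) : Prop :=
  [/\ uniq p.1, forall v, v \in p.1 -> b v /\ S (p.2 v)
    & x = \sum_(v <- p.1) p.2 v *: v].

(** [basis_over] only asserts that representations exist. One is chosen here, and [coordE] shows
    that the resulting coordinates do not depend on the choice. *)
Definition coord_supp x : seq V := (xget ([::], fun=> 0) [set p | combination p x]).1.

Definition coord x v : R :=
  if v \in coord_supp x then (xget ([::], fun=> 0) [set p | combination p x]).2 v else 0.

Lemma coordP x : X x -> combination (coord_supp x, coord x) x.
Proof.
move=> Xx; rewrite /coord /coord_supp; set p := xget _ _.
have [u h e] : combination p x.
  apply: (@xgetPex _ ([::], fun=> 0) [set p | combination p x]).
  by have [_ /(_ x) [/(_ Xx)[t [c h]] _] _] := basis; exists (t, c).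
split=> //= [v vp|]; first by rewrite vp; exact: h.
by rewrite e big_seq [RHS]big_seq; apply: eq_bigr => v vp; rewrite vp.
Qed.

Lemma coord_supp_b x v : X x -> v \in coord_supp x -> b v.
Proof. by move=> /coordP[_ h _] /h[]. Qed.

Lemma coord_S x v : X x -> S (coord x v).
Proof.
move=> Xx; have [_ h _] := coordP Xx; case vs: (v \in coord_supp x); first by case: (h v vs).
by rewrite /coord vs.
Qed.

Lemma coord_out x v : v \notin coord_supp x -> coord x v = 0.
Proof. by rewrite /coord => /negbTE ->. Qed.

Lemma coord_sum x t : X x -> uniq t -> {subset coord_supp x <= t} ->
  x = \sum_(v <- t) coord x v *: v.
Proof.
move=> Xx ut st; have [us _ e] := coordP Xx; rewrite {1}e /=.
by apply: big_uniq_sub => // v /coord_out ->; rewrite scale0r.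
Qed.

Lemma coordE x t c : X x -> uniq t -> (forall v, v \in t -> b v /\ S (c v)) ->
  x = \sum_(v <- t) c v *: v -> forall v, coord x v = if v \in t then c v else 0.
Proof.
move=> Xx ut ht e v.
pose u := undup (coord_supp x ++ t).
have uu : uniq u by exact: undup_uniq.
have su : {subset coord_supp x <= u} by move=> w; rewrite mem_undup mem_cat => ->.
have tu : {subset t <= u} by move=> w; rewrite mem_undup mem_cat orbC => ->.
pose c' w := if w \in t then c w else 0.
have [_ _ ind] := basis.
have [vu|] := boolP (v \in u); last first.
  rewrite mem_undup mem_cat negb_or => /andP[/coord_out -> /negbTE ->] //.
apply/eqP; rewrite -subr_eq0; apply/eqP.
apply: (ind u (fun w => coord x w - c' w)) vu => // [w|].
  rewrite mem_undup mem_cat => /orP[ws|wt].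
    split; first exact: coord_supp_b ws.
    by apply: SB; [exact: coord_S|rewrite /c'; case: ifP => // /ht[]].
  have [bw Sc] := ht w wt; split=> //.
  by apply: SB; [exact: coord_S|rewrite /c' wt].
under eq_bigr do rewrite scalerBl.
rewrite sumrB -coord_sum // -(big_uniq_sub ut uu tu) => [|w /negbTE wt]; last first.
  by rewrite /c' wt scale0r.
rewrite {1}e; apply/eqP; rewrite subr_eq0; apply/eqP.
by rewrite big_seq [RHS]big_seq; apply: eq_bigr => w wt; rewrite /c' wt.
Qed.

Lemma coordD x y v : X x -> X y -> X (x + y) -> coord (x + y) v = coord x v + coord y v.
Proof.
move=> Xx Xy Xxy; pose u := undup (coord_supp x ++ coord_supp y).
have uu : uniq u by exact: undup_uniq.
have su : {subset coord_supp x <= u} by move=> w; rewrite mem_undup mem_cat => ->.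
have tu : {subset coord_supp y <= u} by move=> w; rewrite mem_undup mem_cat orbC => ->.
rewrite (coordE Xxy uu (c := fun w => coord x w + coord y w)).
- case: ifPn => // vu.
  by rewrite !coord_out ?addr0 //; apply: contra vu; [exact: tu|exact: su].
- move=> w; rewrite mem_undup mem_cat => h; split; last by apply: SD; exact: coord_S.
  by case/orP: h; exact: coord_supp_b.
under eq_bigr do rewrite scalerDl.
by rewrite big_split /= -!coord_sum.
Qed.

Lemma coordZ a x v : S a -> X x -> X (a *: x) -> coord (a *: x) v = a * coord x v.
Proof.
move=> Sa Xx Xax; have [us h e] := coordP Xx.
rewrite (coordE Xax us (c := fun w => a * coord x w)).
- by case: ifPn => // vu; rewrite coord_out ?mulr0.
- by move=> w /h[bw Sw]; split=> //; exact: SM.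
by rewrite {1}e scaler_sumr; apply: eq_bigr => w _; rewrite scalerA.
Qed.

Lemma coord0 v : X 0 -> coord 0 v = 0.
Proof. by move=> X0; rewrite (coordE X0 (t := [::]) (c := fun=> 0)) ?big_nil. Qed.

Lemma coord_delta v w : S 1 -> b v -> X v -> coord v w = (v == w)%:R.
Proof.
move=> S1 bv Xv; rewrite (coordE Xv (t := [:: v]) (c := fun=> 1)) //.
- by rewrite inE eq_sym; case: eqP.
- by move=> u; rewrite inE => /eqP ->.
by rewrite big_seq1 scale1r.
Qed.

(** The extension of [th] from the basis to a form on [X]. It is linear over S only: for S = Q(q)
    the form need not commute with multiplication by pi. *)
Definition basis_form (th : V -> R) (x : V) : R :=
  \sum_(v <- coord_supp x) coord x v * th v.

Lemma basis_formE th x t : X x -> uniq t -> {subset coord_supp x <= t} ->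
  basis_form th x = \sum_(v <- t) coord x v * th v.
Proof.
move=> Xx ut st; have [us _ _] := coordP Xx.
by apply: big_uniq_sub => // v /coord_out ->; rewrite mul0r.
Qed.

Lemma basis_formD th x y : X x -> X y -> X (x + y) ->
  basis_form th (x + y) = basis_form th x + basis_form th y.
Proof.
move=> Xx Xy Xxy; pose u := undup (coord_supp (x + y) ++ coord_supp x ++ coord_supp y).
have uu : uniq u by exact: undup_uniq.
rewrite !(@basis_formE th _ u) //; first 1 last.
- by move=> w; rewrite mem_undup !mem_cat => ->; rewrite !orbT.
- by move=> w; rewrite mem_undup !mem_cat => ->; rewrite !orbT.
- by move=> w; rewrite mem_undup !mem_cat => ->.
by rewrite -big_split; apply: eq_bigr => v _; rewrite coordD // mulrDl.
Qed.

Lemma basis_formZ th a x : S a -> X x -> X (a *: x) ->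
  basis_form th (a *: x) = a * basis_form th x.
Proof.
move=> Sa Xx Xax; pose u := undup (coord_supp (a *: x) ++ coord_supp x).
have uu : uniq u by exact: undup_uniq.
rewrite !(@basis_formE th _ u) //; first 1 last.
- by move=> w; rewrite mem_undup !mem_cat => ->; rewrite !orbT.
- by move=> w; rewrite mem_undup !mem_cat => ->.
by rewrite mulr_sumr; apply: eq_bigr => v _; rewrite coordZ // mulrA.
Qed.
End Coordinates.

Section Combinations.
Variables (R : comNzRingType) (V : lmodType R) (S : set R) (b : set V).
Hypotheses (S0 : S 0) (SD : forall a c, S a -> S c -> S (a + c)).

Lemma combinationD x y : (exists p, combination S b p x) ->
  (exists p, combination S b p y) -> exists p, combination S b p (x + y).
Proof.
pose W (v : V) : set V := [set c *: v | c in S].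
have dec z : (exists p, combination S b p z) <-> decomposable b W z.
  split=> [[[t c] [/= ut ht ->]]|[t [w [ut ht ->]]]].
    by exists t, (fun v => c v *: v); split=> // v /ht[bv Sc]; split=> //; exists (c v).
  have /choice[c hc] v : exists c, v \in t -> S c /\ w v = c *: v.
    have [vt|_] := boolP (v \in t); last by exists 0.
    by have [_ [c Sc <-]] := ht v vt; exists c.
  exists (t, c); split=> //= [v vt|]; first by have [bv _] := ht v vt; have [Sv _] := hc v vt.
  by rewrite big_seq [RHS]big_seq; apply: eq_bigr => v /hc[_ ->].
rewrite !dec; apply: decomp_add => v; first by exists 0; rewrite ?scale0r.
by move=> _ _ [c Sc <-] [c' Sc' <-]; exists (c + c'); [exact: SD|rewrite scalerDl].
Qed.

Lemma combination0 : exists p, combination S b p 0.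
Proof. by exists ([::], fun=> 0); split; rewrite ?big_nil. Qed.

Lemma combination_sum I (r : seq I) (P : pred I) (f : I -> V) :
  (forall i, P i -> exists p, combination S b p (f i)) ->
  exists p, combination S b p (\sum_(i <- r | P i) f i).
Proof.
move=> h; apply: (big_ind (fun x => exists p, combination S b p x)) => //.
  exact: combination0.
exact: combinationD.
Qed.

Lemma combinationZ a x : S a -> (forall c d, S c -> S d -> S (c * d)) ->
  (exists p, combination S b p x) -> exists p, combination S b p (a *: x).
Proof.
move=> Sa SM [[t c] [/= ut ht ->]]; exists (t, fun v => a * c v); split=> //=.
  by move=> v /ht[bv Sc]; split=> //; exact: SM.
by rewrite scaler_sumr; apply: eq_bigr => v _; rewrite scalerA.
Qed.

Lemma combination1 a v : S a -> b v -> exists p, combination S b p (a *: v).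
Proof.
move=> Sa bv; exists ([:: v], fun=> a); split=> //=; last by rewrite big_seq1.
by move=> u; rewrite inE => /eqP ->.
Qed.

(** Independence is tested by a dual family [xi]. Linearity of [xi] is asked on combinations with
    coefficients in S, because coordinates are linear over S only. *)
Lemma basis_dual (X : set V) (xi : V -> V -> R) :
  b `<=` X -> (forall x, X x -> exists p, combination S b p x) ->
  (forall p x, combination S b p x -> X x) ->
  (forall v p x, b v -> combination S b p x -> xi v x = \sum_(w <- p.1) p.2 w * xi v w) ->
  (forall v w, b v -> b w -> xi v w = (v == w)%:R) ->
  (forall v, b v -> xi v 0 = 0) -> basis_over S b X.
Proof.
move=> bX Xc cX xil xid xi0; split=> // [x|t c ut ht e v vt].
  split=> [/Xc[[t c] h]|[t [c h]]]; first by exists t, c.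
  exact: (cX (t, c)).
have [bv _] := ht v vt.
have := xil v (t, c) 0 bv (And3 ut ht (esym e)).
rewrite xi0 //= (bigD1_seq v) //= xid // eqxx mulr1 big1_seq ?addr0 // => w /andP[wv wt].
by have [bw _] := ht w wt; rewrite xid // eq_sym (negbTE wv) mulr0.
Qed.
End Combinations.

Section ScalarSubrings.

Lemma Qq_scal0 : Qq_scal 0. Proof. by exists 0; rewrite ?rmorph0. Qed.
Lemma Qq_scal1 : Qq_scal 1. Proof. by exists 1; rewrite ?rmorph1. Qed.
Lemma Qq_scalB a c : Qq_scal a -> Qq_scal c -> Qq_scal (a - c).
Proof. by move=> [x _ <-] [y _ <-]; exists (x - y); rewrite ?rmorphB. Qed.
Lemma Qq_scalD a c : Qq_scal a -> Qq_scal c -> Qq_scal (a + c).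
Proof. by move=> [x _ <-] [y _ <-]; exists (x + y); rewrite ?rmorphD. Qed.
Lemma Qq_scalM a c : Qq_scal a -> Qq_scal c -> Qq_scal (a * c).
Proof. by move=> [x _ <-] [y _ <-]; exists (x * y); rewrite ?rmorphM. Qed.
Lemma A_scal_Qq a : A_scal a -> Qq_scal a.
Proof. by move=> [x _ <-]; exists x. Qed.

Lemma A_scal1 : A_scal 1. Proof. by have := A_embQ 1; rewrite rmorph1. Qed.
Lemma A_scal0 : A_scal 0. Proof. by have := A_embQ 0; rewrite rmorph0. Qed.
Lemma A_scalD a c : A_scal a -> A_scal c -> A_scal (a + c).
Proof. by move=> [x rx <-] [y ry <-]; exists (x + y); rewrite ?rmorphD //; exact: regular_add. Qed.
Lemma A_scalM a c : A_scal a -> A_scal c -> A_scal (a * c).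
Proof. by move=> [x rx <-] [y ry <-]; exists (x * y); rewrite ?rmorphM //; exact: regular_mul. Qed.
(** Where pi is a sign, every scalar acts as an element of Q(q), and the same element serves all
    modules with that sign. This is what lets a tensor product over Q(q)^pi be handled with bases
    over Q(q). *)
Lemma scalar_sign (s : bool) (a : Qqpi) : exists c : Qq, forall V : lmodType Qqpi,
  (forall m : V, ppi *: m = (-1) ^+ s *: m) -> forall m : V, a *: m = emb c *: m.
Proof.
have [x [y ->]] := Qqpi_decomp a; exists (x + y * (-1) ^+ s) => V hs m.
by rewrite scalerDl -scalerA hs scalerA -scalerDl rmorphD rmorphM rmorphXn rmorphN1.
Qed.
End ScalarSubrings.

Section Slice.
Variables (V V' : lmodType Qqpi) (th : V' -> Qqpi).
Hypothesis thD : forall x y, th (x + y) = th x + th y.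
Hypothesis thZ : forall a x (m : V), th (a *: x) *: m = a *: (th x *: m).

Definition slice_fun (m : V) (x : V') : V := th x *: m.

Lemma slice_bilinear :
  bilinear_for (GRing.Scale.Law.clone _ _ *:%R _) (GRing.Scale.Law.clone _ _ *:%R _) slice_fun.
Proof.
split=> [x a m m'|m a x y]; rewrite /slice_fun.
  by rewrite scalerDr scalerAC.
by rewrite thD scalerDl thZ.
Qed.
HB.instance Definition _ := bilinear_isBilinear.Build Qqpi V V' V _ _ slice_fun slice_bilinear.

(** The map id (x) th. The hypothesis [thZ] asks for linearity of [th] only after acting on V, which
    is what a form linear over Q(q) satisfies when pi is a sign. *)
Definition slice : {linear tensor V V' -> V} := tlift slice_fun.

Lemma sliceE m x : slice (tens m x) = th x *: m.
Proof. exact: tliftE. Qed.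
End Slice.

Section TensorBasis.
Variables (s : bool) (V V' : lmodType Qqpi) (L : Asubmod V) (L' : Asubmod V').
Variables (b : set V) (b' : set V').
Hypotheses (hs : forall m : V, ppi *: m = (-1) ^+ s *: m).
Hypotheses (hs' : forall m : V', ppi *: m = (-1) ^+ s *: m).
Hypotheses (bQ : basis_over Qq_scal b [set: V]) (bA : basis_over A_scal b (aset L)).
Hypotheses (bQ' : basis_over Qq_scal b' [set: V']) (bA' : basis_over A_scal b' (aset L')).

Lemma coord_lattice (W : lmodType Qqpi) (N : Asubmod W) (c : set W) x v :
  basis_over Qq_scal c [set: W] -> basis_over A_scal c (aset N) ->
  aset N x -> A_scal (coord Qq_scal c x v).
Proof.
move=> cQ [_ /(_ x) cA _] /cA[t [d [ut ht e]]].
rewrite (coordE Qq_scal0 Qq_scalB cQ Logic.I ut _ e) => [|w /ht[cw /A_scal_Qq]//].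
by case: ifP => [/ht[]|_] //; exact: A_scal0.
Qed.

Let form th : V' -> Qqpi := basis_form Qq_scal b' th.

Let formD th x y : form th (x + y) = form th x + form th y.
Proof. by apply: (basis_formD Qq_scal0 Qq_scalB bQ'). Qed.

Let formZ th a x (m : V) : form th (a *: x) *: m = a *: (form th x *: m).
Proof.
have [c hc] := scalar_sign s a; rewrite !hc // /form.
by rewrite (basis_formZ Qq_scal0 Qq_scalB Qq_scalM bQ') ?scalerA //; exists c.
Qed.

Definition basis_slice (th : V' -> Qqpi) : {linear tensor V V' -> V} :=
  slice (formD th) (formZ th).

Lemma basis_sliceE th m x : basis_slice th (tens m x) = form th x *: m.
Proof. exact: sliceE. Qed.

Lemma basis_slice0 th : basis_slice th 0 = 0. Proof. exact: linear0. Qed.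
Lemma basis_sliceD th x y : basis_slice th (x + y) = basis_slice th x + basis_slice th y.
Proof. exact: linearD. Qed.
Lemma basis_sliceZ th a x : basis_slice th (a *: x) = a *: basis_slice th x.
Proof. exact: linearZ_LR. Qed.

Lemma form_lattice th x : (forall v, A_scal (th v)) -> aset L' x -> A_scal (form th x).
Proof.
move=> hth Lx; rewrite /form /basis_form; apply: (big_ind A_scal) => //.
- exact: A_scal0.
- exact: A_scalD.
by move=> v _; apply: A_scalM => //; exact: (coord_lattice _ bQ' bA' Lx).
Qed.

(** The preimage of L under the slice is an A-submodule containing the pure tensors of lattice
    vectors. *)
Lemma basis_slice_ltens th x :
  (forall v, A_scal (th v)) ->
  Aspan_set [set x : tensor V V' | exists l l', [/\ aset L l, aset L' l' & x = tens l l']] x ->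
  aset L (basis_slice th x).
Proof.
move=> hth; pose N := @ASubmod (tensor V V') [set x | aset L (basis_slice th x)].
have N0 : aset L (basis_slice th 0) by rewrite basis_slice0; exact: aset0.
have ND y z : aset L (basis_slice th y) -> aset L (basis_slice th z) ->
  aset L (basis_slice th (y + z)) by rewrite basis_sliceD; exact: asetD.
have NZ a y : A_scal a -> aset L (basis_slice th y) -> aset L (basis_slice th (a *: y)).
  by rewrite basis_sliceZ; exact: asetZ.
move=> /(_ (N N0 ND NZ)); apply=> y [l [l' [Ll Ll' ->]]] /=.
by rewrite basis_sliceE; apply: asetZ => //; exact: form_lattice.
Qed.

Definition delta (y v : V') : Qqpi := (v == y)%:R.

Lemma form_delta y x : form (delta y) x = coord Qq_scal b' x y.
Proof.
rewrite /form /basis_form /delta; have [ys|yns] := boolP (y \in coord_supp Qq_scal b' x).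
  rewrite (bigD1_seq y) //=; last by case: (coordP bQ' (x := x) Logic.I).
  rewrite eqxx mulr1 big1 ?addr0 // => v /negbTE ->; exact: mulr0.
rewrite coord_out // big1_seq // => v /andP[_ vs].
by case: eqP => [e|]; [rewrite e (negbTE yns) in vs|rewrite mulr0].
Qed.

Lemma slice_expand x : exists t : seq V', [/\ uniq t, forall y, y \in t -> b' y
  & x = \sum_(y <- t) tens (basis_slice (delta y) x) y].
Proof.
(* Asking for the expansion over every larger list makes the property additive in x. *)
pose P x := exists2 t0 : seq V', forall y, y \in t0 -> b' y & forall t, uniq t ->
  {subset t0 <= t} -> x = \sum_(y <- t) tens (basis_slice (delta y) x) y.
suff [t0 h0 h] : P x.
  exists (undup t0); split; [exact: undup_uniq|by move=> y; rewrite mem_undup; exact: h0|].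
  by apply: h => [|y]; rewrite ?undup_uniq // mem_undup.
have [ts ->] := tensor_gen x; apply: (big_ind P).
- exists [::] => // t _ _; rewrite big1 // => y _; rewrite basis_slice0; exact: tens0l.
- move=> y z [t h0 h] [t' h0' h']; exists (t ++ t') => [w|u uu su].
    by rewrite mem_cat => /orP[/h0|/h0'].
  have st : {subset t <= u} by move=> w wt; apply: su; rewrite mem_cat wt.
  have st' : {subset t' <= u} by move=> w wt; apply: su; rewrite mem_cat wt orbT.
  rewrite {1}(h u uu st) {1}(h' u uu st') -big_split; apply: eq_bigr => w _.
  by rewrite basis_sliceD; rewrite tensDl.
move=> p _; exists (coord_supp Qq_scal b' p.2) => [y|t ut st].
  exact: (coord_supp_b bQ').
under eq_bigr do rewrite basis_sliceE form_delta tensZl -tensZr.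
by rewrite -tens_sumr -(coord_sum bQ').
Qed.

Definition tensor_basis : set (tensor V V') :=
  [set v | exists x y, [/\ b x, b' y & v = tens x y]].

(** A basis vector does not display its two factors, so a pair is chosen; [xi_delta] then shows that
    the choice is harmless. *)
Let xi (v z : tensor V V') : Qqpi :=
  let p := xget (0, 0) [set p | [/\ b p.1, b' p.2 & v = tens p.1 p.2]] in
  coord Qq_scal b (basis_slice (delta p.2) z) p.1.

Let xiP v : tensor_basis v -> exists x y, [/\ b x, b' y, v = tens x y &
  forall z, xi v z = coord Qq_scal b (basis_slice (delta y) z) x].
Proof.
move=> [x [y [bx by' e]]]; pose P := [set p | [/\ b p.1, b' p.2 & v = tens p.1 p.2]].
have [h1 h2 h3] : P (xget (0, 0) P) by apply: (@xgetI _ (0, 0) P (x, y)).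
by exists (xget (0, 0) P).1, (xget (0, 0) P).2.
Qed.

Let xi_lin v (p : seq (tensor V V') * (tensor V V' -> Qqpi)) x : tensor_basis v ->
  combination Qq_scal tensor_basis p x -> xi v x = \sum_(w <- p.1) p.2 w * xi v w.
Proof.
move=> /xiP[y [z [_ _ _ E]]] [_ + ->]; rewrite E; case: p => t c /=.
elim: t => [|w t ih] ht.
  by rewrite !big_nil basis_slice0 (coord0 Qq_scal0 Qq_scalB bQ).
rewrite !big_cons basis_sliceD (coordD Qq_scal0 Qq_scalB bQ) // basis_sliceZ.
rewrite (coordZ Qq_scal0 Qq_scalB Qq_scalM bQ) //; last by case: (ht w (mem_head _ _)).
by rewrite E ih // => u ut; apply: ht; rewrite inE ut orbT.
Qed.

Let xi_delta v w : tensor_basis v -> tensor_basis w -> xi v w = (v == w)%:R.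
Proof.
move=> /xiP[x [y [bx by' e E]]] [x' [y' [bx' by'' e']]].
have F x1 y1 : b x1 -> b' y1 -> xi v (tens x1 y1) = ((y1 == y) && (x1 == x))%:R.
  move=> bx1 by1; rewrite E basis_sliceE form_delta.
  rewrite (coord_delta Qq_scal0 Qq_scalB bQ') //; last exact: Qq_scal1.
  rewrite (coordZ Qq_scal0 Qq_scalB Qq_scalM bQ) //; last first.
    by case: eqP => _; [exact: Qq_scal1|exact: Qq_scal0].
  rewrite (coord_delta Qq_scal0 Qq_scalB bQ) //; last exact: Qq_scal1.
  by rewrite -natrM mulnb.
have [vw|vw] := eqVneq v w; first by rewrite -vw {2}e F // !eqxx.
rewrite e' F //; case: andP => // -[/eqP yy /eqP xx].
by rewrite e e' yy xx eqxx in vw.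
Qed.

Lemma tensor_basis_Qq : basis_over Qq_scal tensor_basis [set: tensor V V'].
Proof.
apply: (@basis_dual _ _ _ _ _ xi).
- by [].
- move=> x _; have [t [ut ht ->]] := slice_expand x.
  rewrite big_seq; apply: combination_sum => [||y yt]; [exact: Qq_scal0|exact: Qq_scalD|].
  set m := basis_slice _ _.
  have [um hm em] := coordP bQ (x := m) Logic.I.
  rewrite {1}em tens_suml big_seq; apply: combination_sum => [||v vm];
    [exact: Qq_scal0|exact: Qq_scalD|].
  rewrite tensZl; apply: combination1; first by case: (hm v vm).
  by exists v, y; split=> //; [case: (hm v vm)|exact: ht].
- by [].
- by move=> v p x bv; exact: xi_lin.
- exact: xi_delta.
move=> v bv; rewrite (@xi_lin v ([::], fun=> 0)) ?big_nil //; split; rewrite ?big_nil //.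
Qed.

Lemma tensor_basis_A (X : Asubmod (tensor V V')) :
  (forall x, aset X x <-> Aspan_set [set x : tensor V V' |
     exists l l', [/\ aset L l, aset L' l' & x = tens l l']] x) ->
  basis_over A_scal tensor_basis (aset X).
Proof.
move=> hX; have bX : tensor_basis `<=` aset X.
  move=> v [x [y [bx by' ->]]]; apply/hX => N; apply; exists x, y; split=> //.
    by case: bA => /(_ x bx).
  by case: bA' => /(_ y by').
apply: (@basis_dual _ _ _ _ _ xi).
- by [].
- move=> x /hX Xx; have [t [ut ht ->]] := slice_expand x.
  rewrite big_seq; apply: combination_sum => [||y yt]; [exact: A_scal0|exact: A_scalD|].
  set m := basis_slice _ _.
  have Lm : aset L m.
    apply: basis_slice_ltens => // v; rewrite /delta; case: (_ == _); [exact: A_scal1|exact: A_scal0].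
  have [um hm em] := coordP bQ (x := m) Logic.I.
  rewrite em tens_suml big_seq; apply: combination_sum => [||v vm];
    [exact: A_scal0|exact: A_scalD|].
  rewrite tensZl; apply: combination1; first exact: (coord_lattice _ bQ bA Lm).
  by exists v, y; split=> //; [case: (hm v vm)|exact: ht].
- move=> p x [_ h ->]; rewrite big_seq; apply: (big_ind (aset X)); [exact: aset0|exact: asetD|].
  by move=> v /h[bv Av]; apply: asetZ => //; exact: bX.
- by move=> v p x bv [u h e]; apply: xi_lin => //; split=> // w /h[bw /A_scal_Qq].
- exact: xi_delta.
move=> v bv; rewrite (@xi_lin v ([::], fun=> 0)) ?big_nil //; split; rewrite ?big_nil //.
Qed.
End TensorBasis.

(** * Reduction modulo q *)

Section Residue.

Lemma A_scal_residue a : A_scal a -> exists c (a' : Qqpi),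
  A_scal a' /\ a = embQ c + qq * a'.
Proof.
move=> [_ [n [d [d0 ->]]] <-].
pose c := n.[0] / d.[0].
have /factor_theorem[m e] : root (n - c%:P * d) 0.
  by rewrite /root !hornerE /c -mulrA mulVf // mulr1 subrr.
exists c, (emb (tofrac m / tofrac d)); split; first by exists (tofrac m / tofrac d) => //; exists m, d.
have D0 : tofrac d != 0.
  by rewrite tofrac_eq0; apply: contraNneq d0 => ->; rewrite horner0.
rewrite /embQ /qq -rmorphM -rmorphD; congr (emb _); apply: (mulIf D0).
rewrite mulfVK // mulrDl -mulrA mulfVK // -!rmorphM -rmorphD /=; congr (tofrac _).
by rewrite ['X * m]mulrC -['X]subr0 -polyC0 -e addrC subrK.
Qed.

Variables (V : lmodType Qqpi) (L : Asubmod V).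

Lemma cls_q l : aset L l -> cls L (qq *: l) = 0.
Proof. by move=> Ll; rewrite -cls0; apply/clsP; exists l => //; rewrite subr0. Qed.

Lemma cls_scale c x : cls L (embQ c *: x) = c *: cls L x. Proof. exact: clsZ. Qed.

Lemma aset_qq l : aset L l -> aset L (qq *: l).
Proof. by apply: asetZ; exact: A_scal_q. Qed.

Lemma Lbar_cls l : aset L l -> @Lbar _ L (cls L l). Proof. by move=> Ll; exists l. Qed.

Lemma Lbar0 : @Lbar _ L 0. Proof. by rewrite -cls0; apply: Lbar_cls; exact: aset0. Qed.

Lemma LbarD z w : @Lbar _ L z -> @Lbar _ L w -> @Lbar _ L (z + w).
Proof. by move=> [l Ll <-] [k Lk <-]; rewrite -clsDr; apply: Lbar_cls; exact: asetD. Qed.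

Lemma LbarZ c z : @Lbar _ L z -> @Lbar _ L (c *: z).
Proof. by move=> [l Ll <-]; rewrite -cls_scale; apply: Lbar_cls; exact: Laset_embQ. Qed.

Lemma cls_A a l : A_scal a -> aset L l -> exists c : rat, cls L (a *: l) = c *: cls L l.
Proof.
move=> /A_scal_residue[c [a' [Aa' ->]]] Ll; exists c.
rewrite scalerDl -scalerA clsDr cls_q ?addr0 ?cls_scale //; exact: asetZ.
Qed.
End Residue.

Section TensorResidue.
Variables (D : root_data) (s : bool) (M M' : Udata D) (L : Asubmod M) (L' : Asubmod M').
Variables (b : set M) (b' : set M').
Hypotheses (hs : forall m : M, ppi *: m = (-1) ^+ s *: m).
Hypotheses (hs' : forall m : M', ppi *: m = (-1) ^+ s *: m).
Hypotheses (bQ : basis_over Qq_scal b [set: M]) (bA : basis_over A_scal b (aset L)).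
Hypotheses (bQ' : basis_over Qq_scal b' [set: M']) (bA' : basis_over A_scal b' (aset L')).
Variables (B0 : set (lquo L)) (B0' : set (lquo L')).
Hypotheses (hB : basis_over [set: rat] B0 (@Lbar _ L)).
Hypotheses (hB' : basis_over [set: rat] B0' (@Lbar _ L')).
Local Notation LT := (ltens L L').

Lemma ltens_tens l l' : aset L l -> aset L' l' -> aset LT (tens l l').
Proof. by move=> Ll Ll' N; apply; exists l, l'. Qed.

Lemma qtensDl x y z : @Lbar _ L x -> @Lbar _ L y -> @Lbar _ L' z ->
  qtens (x + y) z = qtens x z + qtens y z.
Proof.
move=> [k Lk <-] [l Ll <-] [l' Ll' <-]; rewrite -clsDr !qtensE //; last exact: asetD.
by rewrite tensDl clsDr.
Qed.

Lemma qtensDr x y z : @Lbar _ L x -> @Lbar _ L' y -> @Lbar _ L' z ->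
  qtens x (y + z) = qtens x y + qtens x z.
Proof.
move=> [k Lk <-] [l Ll <-] [l' Ll' <-]; rewrite -clsDr !qtensE //; last exact: asetD.
by rewrite tensDr clsDr.
Qed.

Lemma qtensZl c x z : @Lbar _ L x -> @Lbar _ L' z -> qtens (c *: x) z = c *: qtens x z.
Proof.
move=> [k Lk <-] [l' Ll' <-]; rewrite -cls_scale !qtensE //; last exact: Laset_embQ.
by rewrite tensZl cls_scale.
Qed.

Lemma qtensZr c x z : @Lbar _ L x -> @Lbar _ L' z -> qtens x (c *: z) = c *: qtens x z.
Proof.
move=> [k Lk <-] [l' Ll' <-]; rewrite -cls_scale !qtensE //; last exact: Laset_embQ.
by rewrite tensZr cls_scale.
Qed.

Lemma qtens_suml t (c : lquo L -> rat) z : (forall v, v \in t -> @Lbar _ L v) -> @Lbar _ L' z ->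
  @Lbar _ L (\sum_(v <- t) c v *: v) /\
  qtens (\sum_(v <- t) c v *: v) z = \sum_(v <- t) c v *: qtens v z.
Proof.
move=> ht hz; elim: t ht => [|v t ih] ht.
  rewrite !big_nil; split; first exact: Lbar0.
  by rewrite -(scale0r 0) qtensZl ?scale0r //; exact: Lbar0.
have hv := ht v (mem_head _ _).
have [|h1 h2] := ih; first by move=> w wt; apply: ht; rewrite inE wt orbT.
rewrite !big_cons; split; first by apply: LbarD => //; exact: LbarZ.
by rewrite qtensDl ?h2 ?qtensZl //; exact: LbarZ.
Qed.

Lemma qtens_sumr t (c : lquo L' -> rat) x : (forall v, v \in t -> @Lbar _ L' v) -> @Lbar _ L x ->
  @Lbar _ L' (\sum_(v <- t) c v *: v) /\
  qtens x (\sum_(v <- t) c v *: v) = \sum_(v <- t) c v *: qtens x v.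
Proof.
move=> ht hz; elim: t ht => [|v t ih] ht.
  rewrite !big_nil; split; first exact: Lbar0.
  by rewrite -(scale0r 0) qtensZr ?scale0r //; exact: Lbar0.
have hv := ht v (mem_head _ _).
have [|h1 h2] := ih; first by move=> w wt; apply: ht; rewrite inE wt orbT.
rewrite !big_cons; split; first by apply: LbarD => //; exact: LbarZ.
by rewrite qtensDr ?h2 ?qtensZr //; exact: LbarZ.
Qed.

Let QS0 : [set: rat] 0. Proof. by []. Qed.
Let QSB (a c : rat) : [set: rat] a -> [set: rat] c -> [set: rat] (a - c). Proof. by []. Qed.
Let QSM (a c : rat) : [set: rat] a -> [set: rat] c -> [set: rat] (a * c). Proof. by []. Qed.
(** A lift of the y-coordinate modulo q, by which the slice [sl y] induces id (x) (y-coordinate) on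
    classes. The value 0 off the lattice keeps [kap y] in A everywhere. *)
Let kap y (v : M') : Qqpi :=
  if pselect (aset L' v) is left _ then embQ (coord [set: rat] B0' (cls L' v) y) else 0.

Let kapA y v : A_scal (kap y v).
Proof. by rewrite /kap; case: pselect => _; [exact: A_embQ|exact: A_scal0]. Qed.

Let sl y : {linear tensor M M' -> M} := basis_slice hs hs' bQ' (kap y).

Let sl_lattice y (x : tensor M M') : aset LT x -> aset L (sl y x).
Proof. exact: (basis_slice_ltens hs hs' bQ' bA' (kapA y)). Qed.

Let slD y u v : sl y (u + v) = sl y u + sl y v. Proof. exact: linearD. Qed.
Let slZ y a v : sl y (a *: v) = a *: sl y v. Proof. exact: linearZ_LR. Qed.

Let G y (z : lquo LT) : lquo L := cls L (sl y (repr z)).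

Let G_cls y x : G y (cls LT x) = cls L (sl y x).
Proof.
have /clsP[l Ll e] := cls_repr (cls LT x); apply/clsP; exists (sl y l); first exact: sl_lattice.
by rewrite -slZ -e slD -[- x]scaleN1r slZ scaleN1r.
Qed.

Let GD y z w : G y (z + w) = G y z + G y w.
Proof. by rewrite -[z]cls_repr -[w]cls_repr -clsDr !G_cls slD clsDr. Qed.

Let GZ y c z : G y (c *: z) = c *: G y z.
Proof. by rewrite -[z]cls_repr -cls_scale !G_cls slZ cls_scale. Qed.

(** The basis b' of the lattice need not reduce to B0'. The form is set up on b' from the
    B0'-coordinates of its classes, and A-linearity carries the congruence to all of L'. *)
Let basis_form_residue y l' : aset L' l' -> exists2 a, A_scal a &
  basis_form Qq_scal b' (kap y) l' =
  embQ (coord [set: rat] B0' (cls L' l') y) + qq * a.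
Proof.
move=> Ll'.
have [us hu e] := coordP bQ' (x := l') Logic.I.
have /choice[c hc] v : exists c : rat * Qqpi, v \in coord_supp Qq_scal b' l' ->
   A_scal c.2 /\ coord Qq_scal b' l' v = embQ c.1 + qq * c.2.
  have [c [a' [h1 h2]]] := A_scal_residue (coord_lattice v bQ' bA' Ll').
  by exists (c, a').
have Lv v : v \in coord_supp Qq_scal b' l' -> aset L' v.
  by move=> /hu[bv _]; case: bA' => /(_ v bv).
have E (t : seq M') : (forall v, v \in t -> aset L' v /\ (A_scal (c v).2 /\ coord Qq_scal b' l' v = embQ (c v).1 + qq * (c v).2)) ->
  [/\ aset L' (\sum_(v <- t) coord Qq_scal b' l' v *: v) & exists2 a, A_scal a &
    \sum_(v <- t) coord Qq_scal b' l' v * kap y v =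
    embQ (coord [set: rat] B0' (cls L' (\sum_(v <- t) coord Qq_scal b' l' v *: v)) y) + qq * a].
  elim: t => [|v t ih] ht.
    rewrite !big_nil; split; first exact: aset0.
    exists 0; first exact: A_scal0.
    by rewrite cls0 (coord0 QS0 QSB hB') ?rmorph0 ?mulr0 ?addr0 //; exact: Lbar0.
  have [|h1 [a Aa h2]] := ih; first by move=> w wt; apply: ht; rewrite inE wt orbT.
  have [Lw [Aw ew]] := ht v (mem_head _ _).
  have Lcv : aset L' (coord Qq_scal b' l' v *: v).
    by apply: asetZ => //; exact: (coord_lattice v bQ' bA' Ll').
  rewrite !big_cons; split; first exact: asetD.
  exists ((c v).2 * kap y v + a); first by apply: A_scalD => //; exact: A_scalM.
  rewrite clsDr (coordD QS0 QSB hB'); try by [exact: Lbar_cls|rewrite -clsDr; apply: Lbar_cls; exact: asetD].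
  rewrite h2 rmorphD /=.
  have -> : cls L' (coord Qq_scal b' l' v *: v) = (c v).1 *: cls L' v.
    by rewrite ew scalerDl -scalerA clsDr cls_q ?addr0 ?cls_scale //; exact: asetZ.
  rewrite (coordZ QS0 QSB QSM hB') //; try by [exact: Lbar_cls|apply: LbarZ; exact: Lbar_cls].
  have -> : kap y v = embQ (coord [set: rat] B0' (cls L' v) y).
    by rewrite /kap; case: pselect.
  rewrite rmorphM /= ew.
  move: (embQ (c v).1) (embQ _) (embQ _) (c v).2 qq => x1 x2 x3 x4 x5; ring.
have [|_ [a Aa h]] := E (coord_supp Qq_scal b' l').
  by move=> v vs; split; [exact: Lv|exact: hc].
by exists a; rewrite // {1}/basis_form h -e.
Qed.

Let G_qtens y x z : @Lbar _ L x -> @Lbar _ L' z ->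
  G y (qtens x z) = coord [set: rat] B0' z y *: x.
Proof.
move=> [l Ll <-] [l' Ll' <-]; rewrite qtensE // G_cls.
rewrite (basis_sliceE hs hs' bQ'); have [a Aa ->] := basis_form_residue y Ll'.
rewrite scalerDl -scalerA clsDr cls_q ?addr0 ?cls_scale //; exact: asetZ.
Qed.

Let Bx x : B0 x -> @Lbar _ L x. Proof. by case: hB => + _ _; exact. Qed.
Let By y : B0' y -> @Lbar _ L' y. Proof. by case: hB' => + _ _; exact. Qed.

Let xi (v z : lquo LT) : rat :=
  let p := xget (0, 0) [set p | [/\ B0 p.1, B0' p.2 & v = qtens p.1 p.2]] in
  coord [set: rat] B0 (G p.2 z) p.1.

Let xiP v : qtens_set B0 B0' v -> exists x y, [/\ B0 x, B0' y, v = qtens x y &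
  forall z, xi v z = coord [set: rat] B0 (G y z) x].
Proof.
move=> [x [y [bx by' e]]]; pose P := [set p | [/\ B0 p.1, B0' p.2 & v = qtens p.1 p.2]].
have [h1 h2 h3] : P (xget (0, 0) P) by apply: (@xgetI _ (0, 0) P (x, y)).
by exists (xget (0, 0) P).1, (xget (0, 0) P).2.
Qed.

Let xi_qtens x y x1 y1 : B0 x -> B0' y -> B0 x1 -> B0' y1 ->
  coord [set: rat] B0 (G y (qtens x1 y1)) x = ((y1 == y) && (x1 == x))%:R.
Proof.
move=> bx by' bx1 by1; have hx1 := Bx bx1; have hy1 := By by1.
rewrite G_qtens // (coord_delta QS0 QSB hB') // (coordZ QS0 QSB QSM hB) //; last exact: LbarZ.
by rewrite (coord_delta QS0 QSB hB) // -natrM mulnb.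
Qed.

Let xi_lin v (p : seq (lquo LT) * (lquo LT -> rat)) x : qtens_set B0 B0' v ->
  combination [set: rat] (qtens_set B0 B0') p x -> xi v x = \sum_(w <- p.1) p.2 w * xi v w.
Proof.
move=> /xiP[x1 [y [_ _ _ E]]] [_ + ->]; rewrite E; case: p => t c /=.
have GL w : qtens_set B0 B0' w -> @Lbar _ L (G y w).
  by move=> [x2 [y2 [/Bx h1 /By h2 ->]]]; rewrite G_qtens //; exact: LbarZ.
suff H : (forall v0, v0 \in t -> qtens_set B0 B0' v0 /\ [set: rat] (c v0)) ->
   @Lbar _ L (G y (\sum_(w <- t) c w *: w)) /\
   coord [set: rat] B0 (G y (\sum_(w <- t) c w *: w)) x1 = \sum_(w <- t) c w * xi v w.
  by move=> /H[].
have G0 : G y 0 = 0 by rewrite -cls0 G_cls; congr (cls L _); exact: linear0.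
elim: t => [|w t ih] ht.
  by rewrite !big_nil G0 (coord0 QS0 QSB hB x1 (Lbar0 L)); split; first exact: Lbar0.
have [|h1 h2] := ih; first by move=> u ut; apply: ht; rewrite inE ut orbT.
have [hw _] := ht w (mem_head _ _); have Lw := LbarZ (c w) (GL w hw).
rewrite !big_cons GD GZ; split; first exact: LbarD.
rewrite (coordD QS0 QSB hB) // ?h2; last exact: LbarD.
by rewrite (coordZ QS0 QSB QSM hB) // ?E //; exact: GL.
Qed.

Lemma qtens_basis : basis_over [set: rat] (qtens_set B0 B0') (@Lbar _ LT).
Proof.
have BL v : qtens_set B0 B0' v -> @Lbar _ LT v.
  move=> [x [y [/Bx[l Ll <-] /By[l' Ll' <-] ->]]]; rewrite qtensE //.
  by apply: Lbar_cls; exact: ltens_tens.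
apply: (@basis_dual _ _ _ _ _ xi).
- by [].
- move=> z [x Xx <-].
  (* Membership in the lattice is carried along because an A-scalar reduces to a rational one only
     on lattice vectors. *)
  pose P (x : tensor M M') := aset LT x /\ exists p, combination [set: rat] (qtens_set B0 B0') p (cls LT x).
  have P0 : P 0 by split; [exact: aset0|rewrite cls0; exact: combination0].
  have PD u v : P u -> P v -> P (u + v).
    by move=> [h1 h2] [h3 h4]; split; [exact: asetD|rewrite clsDr; exact: combinationD].
  have PZ a u : A_scal a -> P u -> P (a *: u).
    move=> Aa [h1 h2]; split; first exact: asetZ.
    by have [c ->] := cls_A Aa h1; exact: combinationZ.
  suff [] : P x by [].
  apply: (Xx (ASubmod P0 PD PZ)) => _ [l [l' [Ll Ll' ->]]]; split; first exact: ltens_tens.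
  change (exists p, combination [set: rat] (qtens_set B0 B0') p (cls LT (tens l l'))).
  rewrite -qtensE //.
  have [_ /(_ (cls L l)) [/(_ (Lbar_cls Ll))[t [c [_ ht e]]] _] _] := hB.
  have [_ /(_ (cls L' l')) [/(_ (Lbar_cls Ll'))[t' [c' [_ ht' ->]]] _] _] := hB'.
  have [|_ ->] := @qtens_sumr t' c' (cls L l) _ (Lbar_cls Ll); first by move=> v /ht'[/By].
  rewrite big_seq; apply: combination_sum => // v /ht'[bv _]; rewrite e.
  have [|_ ->] := @qtens_suml t c v _ (By bv); first by move=> w /ht[/Bx].
  apply: combinationZ => //; rewrite big_seq; apply: combination_sum => // w /ht[bw _].
  by apply: combination1 => //; exists w, v.
- by move=> p x [_ h ->]; rewrite big_seq; apply: (big_ind (@Lbar _ LT));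
    [exact: Lbar0|exact: LbarD|move=> v /h[bv _]; apply: LbarZ; exact: BL].
- by move=> v p x bv; exact: xi_lin.
- move=> v w /xiP[x [y [bx by' e E]]] [x' [y' [bx' by'' e']]]; rewrite E.
  have [vw|vw] := eqVneq v w; first by rewrite -vw e xi_qtens // !eqxx.
  rewrite e' xi_qtens //; case: andP => // -[/eqP yy /eqP xx].
  by rewrite e e' yy xx eqxx in vw.
by move=> v bv; rewrite (@xi_lin v ([::], fun=> 0)) ?big_nil //; split; rewrite ?big_nil.
Qed.
End TensorResidue.

(** * Strings in crystal lattices *)

Section Strings.
Variables (D : root_data) (M : Udata D) (i : rI D).
Hypothesis HM : in_Oint M.
Local Notation wt := 'Hom(hh D, rat^o).
Implicit Types (mu nu : wt) (m u v : M).

Let HU : is_Umodule M. Proof. by case: HM => -[]. Qed.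

Lemma etilde0 : etilde M i 0 = 0.
Proof. by rewrite -[X in etilde M i X](scale0r 0) etildeZ // scale0r. Qed.
Lemma ftilde0 : ftilde M i 0 = 0.
Proof. by rewrite -[X in ftilde M i X](scale0r 0) ftildeZ // scale0r. Qed.

Lemma kstringS mu c : kstring (M := M) i mu c -> kstring (M := M) i (mu + alpha i) (fun k => c k.+1).
Proof.
move=> hc k; have := hc k.+1; rewrite mulrS addrA => -[h1 h2 h3].
by split=> // h; apply: h3; move: h; move: (ipair _ _) => z; lia.
Qed.

Lemma etilde_string mu n c : Pwt mu -> kstring (M := M) i mu c ->
  etilde M i (\sum_(k < n.+1) divF i k (c k)) = \sum_(k < n) divF i k (c k.+1).
Proof.
move=> hP hc; have g := @kgraph_string D M i (fun k => divF_pred i k) mu n.+1 c hP hc.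
rewrite (etilde_eq HM g) big_ord_recl /= add0r.
by apply: eq_bigr => k _.
Qed.

Lemma ftilde_string mu n c : Pwt mu -> kstring (M := M) i mu c ->
  ftilde M i (\sum_(k < n) divF i k (c k)) = \sum_(k < n) divF i k.+1 (c k).
Proof.
move=> hP hc; have g := @kgraph_string D M i (fun k => divF i k.+1) mu n c hP hc.
exact: (ftilde_eq HM g).
Qed.

Lemma kstring_exists1 mu m : Pwt mu -> wtspace M mu m ->
  exists n c, kstring (M := M) i mu c /\ m = \sum_(k < n.+1) divF i k (c k).
Proof.
move=> hP hm; have [n [c [hc ->]]] := kstring_exists i HM hP hm.
pose c' k := if (k < n)%N then c k else 0.
exists n, c'; split.
  move=> k; rewrite /c'; case: ifP => _; first exact: hc.
  by split=> //; [exact: wtspace_zero|exact: opE0].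
rewrite big_ord_recr /= {2}/c' ltnn divF_zero addr0.
by apply: eq_bigr => k _; rewrite /c' ltn_ord.
Qed.

Lemma etilde_wt mu m : Pwt mu -> wtspace M mu m -> wtspace M (mu + alpha i) (etilde M i m).
Proof.
move=> hP hm; have [n [c [hc ->]]] := kstring_exists1 hP hm.
rewrite (etilde_string n hP hc); apply: wtspace_sum => k _.
have hP' : Pwt (mu + alpha i) by apply: PwtD => //; exact: alpha_Pwt.
exact: (divF_string HM k hP' (kstringS hc)).
Qed.

Lemma etilde_nilp mu m : Pwt mu -> wtspace M mu m -> exists n, iter n (etilde M i) m = 0.
Proof.
move=> hP hm; have [n [c [hc ->]]] := kstring_exists i HM hP hm; exists n.
elim: n mu c hP hc {hm} => [|n ih] mu c hP hc; first by rewrite big_ord0.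
rewrite iterSr (etilde_string n hP hc); have hP' : Pwt (mu + alpha i) by apply: PwtD => //; exact: alpha_Pwt.
exact: (ih _ _ hP' (kstringS hc)).
Qed.

(** f~ e~ m is m without the k = 0 term of its string decomposition, so the difference is that
    term. *)
Lemma head_highest mu m : Pwt mu -> wtspace M mu m ->
  highest i mu (m - ftilde M i (etilde M i m)).
Proof.
move=> hP hm; have [n [c [hc ->]]] := kstring_exists1 hP hm.
have hP' : Pwt (mu + alpha i) by apply: PwtD => //; exact: alpha_Pwt.
rewrite (etilde_string n hP hc) (ftilde_string n hP' (kstringS hc)).
rewrite big_ord_recl /= addrK divF0; have [+ E0 _] := hc 0%N.
by rewrite mulr0n addr0 => hw; split.
Qed.

Lemma homv_divF t mu u n : homv t mu u ->
  homv (t (+) (par i && odd n)) (mu - alpha i *+ n) (divF i n u).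
Proof.
move=> hu; apply: homvZ; elim: n => [|n ih] /=.
  by rewrite andbF addbF mulr0n subr0.
have := homvF HU i ih; rewrite -addrA -opprD -mulrSr.
by congr homv; case: (par i) => /=; rewrite ?andbF ?addbF // addbT -addbN.
Qed.

Lemma ftilde_iter mu u n : highest i mu u -> iter n (ftilde M i) u = divF i n u.
Proof.
move=> hu; elim: n => [|n ih]; first by rewrite divF0.
rewrite iterS ih; have [le|lt] := leP n%:Z (awt i mu); first exact: (ftilde_divF HM hu le).
rewrite (divF_eq0 HM hu lt) ftilde0 (divF_eq0 HM hu) //.
by apply: lt_trans lt _; rewrite ltz_nat.
Qed.

Section Lattice.
Variable L : Asubmod M.
Hypothesis HL : crystal_lattice L.

Lemma lattice_et m : aset L m -> aset L (etilde M i m).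
Proof. by move=> Lm; have [_ _ _ /(_ i m Lm)[]] := HL. Qed.
Lemma lattice_ft m : aset L m -> aset L (ftilde M i m).
Proof. by move=> Lm; have [_ _ _ /(_ i m Lm)[]] := HL. Qed.
Lemma lattice_gr t m : aset L m -> aset L (gr t m).
Proof. by have [_ _ h _] := HL; exact: h. Qed.

Lemma lattice_sub x y : aset L x -> aset L y -> aset L (x - y).
Proof. by move=> Lx Ly; apply: asetD => //; exact: Laset_opp. Qed.

Lemma lattice_divF mu u n : aset L u -> highest i mu u -> aset L (divF i n u).
Proof.
move=> Lu hu; rewrite -(ftilde_iter n hu).
by elim: n => //= n ih; exact: lattice_ft.
Qed.

Lemma lattice_homv_ind (P : M -> Prop) : P 0 -> (forall x y, P x -> P y -> P (x + y)) ->
  (forall t mu m, aset L m -> homv t mu m -> P m) -> forall m, aset L m -> P m.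
Proof.
move=> P0 PD Ph m Lm; have [_ [_ /(_ m Lm)[t [w [_ ht ->]]] _] _ _] := HL.
have [[_ _ hg] _ _ _] := HM.
rewrite big_seq; apply: (big_ind P) => // mu /ht[hP [Lw hw]].
rewrite -(gr_sum HU (w mu)); apply: PD.
  apply: (Ph false mu); first exact: lattice_gr.
  by split; rewrite ?(gr_gr HU) //; exact: hg.
apply: (Ph true mu); first exact: lattice_gr.
by split; rewrite ?(gr_gr HU) //; exact: hg.
Qed.

(** Write m as its k = 0 term plus f~ e~ m. Both lie in the lattice, e~ m is nilpotent of smaller
    order for e~, and f~ preserves sums of divided powers of highest weight vectors. *)
Lemma lattice_string_ind (P : M -> Prop) : P 0 -> (forall x y, P x -> P y -> P (x + y)) ->
  (forall t mu u n, aset L u -> homv t mu u -> opE M i u = 0 -> n%:Z <= awt i mu ->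
     P (divF i n u)) -> forall m, aset L m -> P m.
Proof.
move=> P0 PD Ph.
(* [Q] says that m is a sum of such divided powers. Unlike [P], it can be shown stable under f~. *)
pose Q m := forall P : M -> Prop, P 0 -> (forall x y, P x -> P y -> P (x + y)) ->
  (forall t mu u n, aset L u -> homv t mu u -> opE M i u = 0 -> n%:Z <= awt i mu ->
     P (divF i n u)) -> P m.
have Q0 : Q 0 by [].
have QD x y : Q x -> Q y -> Q (x + y).
  by move=> hx hy P' P0' PD' Ph'; apply: (PD'); [exact: hx|exact: hy].
have Qft m : Q m -> Q (ftilde M i m).
  move=> /(_ (fun x => Q (ftilde M i x))); apply.
  - by rewrite ftilde0.
  - by move=> x y hx hy; rewrite ftildeD //; exact: QD.
  move=> t mu u n Lu hu Eu nu; have [hP hw _] := hu.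
  have hi : highest i mu u by split.
  rewrite (ftilde_divF HM hi nu) => P' P0' PD' Ph'.
  have [le|lt] := leP n.+1%:Z (awt i mu); first exact: Ph' hu Eu le.
  by rewrite (divF_eq0 HM hi).
suff H m : aset L m -> Q m by move=> m /H; apply.
apply: lattice_homv_ind => // {m} _ mu m Lm [hP hw _].
have [n en] := etilde_nilp hP hw.
elim: n mu m Lm hP hw en => [|n ih] mu m Lm hP hw; first by move=> /= ->.
rewrite iterSr => en.
have hP' : Pwt (mu + alpha i) by apply: PwtD => //; exact: alpha_Pwt.
have := ih _ _ (lattice_et Lm) hP' (etilde_wt hP hw) en => /Qft Qe.
rewrite -(subrK (ftilde M i (etilde M i m)) m); apply: QD => //.
have [_ hu Eu] := head_highest hP hw.
have Lu : aset L (m - ftilde M i (etilde M i m)).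
  by apply: lattice_sub => //; apply: lattice_ft; exact: lattice_et.
move: (m - _) hu Eu Lu => u hu Eu Lu P' P0' PD' Ph'.
have [[_ _ hg] _ _ _] := HM.
rewrite -(gr_sum HU u).
(* The zero part is set apart because n = 0 is admissible only for a nonnegative weight, which a
   nonzero vector guarantees. *)
have key t : P' (gr t u).
  have [->//|u0] := eqVneq (gr t u) 0.
  have hi : highest i mu (gr t u).
    by split=> //; [exact: hg|rewrite gr_E // Eu gr0].
  rewrite -(divF0 i (gr t u)); apply: (Ph' t mu); first exact: lattice_gr.
  - by split; rewrite ?(gr_gr HU) ?eqxx //; exact: hg.
  - by case: hi.
  by apply: (highest_ge0 HM hi).
by apply: PD'.
Qed.

End Lattice.
End Strings.

(** * The rank one computation inside the tensor product of two modules *)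

Section TensorOfStrings.
Variables (D : root_data) (M M' : Udata D) (i : rI D).
Hypotheses (HM : in_Oint M) (HM' : in_Oint M').
Local Notation wt := 'Hom(hh D, rat^o).
Local Notation T := (tensU M M').
Variables (t t' : bool) (mu nu : wt) (u : M) (v : M') (m m' : nat).
Hypotheses (hu : homv t mu u) (Eu : opE M i u = 0) (hm : awt i mu = m).
Hypotheses (hv : homv t' nu v) (Ev : opE M' i v = 0) (hm' : awt i nu = m').

Definition tstring (a b : nat) : T := tens (divF i a u) (divF i b v).

Let e := psign (par i && t).

Let HW : is_weight_module M. Proof. by case: HM. Qed.
Let HW' : is_weight_module M'. Proof. by case: HM'. Qed.
Let Pmu : Pwt mu. Proof. by case: hu. Qed.
Let Pnu : Pwt nu. Proof. by case: hv. Qed.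
Let hiu : highest i mu u. Proof. by case: hu => *; split. Qed.
Let hiv : highest i nu v. Proof. by case: hv => *; split. Qed.

Lemma tstring_homv a b : homv (t (+) t' (+) (par i && odd (a + b)))
  (mu + nu + alpha i *~ (- (a + b)%:Z)) (tstring a b).
Proof.
have := thomv HW HW' (homv_divF i HM a hu) (homv_divF i HM' b hv).
rewrite oddD andb_addr addrACA -opprD -mulrnDr mulrNz.
by rewrite addbACA.
Qed.

Let Wx a b : wstring (M := T) i (mu + nu) (- (a + b)%:Z) (tstring a b).
Proof. by have [] := tstring_homv a b. Qed.

Let r0E : awt i (mu + nu) = m%:Z + m'%:Z.
Proof. by rewrite awtD // hm hm'. Qed.

Let x_out a b : (m < a)%N || (m' < b)%N -> tstring a b = 0.
Proof.
rewrite /tstring => /orP[h|h]; first by rewrite (divF_eq0 HM hiu) ?tens0l // hm ltz_nat.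
by rewrite (divF_eq0 HM' hiv) ?tens0r // hm' ltz_nat.
Qed.

Let awt_u a : awt i (mu - alpha i *+ a) = m%:Z - (2 * a)%:Z.
Proof.
by rewrite -[alpha i *+ a]/(alpha i *~ a) -mulrNz awt_string // hm mulrN PoszM.
Qed.

Let awt_v a : awt i (nu - alpha i *+ a) = m'%:Z - (2 * a)%:Z.
Proof.
by rewrite -[alpha i *+ a]/(alpha i *~ a) -mulrNz awt_string // hm' mulrN PoszM.
Qed.

Let sgn a : psign (par i && (t (+) (par i && odd a))) = e * pi_ i ^+ a.
Proof. by rewrite andb_addr andbA andbb psignD pi_psign. Qed.

Let Fx a b : opF T i (tstring a b) =
  qnum (pi_ i) (q_ i) a.+1 *: tstring a.+1 b +
  (e * pi_ i ^+ a * q_ i ^ (m%:Z - (2 * a)%:Z) * qnum (pi_ i) (q_ i) b.+1) *: tstring a b.+1.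
Proof.
rewrite (tF HW i (homv_divF i HM a hu) (homv_divF i HM' b hv)) sgn awt_u.
rewrite qizE !F_divF; congr (_ + _); first exact: tensZl.
by rewrite (tensZr (qnum _ _ b.+1)) scalerA.
Qed.

Let Ex a b : (a <= m)%N -> (b <= m')%N -> opE T i (tstring a b) =
  (pi_ i ^+ a.-1 * qnum (pi_ i) (q_ i) (m%:Z - a%:Z + 1) * q_ i ^ ((2 * b)%:Z - m'%:Z)) *:
    (if a is a'.+1 then tstring a' b else 0) +
  (e * pi_ i ^+ (a + m + b.-1) * qnum (pi_ i) (q_ i) (m'%:Z - b%:Z + 1)) *:
    (if b is b'.+1 then tstring a b' else 0).
Proof.
move=> am bm; rewrite (tE HW i (homv_divF i HM a hu) (homv_divF i HM' b hv)).
rewrite sgn awt_u awt_v opprB; congr (_ + _).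
  case: a am => [|a] am; first by rewrite divF0 Eu tens0l !scaler0.
  rewrite (E_divF HM a hiu) (tensZl (pi_ i ^+ a * _)) scalerA qizE mulrC hm /=.
  by rewrite (_ : m%:Z - a.+1%:Z + 1 = m%:Z - a%:Z) //; lia.
case: b bm => [|b] bm; first by rewrite divF0 Ev tens0r !scaler0.
rewrite (E_divF HM' b hiv) (tensZr (pi_ i ^+ b * _)) scalerA hm' /=.
rewrite (_ : m'%:Z - b.+1%:Z + 1 = m'%:Z - b%:Z); last by lia.
congr (_ *: _); rewrite -!mulrA; congr (_ * _); rewrite !exprD -!mulrA; congr (_ * _).
rewrite PoszM -mulrN pizD piz_2 mulr1 pizE.
by [].
Qed.

Variables (L : Asubmod T) (s : bool).
Hypothesis hs : forall x : T, ppi *: x = (-1) ^+ s *: x.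
Hypothesis Lx : forall a b, aset L (tstring a b).

Let HT : in_Oint T. Proof. exact: tensU_Oint. Qed.
Let PT : Pwt (mu + nu). Proof. exact: PwtD. Qed.

(** The rank one calculus has coefficients in A[pi] while the lattice is an A-module; as pi acts by
    a sign, it is stable under A[pi] as well. *)
Let LZ a x : Api a -> aset L x -> aset L (a *: x).
Proof.
move=> [y [z [ry rz ->]]] Lx'; rewrite scalerDl -scalerA hs.
have Ay : A_scal (emb y) by exists y.
have Az : A_scal (emb z) by exists z.
apply: asetD; first exact: asetZ.
rewrite -signr_odd; case: (odd s); rewrite ?expr0 ?expr1 ?scaleN1r ?scale1r; last exact: asetZ.
by rewrite scalerN; apply: Laset_opp; exact: asetZ.
Qed.

Let hs_k k w : wstring (M := T) i (mu + nu) k w -> opE T i w = 0 ->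
  highest i (mu + nu + alpha i *~ k) w.
Proof. by move=> hw Ew; split=> //; exact: Pwt_string. Qed.

Let ftF k n w : wstring (M := T) i (mu + nu) k w -> opE T i w = 0 ->
  n%:Z <= awt i (mu + nu) + 2 * k ->
  ftilde T i (divpow (pi_ i) (q_ i) (opF T i) n w) = divpow (pi_ i) (q_ i) (opF T i) n.+1 w.
Proof.
move=> hw Ew; rewrite -awt_string // => hn.
by rewrite -!divFE (ftilde_divF HT (hs_k hw Ew) hn).
Qed.

Let etF k n w : wstring (M := T) i (mu + nu) k w -> opE T i w = 0 ->
  n%:Z <= awt i (mu + nu) + 2 * k ->
  etilde T i (divpow (pi_ i) (q_ i) (opF T i) n w) =
  if n is n'.+1 then divpow (pi_ i) (q_ i) (opF T i) n' w else 0.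
Proof.
move=> hw Ew; rewrite -awt_string // => hn.
by rewrite -!divFE (etilde_divF HT (hs_k hw Ew) hn); case: n {hn} => // n; rewrite divFE.
Qed.

Let ee : e * e = 1. Proof. exact: psignK. Qed.
Let Ae : Api e.
Proof. by rewrite /e psignE; apply: (localX qq_local); exact: Api_ppi. Qed.

Local Notation "v =q= w" := (exists2 l, aset L l & v - w = q_ i *: l) (at level 70).

Let W0 := @wstring_zero D T i (mu + nu).
Let WD := @wstringD D T i (mu + nu).
Let WZ := @wstringZ D T i (mu + nu).
Let WE := wstringE (i := i) HT PT.
Let WF := wstringF (i := i) HT PT.
Let WEF := wstringEF (i := i) HT PT.
Let etD := etildeD i HT.
Let etZ := etildeZ i HT.
Let ftD := ftildeD i HT.
Let ftZ := ftildeZ i HT.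
Let LD := @asetD T L.

Lemma tstring_ft a b : aset L (ftilde T i (tstring a b)).
Proof.
refine (xspan_ft (q_local i) (Api_pi i) (pi_mul i) W0 WD WZ WE WF WEF (nilE_M i HT) (nilF_M i HT)
  Ae ee r0E Wx x_out Fx Ex ftD ftZ ftF LD LZ Lx (xspan_x (q_local i) tstring (erefl (a + b)%N))).
Qed.

Lemma tstring_et a b : aset L (etilde T i (tstring a b)).
Proof.
refine (xspan_et (q_local i) (Api_pi i) (pi_mul i) W0 WD WZ WE WF WEF (nilE_M i HT) (nilF_M i HT)
  Ae ee r0E Wx x_out Fx Ex etD etZ etF LD LZ Lx (xspan_x (q_local i) tstring (erefl (a + b)%N))).
Qed.

(** Rank one congruences hold modulo q_i = q^(d_i) with d_i > 0, hence modulo q. *)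
Let q_cls x y : (x =q= y) -> cls L x = cls L y.
Proof.
move=> [l Ll e0]; apply/clsP; exists (qq ^+ (rd i).-1 *: l).
  by apply: LZ => //; exact: Api_X.
by rewrite e0 scalerA -exprS prednK // rd_gt0.
Qed.

Lemma tstring_ft_cls a b : (a <= m)%N -> (b <= m')%N ->
  cls L (ftilde T i (tstring a b)) =
  cls L (if (b < m - a)%N then tstring a.+1 b
         else psign (par i && (t (+) (par i && odd a))) *: tstring a b.+1).
Proof.
move=> am bm; apply: q_cls; rewrite sgn.
exact: (ft_tensor (q_local i) (Api_pi i) (pi_mul i) W0 WD WZ WE WF WEF (nilE_M i HT) (nilF_M i HT)
  Ae ee r0E Wx x_out Fx Ex ftD ftZ ftF LD LZ Lx).
Qed.

Lemma tstring_et_cls a b : (a <= m)%N -> (b <= m')%N ->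
  cls L (etilde T i (tstring a b)) =
  cls L (if (m - a < b)%N then psign (par i && (t (+) (par i && odd a))) *: tstring a b.-1
         else if a is a'.+1 then tstring a' b else 0).
Proof.
move=> am bm; apply: q_cls; rewrite sgn.
exact: (et_tensor (q_local i) (Api_pi i) (pi_mul i) W0 WD WZ WE WF WEF (nilE_M i HT) (nilF_M i HT)
  Ae ee r0E Wx x_out Fx Ex etD etZ etF LD LZ Lx).
Qed.

Lemma tstring_approx a b : (a <= m)%N -> (b <= m')%N -> exists la n w,
  [/\ highest i la w, n%:Z <= awt i la & cls L (tstring a b) = cls L (divF i n w)].
Proof.
move=> am bm; have [k [n [w [hw Ew hn h]]]] :=
  x_approx (q_local i) (Api_pi i) (pi_mul i) W0 WD WZ WE WF WEF (nilE_M i HT) (nilF_M i HT)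
  Ae ee r0E Wx x_out Fx Ex LD LZ Lx am bm.
exists (mu + nu + alpha i *~ k), n, w; split; [exact: hs_k|by rewrite awt_string|].
by rewrite divFE; exact: q_cls.
Qed.
End TensorOfStrings.

(** * Elements of a crystal basis as classes on strings *)

Section CrystalStrings.
Variables (D : root_data) (s : bool) (M : Udata D) (L : Asubmod M).
Hypotheses (HM : in_Oint M) (hs : forall m : M, ppi *: m = (-1) ^+ s *: m).
Local Notation wt := 'Hom(hh D, rat^o).
Implicit Types (i : rI D) (mu nu : wt) (m u v : M) (z : lquo L).

Let HU : is_Umodule M. Proof. by case: HM => -[]. Qed.

Lemma qpiE z : qpi L z = (-1) ^+ s *: z.
Proof.
by rewrite -[in RHS](cls_repr z) -cls_scale rmorphXn rmorphN1 -hs. Qed.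

Lemma qpiK : involutive (qpi L).
Proof. by move=> z; rewrite !qpiE scalerA -expr2 sqrr_sign scale1r. Qed.

Lemma qpi_eq0 z : (qpi L z == 0) = (z == 0).
Proof. by rewrite qpiE scaler_eq0 signr_eq0. Qed.

Lemma psign_cls t m : cls L (psign t *: m) = iter t (qpi L) (cls L m).
Proof.
case: t; rewrite ?psign0 ?scale1r //= qpiE -cls_scale rmorphXn rmorphN1 -hs.
by rewrite psignE.
Qed.

Lemma pi_closed_neq0 (B0 : set (lquo L)) b : basis_over [set: rat] B0 (@Lbar _ L) ->
  (B0 `|` qpi L @` B0) b -> b != 0.
Proof.
move=> [_ _ ind]; have nz b0 : B0 b0 -> b0 != 0.
  move=> Bb; apply: contraTneq isT => e.
  have h x : x \in [:: b0] -> B0 x /\ [set: rat] 1 by rewrite inE => /eqP ->.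
  have z0 : \sum_(x <- [:: b0]) 1 *: x = 0 by rewrite big_seq1 e scaler0.
  have /eqP := ind [:: b0] (fun=> 1) isT h z0 b0 (mem_head _ _).
  by rewrite oner_eq0.
by move=> [/nz//|[b0 /nz + <-]]; rewrite qpi_eq0.
Qed.

Lemma pi_basis_neq0 (B : set (lquo L)) b : graded_pi_basis B -> B b -> b != 0.
Proof. by move=> [[B0 [h _ sub]] _ _] /sub; exact: pi_closed_neq0. Qed.

Section LatticeStrings.
Hypothesis HL : crystal_lattice L.

Lemma qetilde_cls i m : qetilde L i (cls L m) = cls L (etilde M i m).
Proof.
apply: lqopE; first exact: etildeD.
by move=> l Ll; exists (etilde M i l); [exact: lattice_et|rewrite etildeZ].
Qed.

Lemma qftilde_cls i m : qftilde L i (cls L m) = cls L (ftilde M i m).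
Proof.
apply: lqopE; first exact: ftildeD.
by move=> l Ll; exists (ftilde M i l); [exact: lattice_ft|rewrite ftildeZ].
Qed.

Lemma gr_cls t m m1 : cls L m = cls L m1 -> cls L (gr t m) = cls L (gr t m1).
Proof.
move=> /clsP[l Ll e]; apply/clsP; exists (gr t l); first exact: lattice_gr.
by rewrite -grZ -e grD -[- m1]scaleN1r grZ scaleN1r.
Qed.

Lemma parityE t z : hom_part t z -> z != 0 -> parity z = t.
Proof.
move=> [m [Lm gm] <-] z0; apply/asboolP; case: t gm => gm; first by exists m.
move=> [m1 [Lm1 gm1] e]; move/eqP: z0; apply.
have := gr_cls false e; rewrite gm -gm1 (gr_gr HU) /= => <-.
exact: cls0.
Qed.

Section OneString.
Variables (i : rI D) (mu : wt) (u : M).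
Hypotheses (Lu : aset L u) (hu : highest i mu u) (u0 : cls L u != 0).

Lemma awt_nonneg : 0 <= awt i mu.
Proof. by apply: (highest_ge0 HM hu); apply: contra_neq u0 => ->; exact: cls0. Qed.

Lemma qetilde_divF n : n%:Z <= awt i mu -> qetilde L i (cls L (divF i n u)) =
  if n is n'.+1 then cls L (divF i n' u) else 0.
Proof.
by move=> hn; rewrite qetilde_cls (etilde_divF HM hu hn); case: n {hn}.
Qed.

Lemma qftilde_divF n : n%:Z <= awt i mu -> qftilde L i (cls L (divF i n u)) =
  cls L (divF i n.+1 u).
Proof. by move=> hn; rewrite qftilde_cls (ftilde_divF HM hu hn). Qed.

Lemma cls_divF_neq0 n : n%:Z <= awt i mu -> cls L (divF i n u) != 0.
Proof.
elim: n => [|n ih] hn; first by rewrite divF0.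
have hn' : n%:Z <= awt i mu by apply: le_trans hn; rewrite lez_nat.
apply: contra (ih hn') => /eqP e.
have := qetilde_divF hn; rewrite e -cls0 qetilde_cls etilde0 // => <-.
by rewrite cls0.
Qed.

Lemma iter_qetilde_divF n k : n%:Z <= awt i mu ->
  iter k (qetilde L i) (cls L (divF i n u)) = if (k <= n)%N then cls L (divF i (n - k) u) else 0.
Proof.
move=> hn; elim: k => [|k ih]; first by rewrite subn0.
rewrite iterS ih; case: (ltngtP k n) => kn.
- rewrite qetilde_divF; last by apply: le_trans hn; rewrite lez_nat leq_subr.
  by rewrite subnS; case e: (n - k)%N => //; lia.
- rewrite -cls0 qetilde_cls etilde0 // cls0.
- by rewrite kn subnn qetilde_divF ?awt_nonneg.
Qed.

Lemma iter_qftilde_divF n k : n%:Z <= awt i mu ->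
  iter k (qftilde L i) (cls L (divF i n u)) = cls L (divF i (n + k) u).
Proof.
move=> hn; elim: k => [|k ih]; first by rewrite addn0.
rewrite iterS ih addnS; have [le|lt] := leP (n + k)%:Z (awt i mu); first exact: qftilde_divF.
rewrite (divF_eq0 HM hu lt) qftilde_cls ftilde0 // (divF_eq0 HM hu) //.
by apply: lt_trans lt _; rewrite ltz_nat.
Qed.

Let xget_max (P : nat -> Prop) n : P n -> (forall k, P k -> (k <= n)%N) ->
  xget 0%N [set n | P n /\ forall k, P k -> (k <= n)%N] = n.
Proof.
move=> Pn hn.
have [Pg hg] : [set n | P n /\ forall k, P k -> (k <= n)%N]
  (xget 0%N [set n | P n /\ forall k, P k -> (k <= n)%N]).
  by apply: (@xgetI _ 0%N _ n); split.
by apply/eqP; rewrite eqn_leq hn //= hg.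
Qed.

Lemma epsilon_divF n : n%:Z <= awt i mu -> epsilon i (cls L (divF i n u)) = n.
Proof.
move=> hn; apply: (@xget_max (fun n0 => iter n0 (qetilde L i) (cls L (divF i n u)) != 0)).
  by rewrite iter_qetilde_divF // leqnn subnn divF0.
by move=> k; rewrite iter_qetilde_divF //; case: ifP => //; rewrite eqxx.
Qed.

Lemma phi_divF n (m : nat) : awt i mu = m%:Z -> (n <= m)%N -> phi i (cls L (divF i n u)) = (m - n)%N.
Proof.
move=> hm nm; have hn : n%:Z <= awt i mu by rewrite hm lez_nat.
apply: (@xget_max (fun n0 => iter n0 (qftilde L i) (cls L (divF i n u)) != 0)).
  by rewrite iter_qftilde_divF // subnKC // cls_divF_neq0 // hm.
move=> k; rewrite iter_qftilde_divF // => h; rewrite leqNgt; apply: contra h => h.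
by rewrite (divF_eq0 HM hu) ?cls0 // hm ltz_nat; lia.
Qed.
End OneString.

Section CrystalBasis.
Variable B : set (lquo L).
Hypotheses (HB : graded_pi_basis B) (HO : crystal_operators B).

(** Induction on the nilpotency of e~ on a weight vector representing b. If e~ b lies in B, then b =
    f~ e~ b, and a representation of e~ b as the class of F^(n) u gives one of b with n + 1. If e~ b
    = 0, then b itself is the class of a highest weight vector. *)
Lemma crystal_string i b : B b -> exists t mu u (n m : nat),
  [/\ aset L u, homv t mu u, opE M i u = 0, cls L u != 0 &
      [/\ awt i mu = m%:Z, (n <= m)%N & b = cls L (divF i n u)]].
Proof.
move=> Bb; have [_ hwt hhom] := HB.
have [mu [[hP [m [Lm hm] e]] _]] := hwt b Bb.
have [N eN] := etilde_nilp i HM hP hm.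
suff [t [la [u [n [Lu hu Eu [u0 e']]]]]] : exists t la u n,
   [/\ aset L u, homv t la u, opE M i u = 0 & cls L u != 0 /\ b = cls L (divF i n u)].
  have [hPl hwl _] := hu; have hi : highest i la u by split.
  have := awt_nonneg hi u0; case el: (awt i la) => [k|//] _.
  exists t, la, u, n, k; split=> //; split=> //.
  rewrite leqNgt; apply/negP => lt; have := pi_basis_neq0 HB Bb.
  by rewrite e' (divF_eq0 HM hi) ?cls0 ?eqxx // el ltz_nat.
elim: N b Bb mu m hP Lm hm e eN => [|N ih] b Bb mu m hP Lm hm e eN.
  by have := pi_basis_neq0 HB Bb; rewrite -e -[m]/(iter 0 (etilde M i) m) eN cls0 eqxx.
have e1 : qetilde L i b = cls L (etilde M i m) by rewrite -e qetilde_cls.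
have [HO1 HO2] := HO; have [[Be|e0] _] := HO1 i b Bb.
  have hP' : Pwt (mu + alpha i) by apply: PwtD => //; exact: alpha_Pwt.
  rewrite iterSr in eN.
  have [t [la [u [n [Lu hu Eu [u0 e']]]]]] := ih _ Be _ _ hP'
      (lattice_et i HL Lm) (etilde_wt i HM hP hm) (esym e1) eN.
  exists t, la, u, n.+1; split=> //; split=> //.
  have [hPl hwl _] := hu; have hi : highest i la u by split.
  have /(HO2 i b _ Bb Be) -> := erefl (qetilde L i b).
  by rewrite e' -(ftilde_iter HM n.+1 hi) iterS -(ftilde_iter HM n hi) qftilde_cls.
(* Now e~ m lies in qL, so m and its highest weight part m - f~ e~ m have the same class. *)
move: e1; rewrite e0 -cls0 => /esym/clsP[l Ll]; rewrite subr0 => el.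
have [t ht] := hhom b Bb; have {ht} [m2 [Lm2 gm2] e2] := ht.
have [_ hu Eu] := head_highest i HM hP hm.
set u := m - _ in hu Eu.
have eu : cls L u = b.
  rewrite -e; apply/clsP; exists (- ftilde M i l); first by apply: Laset_opp; exact: lattice_ft.
  by rewrite /u addrC addKr el ftildeZ // scalerN.
have Lu : aset L u.
  by apply: lattice_sub => //; rewrite el ftildeZ //; apply: aset_qq; exact: lattice_ft.
(* Since b also has a homogeneous representative, projecting u to that parity does not change its
   class. *)
have eg : cls L (gr t u) = b by rewrite -e2 -gm2; apply: gr_cls; rewrite eu e2.
have [[_ _ hg] _ _ _] := HM.
exists t, mu, (gr t u), 0%N; split.
- exact: lattice_gr.
- by split; rewrite ?(gr_gr HU) ?eqxx //; exact: hg.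
- by rewrite gr_E // Eu gr0.
split; last by rewrite divF0 eg.
by rewrite eg; exact: (pi_basis_neq0 HB Bb).
Qed.
End CrystalBasis.
End LatticeStrings.
End CrystalStrings.

(** * The tensor product of two crystals *)

Section TensorCrystal.
Variables (D : root_data) (s : bool) (M M' : Udata D) (L : Asubmod M) (L' : Asubmod M').
Variables (B : set (lquo L)) (B' : set (lquo L')).
Hypotheses (OM : in_Oint_pm s M) (OM' : in_Oint_pm s M').
Hypotheses (cB : crystal_basis L B) (cB' : crystal_basis L' B').
Local Notation wt := 'Hom(hh D, rat^o).
Local Notation T := (tensU M M').
Local Notation LT := (ltens L L').
Local Notation BB := (qtens_set B B').
Implicit Types (i : rI D) (mu nu : wt).

Let HM : in_Oint M. Proof. by case: OM. Qed.
Let HM' : in_Oint M'. Proof. by case: OM'. Qed.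
Let hs : forall m : M, ppi *: m = (-1) ^+ s *: m. Proof. by case: OM. Qed.
Let hs' : forall m : M', ppi *: m = (-1) ^+ s *: m. Proof. by case: OM'. Qed.
Let OT : in_Oint_pm s T. Proof. exact: tensU_Oint_pm. Qed.
Let HT : in_Oint T. Proof. by case: OT. Qed.
Let hsT : forall x : T, ppi *: x = (-1) ^+ s *: x. Proof. by case: OT. Qed.
Let HW : is_weight_module M. Proof. by case: HM. Qed.
Let HW' : is_weight_module M'. Proof. by case: HM'. Qed.
Let HL : crystal_lattice L. Proof. by case: cB. Qed.
Let HL' : crystal_lattice L'. Proof. by case: cB'. Qed.
Let HB : graded_pi_basis B. Proof. by case: cB. Qed.
Let HB' : graded_pi_basis B'. Proof. by case: cB'. Qed.
Let HO : crystal_operators B. Proof. by case: cB. Qed.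
Let HO' : crystal_operators B'. Proof. by case: cB'. Qed.

Lemma ltens_ind (P : T -> Prop) : P 0 -> (forall x y, P x -> P y -> P (x + y)) ->
  (forall a x, A_scal a -> P x -> P (a *: x)) ->
  (forall l l', aset L l -> aset L' l' -> P (tens l l')) -> forall x, aset LT x -> P x.
Proof.
move=> P0 PD PZ Pt x /(_ (ASubmod P0 PD PZ)); apply=> _ [l [l' [Ll Ll' ->]]].
exact: Pt.
Qed.

Lemma ltens_homv_ind (P : T -> Prop) : P 0 -> (forall x y, P x -> P y -> P (x + y)) ->
  (forall a x, A_scal a -> P x -> P (a *: x)) ->
  (forall t mu l t' nu l', aset L l -> homv t mu l -> aset L' l' -> homv t' nu l' ->
     P (tens l l')) -> forall x, aset LT x -> P x.
Proof.
move=> P0 PD PZ Pt; apply: ltens_ind => // l l' Ll Ll'.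
move: l Ll; apply: (lattice_homv_ind HM HL); first by rewrite tens0l.
  by move=> x y hx hy; rewrite tensDl; exact: PD.
move=> t mu l Ll hl.
move: l' Ll'; apply: (lattice_homv_ind HM' HL'); first by rewrite tens0r.
  by move=> x y hx hy; rewrite tensDr; exact: PD.
by move=> t' nu l' Ll' hl'; exact: Pt Ll hl Ll' hl'.
Qed.

Lemma tstring_ltens i mu nu u v a b : aset L u -> highest i mu u -> aset L' v ->
  highest i nu v -> aset LT (tstring i u v a b).
Proof.
move=> Lu hu Lv hv; apply: ltens_tens.
  exact: (lattice_divF HM HL a Lu hu).
exact: (lattice_divF HM' HL' b Lv hv).
Qed.

Lemma ltens_ops i x : aset LT x -> aset LT (etilde T i x) /\ aset LT (ftilde T i x).
Proof.
move: x; apply: ltens_ind.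
- by rewrite etilde0 // ftilde0 //; split; exact: aset0.
- by move=> x y [h1 h2] [h3 h4]; rewrite etildeD // ftildeD //; split; exact: asetD.
- by move=> a x Aa [h1 h2]; rewrite etildeZ // ftildeZ //; split; exact: asetZ.
move=> l l' Ll Ll'; move: l Ll; apply: (lattice_string_ind (i := i) HM HL).
- by rewrite tens0l etilde0 // ftilde0 //; split; exact: aset0.
- by move=> x y [h1 h2] [h3 h4]; rewrite tensDl etildeD // ftildeD //; split; exact: asetD.
move=> t mu u a Lu hu Eu hn; move: l' Ll'; apply: (lattice_string_ind (i := i) HM' HL').
- by rewrite tens0r etilde0 // ftilde0 //; split; exact: aset0.
- by move=> x y [h1 h2] [h3 h4]; rewrite tensDr etildeD // ftildeD //; split; exact: asetD.
move=> t' nu v b Lv hv Ev hn'.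
have [m em] : exists m : nat, awt i mu = m by move: hn; case: (awt i mu) => // m _; exists m.
have [m' em'] : exists m : nat, awt i nu = m by move: hn'; case: (awt i nu) => // m' _; exists m'.
have hi : highest i mu u by case: hu => *; split.
have hi' : highest i nu v by case: hv => *; split.
have Lx a' b' : aset LT (tstring i u v a' b') by exact: tstring_ltens Lu hi Lv hi'.
split; first exact: (tstring_et HM HM' hu Eu em hv Ev em' hsT Lx).
exact: (tstring_ft HM HM' hu Eu em hv Ev em' hsT Lx).
Qed.

Lemma ltens_crystal_lattice : crystal_lattice LT.
Proof.
have [[b [bA bQ]] _ _ _] := HL; have [[b' [bA' bQ']] _ _ _] := HL'.
split.
- exists (tensor_basis b b'); split; last exact: (tensor_basis_Qq hs hs' bQ bQ').
  exact: (tensor_basis_A hs hs' bQ bA bQ' bA').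
- split=> [mu _ x []//|x Lx|t w ut ht]; last first.
    by apply: wtspace_indep => // mu /ht[hP [_ hw]].
  move: x Lx; apply: ltens_homv_ind.
  + by exists [::], (fun=> 0); rewrite big_nil.
  + move=> x y; apply: (@decomp_add _ _ (@Pwt D) (fun mu => aset LT `&` wtspace T mu)) => mu;
      first by split; [exact: aset0|exact: wtspace_zero].
    by move=> x1 y1 [h1 h2] [h3 h4]; split; [exact: asetD|exact: wtspaceD].
  + move=> a x Aa [t [w [ut ht ->]]]; exists t, (fun mu => a *: w mu); split=> //.
      move=> mu /ht[hP [Lw hw]]; split=> //; split; [exact: asetZ|exact: wtspaceZ].
    exact: scaler_sumr.
  + move=> t mu l t' nu l' Ll hl Ll' hl'; have [hP hw _] := thomv HW HW' hl hl'.
    exists [:: mu + nu], (fun=> tens l l'); split=> //; last by rewrite big_seq1.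
    move=> la; rewrite inE => /eqP ->; split=> //; split=> //; exact: ltens_tens.
- move=> t; apply: ltens_homv_ind.
  + by rewrite gr0; exact: aset0.
  + by move=> x y hx hy; rewrite grD; exact: asetD.
  + by move=> a x Aa hx; rewrite grZ; exact: asetZ.
  + move=> t1 mu l t' nu l' Ll hl Ll' hl'; rewrite (tgr HW HW' t hl hl').
    by case: eqP => _; [exact: ltens_tens|exact: aset0].
by move=> i x; exact: ltens_ops.
Qed.

Let HLT := ltens_crystal_lattice.

Let BL b : B b -> @Lbar _ L b.
Proof.
(* An index is needed to write b as the class of a vector on a string, which lies in the lattice. *)
have [i _] := par_nonempty D.
move=> /(crystal_string HM hs HL HB HO i)[t [mu [u [n [m [Lu hu Eu _ [_ _ ->]]]]]]].
apply: Lbar_cls; apply: (lattice_divF (i := i) HM HL n Lu (mu := mu)).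
by case: hu => *; split.
Qed.

Let BL' b : B' b -> @Lbar _ L' b.
Proof.
have [i _] := par_nonempty D.
move=> /(crystal_string HM' hs' HL' HB' HO' i)[t [mu [u [n [m [Lu hu Eu _ [_ _ ->]]]]]]].
apply: Lbar_cls; apply: (lattice_divF (i := i) HM' HL' n Lu (mu := mu)).
by case: hu => *; split.
Qed.

Lemma qtens_qpil b b' : @Lbar _ L b -> @Lbar _ L' b' -> qtens (qpi L b) b' = qpi LT (qtens b b').
Proof. by move=> hb hb'; rewrite (qpiE hs) (qpiE hsT) qtensZl. Qed.

Lemma qtens_qpir b b' : @Lbar _ L b -> @Lbar _ L' b' -> qtens b (qpi L' b') = qpi LT (qtens b b').
Proof. by move=> hb hb'; rewrite (qpiE hs') (qpiE hsT) qtensZr. Qed.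

(** With b the class of F^(n) u and b' that of F^(c) v, phi_i(b) = m - n and epsilon_i(b') = c are
    the numbers compared in the rank one rule, and p(b) is the parity of F^(n) u. The last two
    components serve the exchange of e~ and f~ and the gradings. *)
Lemma qtens_crystal_formula i b b' : B b -> B' b' ->
  [/\ qftilde LT i (qtens b b') =
        (if (epsilon i b' < phi i b)%N then qtens (qftilde L i b) b'
         else iter (par i * parity b) (qpi LT) (qtens b (qftilde L' i b'))),
      qetilde LT i (qtens b b') =
        (if (phi i b < epsilon i b')%N
         then iter (par i * parity b) (qpi LT) (qtens b (qetilde L' i b'))
         else qtens (qetilde L i b) b'),
      exists la n w, [/\ highest i la w, n%:Z <= awt i la & qtens b b' = cls LT (divF i n w)]
    & exists t mu x, [/\ aset LT x, homv t mu x & qtens b b' = cls LT x]].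
Proof.
move=> Bb Bb'.
have [t [mu [u [n [m [Lu hu Eu u0 [em nm eb]]]]]]] := crystal_string HM hs HL HB HO i Bb.
have [t' [nu [v [c [m' [Lv hv Ev v0 [em' cm eb']]]]]]] := crystal_string HM' hs' HL' HB' HO' i Bb'.
have hi : highest i mu u by case: hu => *; split.
have hi' : highest i nu v by case: hv => *; split.
have Lx a' b1 : aset LT (tstring i u v a' b1) by exact: tstring_ltens Lu hi Lv hi'.
have hn : n%:Z <= awt i mu by rewrite em lez_nat.
have hc : c%:Z <= awt i nu by rewrite em' lez_nat.
have LF k : aset L (divF i k u) by exact: (lattice_divF HM HL k Lu hi).
have LF' k : aset L' (divF i k v) by exact: (lattice_divF HM' HL' k Lv hi').
have qx k l : qtens (cls L (divF i k u)) (cls L' (divF i l v)) = cls LT (tstring i u v k l).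
  exact: qtensE.
have pb : parity b = t (+) (par i && odd n).
  apply: (parityE HM HL); last exact: (pi_basis_neq0 hs HB).
  by rewrite eb; exists (divF i n u); split=> //; have [_ _ g] := homv_divF i HM n hu.
have ph : phi i b = (m - n)%N by rewrite eb; exact: (phi_divF HM HL hi u0 em nm).
have ep : epsilon i b' = c by rewrite eb'; exact: (epsilon_divF HM' HL' hi' v0 hc).
have it z : iter (par i * parity b) (qpi LT) (cls LT z) =
    cls LT (psign (par i && (t (+) (par i && odd n))) *: z).
  by rewrite (psign_cls LT hsT) pb mulnb.
have ebb : qtens b b' = cls LT (tstring i u v n c) by rewrite eb eb' qx.
split.
- rewrite ebb (qftilde_cls HT HLT) (tstring_ft_cls HM HM' hu Eu em hv Ev em' hsT Lx nm cm).
  rewrite ph ep; case: ifP => _.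
    by rewrite eb (qftilde_divF HM HL hi hn) eb' qx.
  by rewrite eb' (qftilde_divF HM' HL' hi' hc) {2}eb qx it.
- rewrite ebb (qetilde_cls HT HLT) (tstring_et_cls HM HM' hu Eu em hv Ev em' hsT Lx nm cm).
  rewrite ph ep; case: ifP => mc.
    rewrite eb' (qetilde_divF HM' HL' hi' hc) {2}eb.
    by case: c mc {hc cm eb' ep ebb} => // c _; rewrite qx it.
  rewrite eb (qetilde_divF HM HL hi hn) eb'.
  case: n {hn nm eb pb ph it ebb mc} => [|n]; last by rewrite qx.
  by rewrite cls0 -cls0 qtensE ?tens0l //; exact: aset0.
- have [la [k [w [hw kw e]]]] := tstring_approx HM HM' hu Eu em hv Ev em' hsT Lx nm cm.
  by exists la, k, w; rewrite ebb.
have h := tstring_homv i HM HM' hu hv n c.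
by do 2!eexists; exists (tstring i u v n c); split; [|exact: h|].
Qed.

Lemma qtens_graded_pi_basis : graded_pi_basis BB.
Proof.
have [[b [bA bQ]] _ _ _] := HL; have [[b' [bA' bQ']] _ _ _] := HL'.
have [[B0 [hB0 sB0 sB]] _ _] := HB; have [[B0' [hB0' sB0' sB']] _ _] := HB'.
have [i _] := par_nonempty D.
have hT := qtens_basis hs hs' bQ' bA' hB0 hB0'.
have sub : BB `<=` qtens_set B0 B0' `|` qpi LT @` qtens_set B0 B0'.
  move=> _ [x [y [Bx By ->]]].
  have key x0 y0 : B0 x0 -> B0' y0 -> qtens_set B0 B0' (qtens x0 y0) by exists x0, y0.
  case: (sB x Bx) => [hx|[x0 hx <-]]; case: (sB' y By) => [hy|[y0 hy <-]].
  + by left; exact: key.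
  + by right; exists (qtens x y0); [exact: key|rewrite qtens_qpir //; [exact: BL|apply: BL'; exact: sB0']].
  + by right; exists (qtens x0 y); [exact: key|rewrite qtens_qpil //; [apply: BL; exact: sB0|exact: BL']].
  + left; have h0 : @Lbar _ L x0 by apply: BL; exact: sB0.
    have h0' : @Lbar _ L' y0 by apply: BL'; exact: sB0'.
    have h1 : @Lbar _ L' (qpi L' y0) by rewrite (qpiE hs'); exact: LbarZ.
    by rewrite qtens_qpil // qtens_qpir // (qpiK hsT); exact: key.
split.
- exists (qtens_set B0 B0'); split=> //.
  by move=> _ [x [y [/sB0 hx /sB0' hy ->]]]; exists x, y.
- move=> _ [x [y [Bx By ->]]].
  have [_ _ _ [t [mu [z [Lz [hP hz _] ez]]]]] := qtens_crystal_formula i Bx By.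
  exists mu; split; first by split=> //; exists z.
  (* Suppose the class also had a representative z' of another weight nu. Then z - z' = q l with l
     in the lattice, and the components of weight mu give z = q l1 with l1 in the lattice,
     contradicting that the class is nonzero. *)
  move=> nu [hP' [z' [Lz' hz'] ez']]; apply: contrapT => mn.
  have nz : qtens x y != 0 by apply: (pi_closed_neq0 hsT hT); apply: sub; exists x, y.
  have := ez'; rewrite ez => /esym/clsP[l Ll el].
  have [_ [_ /(_ l Ll)[la [w [ul hl e]]] _] _ _] := HLT.
  have WD k x1 y1 : wtspace T k x1 -> wtspace T k y1 -> wtspace T k (x1 + y1).
    exact: wtspaceD.
  pose J := [set k | Pwt k /\ k <> mu].
  have [l1 [l2 [Ll1 hl1 d2 e12]]] : exists l1 l2, [/\ aset LT l1, wtspace T mu l1,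
      decomposable J (wtspace T) (qq *: l2) & l = l1 + l2].
    exists (if mu \in la then w mu else 0), (\sum_(k <- la | k != mu) w k).
    split.
    - by case: ifP => [/hl[_ []]//|_]; exact: aset0.
    - by case: ifP => [/hl[_ []]//|_]; exact: wtspace_zero.
    - exists [seq k <- la | k != mu], (fun k => qq *: w k); split; first exact: filter_uniq.
        move=> k; rewrite mem_filter => /andP[/eqP km /hl[hk [_ hwk]]].
        by split; [split|exact: wtspaceZ].
      by rewrite scaler_sumr big_filter.
    rewrite e; case: ifP => mla; first by rewrite (bigD1_seq mu).
    rewrite add0r [RHS]big_mkcond /= big_seq [RHS]big_seq; apply: eq_bigr => k kla.
    by case: eqP => // km; rewrite km mla in kla.
  have dz' : decomposable J (wtspace T) z'.
    exists [:: nu], (fun=> z'); split=> //; last by rewrite big_seq1.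
    by move=> k; rewrite inE => /eqP ->; split=> //; split=> // /esym.
  have [r [f [ur hr er]]] := decomp_add (@wtspace_zero D T) WD dz' d2.
  pose g k := if k == mu then qq *: l1 - z else f k.
  have mr : mu \notin r by apply/negP => /hr[[_]].
  have z0 : g mu = 0.
    apply: (@wtspace_indep D T (mu :: r) g); rewrite /= ?mr ?mem_head //.
      move=> k; rewrite inE /g; case: eqP => [-> _|_ /= /hr[[] //]].
      by split=> //; rewrite -scaleN1r; apply: wtspaceD; exact: wtspaceZ.
    rewrite big_cons {1}/g eqxx.
    have -> : \sum_(k <- r) g k = z' + qq *: l2.
      rewrite er big_seq [RHS]big_seq; apply: eq_bigr => k kr.
      by rewrite /g; case: eqP => // km; rewrite km (negbTE mr) in kr.
    have -> (a1 a2 a3 a4 : T) : a1 - a2 + (a3 + a4) = a1 + a4 - (a2 - a3).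
      by rewrite opprB [a3 + _]addrC addrACA [- a2 + _]addrC.
    by rewrite el -scalerDr -e12 subrr.
  move/eqP: nz; apply; rewrite ez; change (cls LT z = cls LT 0); apply/clsP; exists l1 => //.
  by rewrite subr0; apply/eqP; rewrite eq_sym -subr_eq0; apply/eqP; rewrite -z0 /g eqxx.
move=> _ [x [y [Bx By ->]]].
have [_ _ _ [t [mu [z [Lz [hP hz gz] ez]]]]] := qtens_crystal_formula i Bx By.
by exists t, z.
Qed.

Let PC := pi_closure BB.

Let PC_string i z : PC z -> exists la n w,
  [/\ highest i la w, n%:Z <= awt i la & z = cls LT (divF i n w)].
Proof.
have hB x : BB x -> exists la n w,
    [/\ highest i la w, n%:Z <= awt i la & x = cls LT (divF i n w)].
  by move=> [b [b' [Bb Bb' ->]]]; have [_ _] := qtens_crystal_formula i Bb Bb'.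
move=> [/hB//|[x /hB[la [n [w [[hP hw Ew] hn ->]]]] <-]].
exists la, n, (psign true *: w); split=> //.
  by split; [|exact: wtspaceZ|rewrite opEZ Ew scaler0].
by rewrite divFZ (psign_cls LT hsT).
Qed.

Let PC_neq0 z : PC z -> z != 0.
Proof.
have hB := pi_basis_neq0 hsT qtens_graded_pi_basis.
by move=> [/hB//|[x /hB + <-]]; rewrite (qpi_eq0 hsT).
Qed.

Let PC_qpi z : PC z -> PC (qpi LT z).
Proof.
by move=> [hz|[x hx <-]]; [right; exists z|left; rewrite (qpiK hsT)].
Qed.

Let PC0_iter k z : (PC `|` [set 0]) z -> (PC `|` [set 0]) (iter k (qpi LT) z).
Proof.
move=> hz; elim: k => //= k [/PC_qpi|/= ->]; first by left.
by right; rewrite /= (qpiE hsT) scaler0.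
Qed.

(** The exchange property is read off from strings: every element of the closure is the class of
    some F^(n) w, on which e~ and f~ shift n by one, and nonzero classes keep n within the
    string. *)
Lemma qtens_crystal_operators : crystal_operators (pi_closure BB).
Proof.
have [HO1 _] := HO; have [HO1' _] := HO'.
have q0l b' : B' b' -> qtens (0 : lquo L) b' = 0.
  by move=> /BL' h; rewrite -(scale0r 0) qtensZl ?scale0r //; exact: Lbar0.
have q0r b : B b -> qtens b (0 : lquo L') = 0.
  by move=> /BL h; rewrite -(scale0r 0) qtensZr ?scale0r //; exact: Lbar0.
have inl b b' : (B `|` [set 0]) b -> B' b' -> (PC `|` [set 0]) (qtens b b').
  by move=> [Bb|->] Bb'; [left; left; exists b, b'|right; exact: q0l].
have inr b b' : B b -> (B' `|` [set 0]) b' -> (PC `|` [set 0]) (qtens b b').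
  by move=> Bb [Bb'|->]; [left; left; exists b, b'|right; exact: q0r].
split=> i z.
- have hB x : BB x -> (PC `|` [set 0]) (qetilde LT i x) /\ (PC `|` [set 0]) (qftilde LT i x).
    move=> [b [b' [Bb Bb' ->]]]; have [-> -> _ _] := qtens_crystal_formula i Bb Bb'.
    have [h1 h2] := HO1 i b Bb; have [h3 h4] := HO1' i b' Bb'.
    by split; case: ifP => _; do ?[exact: inl|apply: PC0_iter; exact: inr].
  move=> [/hB//|[x /hB[h1 h2] <-]].
  have e1 : qetilde LT i (qpi LT x) = qpi LT (qetilde LT i x).
    rewrite -[x]cls_repr -[qpi LT (cls LT _)](psign_cls LT hsT true).
    by rewrite !(qetilde_cls HT HLT) etildeZ // (psign_cls LT hsT true).
  have e2 : qftilde LT i (qpi LT x) = qpi LT (qftilde LT i x).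
    rewrite -[x]cls_repr -[qpi LT (cls LT _)](psign_cls LT hsT true).
    by rewrite !(qftilde_cls HT HLT) ftildeZ // (psign_cls LT hsT true).
  by rewrite e1 e2; split; [exact: (PC0_iter 1)|exact: (PC0_iter 1)].
move=> z' hz hz'; split=> e.
  have [la [n [w [hw hn ez]]]] := PC_string i hz.
  have := PC_neq0 hz'; rewrite -e ez (qetilde_cls HT HLT) (etilde_divF HT hw hn).
  case: n hn {ez} => [|n] hn; first by rewrite cls0 eqxx.
  by move=> _; rewrite (qftilde_cls HT HLT) (ftilde_divF HT hw) //; apply: le_trans hn; rewrite lez_nat.
have [la [n [w [hw hn ez]]]] := PC_string i hz'.
have ze : z = cls LT (divF i n.+1 w).
  by rewrite e ez (qftilde_cls HT HLT) (ftilde_divF HT hw hn).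
(* The string does not end at n, because z = f~ z' is a nonzero class. *)
have hn1 : n.+1%:Z <= awt i la.
  rewrite leNgt; apply/negP => lt; have := PC_neq0 hz.
  by rewrite ze (divF_eq0 HT hw lt) cls0 eqxx.
by rewrite ze (qetilde_cls HT HLT) (etilde_divF HT hw hn1).
Qed.

Lemma qtens_crystal_basis_upto_pi : crystal_basis_upto_pi LT BB.
Proof.
split; [exact: HLT|exact: qtens_graded_pi_basis|exact: qtens_crystal_operators].
Qed.

Lemma qtens_crystal_basis :
  s = false \/ qpi L @` B `<=` B \/ qpi L' @` B' `<=` B' -> crystal_basis LT BB.
Proof.
move=> h; split; [exact: HLT|exact: qtens_graded_pi_basis|].
suff <- : pi_closure BB = BB by exact: qtens_crystal_operators.
rewrite predeqE => z; split=> [[//|[_ [b [b' [Bb Bb' ->]]] <-]]|hz]; last by left.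
case: h => [s0|[st|st]].
- by rewrite (qpiE hsT) s0 expr0 scale1r; exists b, b'.
- exists (qpi L b), b'; split=> //; first by apply: st; exists b.
  by rewrite qtens_qpil //; [exact: BL|exact: BL'].
exists b, (qpi L' b'); split=> //; first by apply: st; exists b'.
by rewrite qtens_qpir //; [exact: BL|exact: BL'].
Qed.
End TensorCrystal.

Theorem theorem4p12 (D : root_data) (s : bool) (M M' : Udata D)
    (L : Asubmod M) (L' : Asubmod M')
    (B : set (lquo L)) (B' : set (lquo L')) :
  in_Oint_pm s M -> in_Oint_pm s M' ->
  crystal_basis L B -> crystal_basis L' B' ->
  [/\ in_Oint_pm s (tensU M M'),
      crystal_basis_upto_pi (ltens L L') (qtens_set B B'),
      s = false \/ qpi L @` B `<=` B \/ qpi L' @` B' `<=` B' ->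
        crystal_basis (ltens L L') (qtens_set B B')
    & forall (i : rI D) (b : lquo L) (b' : lquo L'), B b -> B' b' ->
      qftilde (ltens L L') i (qtens b b') =
        (if (epsilon i b' < phi i b)%N then qtens (qftilde L i b) b'
         else iter (par i * parity b) (qpi (ltens L L'))
                (qtens b (qftilde L' i b')))
      /\
      qetilde (ltens L L') i (qtens b b') =
        (if (phi i b < epsilon i b')%N
         then iter (par i * parity b) (qpi (ltens L L'))
                (qtens b (qetilde L' i b'))
         else qtens (qetilde L i b) b')].
Proof.
move=> OM OM' cB cB'; split.
- exact: tensU_Oint_pm.
- exact: qtens_crystal_basis_upto_pi OM OM' cB cB'.
- exact: qtens_crystal_basis OM OM' cB cB'.
by move=> i b b' Bb Bb'; have [] := qtens_crystal_formula OM OM' cB cB' i Bb Bb'.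
Qed.
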